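(* Let $d\geq 2$ be an integer and let $G$ be a finite simple graph embedded in a surface of Euler characteristic $\varepsilon>0$. If $\Delta(G)\geq 5d+2$, then $C_{d,1}^T(G)\leq \Delta(G)+2d$.
   Context: $\Delta(G)$ is the maximum degree of $G$. A $(d,1)$-total labelling of $G$ is an assignment $c$ of integer labels (colors) to the elements of $V(G)\cup E(G)$ such that $c(u)\neq c(v)$ whenever $uv\in E(G)$, $c(e)\neq c(e')$ whenever $e,e'$ are distinct edges sharing an endpoint, and $|c(u)-c(e)|\geq d$ whenever vertex $u$ is incident with edge $e$. Given a list $L(x)$ of integers for each $x\in V(G)\cup E(G)$, an $L$-$(d,1)$-total labelling is a $(d,1)$-total labelling $c$ with $c(x)\in L(x)$ for all $x$. $G$ is $k$-$(d,1)$-total choosable if it has an $L$-$(d,1)$-total labelling for every list assignment $L$ with $|L(x)|=k$ for all $x\in V(G)\cup E(G)$. The $(d,1)$-total choosability $C_{d,1}^T(G)$ is the minimum $k$ such that $G$ is $k$-$(d,1)$-total choosable. *)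

(* Defs.v *)
From HB Require Import structures.
From mathcomp Require Import all_boot all_order all_algebra finmap.
From mathcomp Require Import all_classical all_reals all_analysis.

Set Implicit Arguments.
Unset Strict Implicit.
Unset Printing Implicit Defensive.

Import Order.TTheory GRing.Theory Num.Theory.
Import numFieldNormedType.Exports.

Local Open Scope ring_scope.

Record sgraph := SGraph {
  vertex :> finType;
  adj : rel vertex;
  adj_sym : symmetric adj;
  adj_irr : irreflexive adj }.

Definition edge_set (G : sgraph) : {set {set G}} :=
  [set [set p.1; p.2]%SET | p in [pred p : G * G | adj p.1 p.2]]%SET.

Definition edge (G : sgraph) := {A : {set G} | A \in edge_set G}.

Definition max_degree (G : sgraph) : nat :=
  (\max_(v : G) #|[pred w | adj v w]|)%N.

Definition element (G : sgraph) : finType := (G + edge G)%type.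

Definition total_labelling (d : nat) (G : sgraph) (c : element G -> int) : Prop :=
  [/\ forall u v : G, adj u v -> c (inl u) <> c (inl v),
      forall e e' : edge G, e != e' ->
        (val e :&: val e' != finset.set0)%SET -> c (inr e) <> c (inr e')
    & forall (u : G) (e : edge G), u \in val e ->
        d%:Z <= `|c (inl u) - c (inr e)|].

Definition total_choosable (d : nat) (G : sgraph) (k : nat) : Prop :=
  forall L : element G -> {fset int}, (forall x, #|` L x| = k) ->
  exists2 c : element G -> int, total_labelling d c & forall x, c x \in L x.

Lemma total_choosable_ex (d : nat) (G : sgraph) :
  exists k, `[< total_choosable d G k >].
Proof.
exists (#|element G| * d.*2.+1).+1; apply/asboolP => L Lk.
suff greedy (s : seq (element G)) : (size s <= #|element G|)%N -> uniq s ->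
    exists c : element G -> int, (forall x, x \in s -> c x \in L x) /\
      (forall x y, x \in s -> y \in s -> x != y -> d%:Z < `|c x - c y|).
  have [|c [cL cd]] := greedy (enum (element G)) _ (enum_uniq _).
    by rewrite -cardE.
  have far x y : x != y -> d%:Z < `|c x - c y|.
    by move=> xy; apply: cd; rewrite ?mem_enum.
  have neq x y : x != y -> c x <> c y.
    by move=> /far + cxy; rewrite cxy subrr normr0.
  exists c => [|x]; last by apply: cL; rewrite mem_enum.
  split=> [u v uv|e e' ee' _|u e _].
  - apply: neq; apply/eqP => -[uv']; move: uv.
    by rewrite uv' adj_irr.
  - by apply: neq; apply/eqP => -[eE]; rewrite eE eqxx in ee'.
  - by apply: ltW; apply: far.
elim: s => [|x s IHs]; first by move=> _ _; exists (fun=> 0).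
move=> /= szs /andP[xs us]; have [c [cL cd]] := IHs (ltnW szs) us.
pose bad := [seq c y + i%:Z - d%:Z | y <- s, i <- iota 0 d.*2.+1].
have [a aL abad] : exists2 a, a \in L x & a \notin bad.
  apply: contrapT => noa.
  have sub : {subset (L x : seq int) <= bad}.
    by move=> a aL; apply/negPn/negP => abad; apply: noa; exists a.
  have := uniq_leq_size (fset_uniq (L x)) sub.
  rewrite size_allpairs size_iota => /leq_trans/(_ (leq_mul (ltnW szs) (leqnn _))).
  by rewrite [X in (X <= _)%N](Lk x) ltnn.
have afar y : y \in s -> d%:Z < `|a - c y|.
  move=> ys; rewrite ltNge; apply/negP; rewrite ler_norml => /andP[la ua].
  move/negP: abad; apply; apply/allpairsP.
  have nn : 0 <= a - c y + d%:Z by rewrite -lerBlDr sub0r.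
  exists (y, absz (a - c y + d%:Z)); split=> //.
    rewrite mem_iota leq0n add0n ltnS andTb -lez_nat gez0_abs //.
    by rewrite -addnn PoszD lerD2r.
  by rewrite /= gez0_abs // addrA addrK addrC subrK.
exists (fun y => if y == x then a else c y); split=> [y|y z].
  by rewrite inE; case: eqP => [->|_ /= /cL].
rewrite !inE; case: eqP => [->|_]; case: eqP => [->|_] /=.
- by rewrite eqxx.
- by move=> _ /afar.
- by move=> /afar; rewrite distrC.
- exact: cd.
Qed.

Definition total_choosability (d : nat) (G : sgraph) : nat :=
  ex_minn (total_choosable_ex d G).

Section Complexes.
Variables (n : nat) (K : {set {set 'I_n}}).
Local Open Scope set_scope.

Definition simplicial_complex : Prop :=
  [/\ finset.set0 \notin K, forall v, [set v] \in K
    & forall s t : {set 'I_n}, s != finset.set0 -> s \subset t -> t \in K -> s \in K].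

(* Adjacency in the link of v, a graph on the neighbours of v. *)
Definition link_adj (v : 'I_n) : rel 'I_n :=
  [rel w w' | (#|[set v; w; w']| == 3%N) && ([set v; w; w'] \in K)].

(* A connected pure 2-dimensional complex in which every edge lies on exactly
   two triangles and every vertex link is connected, hence a cycle: the
   triangulations of connected closed surfaces, with vertex set 'I_n. *)
Definition closed_surface_complex : Prop :=
  [/\ simplicial_complex,
      forall s, s \in K -> exists t, [/\ t \in K, #|t| = 3%N & s \subset t],
      forall s, s \in K -> #|s| = 2%N ->
        #|[set t in K | (#|t| == 3%N) && (s \subset t)]| = 2%N,
      forall v w w', w != v -> w' != v -> [set v; w] \in K -> [set v; w'] \in K ->
        connect (link_adj v) w w'
    & forall v w, connect [rel a b | [set a; b] \in K] v w].

Definition complex_euler_char : int := \sum_(s in K) (-1) ^+ #|s|.-1.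

End Complexes.

Local Open Scope classical_set_scope.

(* The geometric realization, in barycentric coordinates. *)
Definition polyhedron (R : realType) (n : nat) (K : {set {set 'I_n}}) :
    set 'rV[R]_n :=
  [set x | [/\ forall i, 0 <= x ord0 i, \sum_i x ord0 i = 1
    & exists2 s, s \in K & forall i, i \notin s -> x ord0 i = 0]].
Arguments polyhedron R {n} K.

Definition homeomorphic (X Y : topologicalType) (A : set X) (B : set Y) : Prop :=
  exists (f : X -> Y) (g : Y -> X),
  [/\ {within A, continuous f} /\ {within B, continuous g},
      set_fun A B f, set_fun B A g,
      forall x, A x -> g (f x) = x & forall y, B y -> f (g y) = y].

Definition closed_surface (R : realType) (S : topologicalType) : Prop :=
  [/\ hausdorff_space S, compact [set: S], connected [set: S], [set: S] !=set0
    & forall p : S, exists (U : set S) (V : set 'rV[R]_2),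
        [/\ open U, U p, open V & homeomorphic U V]].

Definition has_euler_char (R : realType) (S : topologicalType) (eps : int) : Prop :=
  exists (n : nat) (K : {set {set 'I_n}}),
  [/\ closed_surface_complex K, homeomorphic (polyhedron R K) [set: S]
    & complex_euler_char K = eps].

(* Vertices are drawn as the distinct points pos v, and each edge e as the
   simple arc arc e restricted to [0, 1]; values outside [0, 1] are irrelevant. *)
Definition embedding (R : realType) (S : topologicalType) (G : sgraph)
    (pos : G -> S) (arc : edge G -> R -> S) : Prop :=
  [/\ injective pos,
      forall e : edge G,
        {within `[0, 1], continuous (arc e)} /\ set_inj `[0, 1] (arc e),
      forall e : edge G, exists u v : G,
        [/\ val e = [set u; v]%SET, arc e 0 = pos u & arc e 1 = pos v],
      forall (e : edge G) (t : R) (v : G), `]0, 1[ t -> arc e t <> pos v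
    & forall (e e' : edge G) (t t' : R), e != e' ->
        `]0, 1[ t -> `]0, 1[ t' -> arc e t <> arc e' t'].

Definition embedded_in (R : realType) (G : sgraph) (S : topologicalType) : Prop :=
  exists (pos : G -> S) (arc : edge G -> R -> S), embedding pos arc.

(* Main.v *)
(** A graph with edge set A and vertex set U that is a minor of a triangulated
closed surface T with H^1(T; F_2) of order at most 2 satisfies |A| <= |U| or
|A| + 1 <= |U| + f, where f counts the nonzero boundaries of the classes of
triangles that can be joined without crossing the minor: a cochain on A that is
orthogonal to these boundaries extends to a cocycle of T. The boundaries are
even sets of edges and every edge lies in at most two of them, so |A| <= 3|U| - 3,
and |A| <= 2|U| - 2 if A is bipartite.

Subdividing each triangle of a triangulation of the surface into N^2 triangles,
the two triangles at an edge and the bound on H^1 survive (the ladder argument in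
each triangle), and a closed surface with positive Euler characteristic has at most
one nontrivial class in H^1. The vertices of the subdivision close to a connected
set form a connected set, and disjoint compact sets stay disjoint when N is large,
so cutting every arc of an embedding into three pieces shows that the graph is a
minor of a fine subdivision. No Jordan curve theorem is needed.

For the labelling, let M be the maximum degree and remove an edge uv from a
smallest graph without a labelling. If deg u <= 3, uncolour u, label uv and then u;
if deg u = 4, relabel u and then label uv; if deg u = 5, uncolour u and a second
edge uw, and relabel u, uv, uw. Hence neighbours of 3-vertices have degree M,
neighbours of 4-vertices have degree at least M - 2d >= 8, and all but one of the
neighbours of a 5-vertex have degree at least M - 2d - 1 >= 7. The bipartite bound
applied to the edges at 3-vertices, at 3- and 4-vertices, and at 3-, 4- and
5-vertices then contradicts the bound on the number of all edges. *)

From mathcomp Require Import all_boot all_order all_algebra finmap boolp.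
From mathcomp Require Import zify ring lra.
Require Import Defs.

Set Implicit Arguments.
Unset Strict Implicit.
Unset Printing Implicit Defensive.

Import Order.TTheory GRing.Theory Num.Theory.
Local Open Scope ring_scope.

(** No quotient space or dimension is formed. A subspace is a finite set closed under addition, a
    rank is an exponent of 2, and the condition on [H^1] reads: among two cocycles and their sum one
    is a coboundary. In this shape it passes from the surface to a subdivision and can be used on a
    minor. The faces of the minor are merely components of a dual graph, so nothing about discs or
    boundary walks has to be known; evenness of the boundaries is all that the girth argument asks
    for.

    The projective plane forces the order 2, and this costs a constant: [3|U| - 3] instead of the
    planar [3|U| - 6]. The discharging only needs some positive deficit, since its weights balance
    exactly. Give a vertex of degree [k] the excess [k - 6]. Degrees 3, 4, 5 lack 3, 2, 1; degree 7
    can give 1, degrees from 8 on can give 2, and degrees from [M] on can give [2 + 4], which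
    requires [M >= 12], the value of [5d + 2] at [d = 2]. The thresholds 8 and 7 are [M - 2d] and
    [M - 2d - 1] at the same values. *)

Local Notation F2 := 'F_2.

(** * Counting in F_2-vector spaces *)

Lemma F2_addxx (x : F2) : x + x = 0.
Proof. by apply: addrr_pchar2; rewrite pchar_Fp. Qed.

Lemma F2_cases (x : F2) : x = 0 \/ x = 1.
Proof. by case: x => [[|[|?]] //= ?]; [left|right]; apply: val_inj. Qed.

Lemma ffF2_addxx (I : finType) (f : {ffun I -> F2}) : f + f = 0.
Proof. by apply/ffunP => i; rewrite !ffunE F2_addxx. Qed.

Lemma F2_natr (n : nat) : (n%:R : F2) = (odd n)%:R.
Proof.
rewrite -[in LHS](odd_double_half n) natrD -addnn natrD F2_addxx addr0 //.
Qed.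

Lemma F2_natr_eq0 (n : nat) : ((n%:R : F2) == 0) = ~~ odd n.
Proof. by rewrite F2_natr; case: odd. Qed.

Section Counting.
Variables (I : finType).
Implicit Types (A C : {set {ffun I -> F2}}) (D : {set I}).

(** A copy of [F_2^D] inside one ambient function space, so that cochains on different edge sets
    share a type. *)
Definition supp_in D := [set f : {ffun I -> F2} | [forall i, (i \notin D) ==> (f i == 0)]].

Lemma supp_inP D (f : {ffun I -> F2}) :
  reflect (forall i, i \notin D -> f i = 0) (f \in supp_in D).
Proof.
rewrite inE; apply: (iffP forallP) => h i; first by move=> iD; move: (h i); rewrite iD => /eqP.
by apply/implyP => /h ->.
Qed.

Lemma card_supp_in D : #|supp_in D| = (2 ^ #|D|)%N.
Proof.
have -> : supp_in D = [set f in pffun_on (0 : F2) (mem D) (predT)].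
  apply/setP => f; rewrite !inE; apply/forallP/pffun_onP => [h|[/subsetP h _] i].
    split=> [|y]; last by [].
    apply/subsetP => i; rewrite inE; apply: contraNT => iD.
    by move: (h i); rewrite iD.
  by apply/implyP; apply: contraNT => fi; apply: h; rewrite inE.
by rewrite cardsE card_pffun_on card_Fp.
Qed.

Lemma supp_in_add D f g : f \in supp_in D -> g \in supp_in D -> f + g \in supp_in D.
Proof.
by move=> /supp_inP fD /supp_inP gD; apply/supp_inP => i iD; rewrite ffunE fD ?gD ?addr0.
Qed.

(** Rank-nullity as a count: each fibre of [h] over its image is a translate of the kernel. In
    characteristic 2, closure under addition makes a nonempty [A] a subgroup. *)
Lemma card_image_ker (J : finType) (h : {ffun I -> F2} -> {ffun J -> F2}) A :
    (forall f g, f \in A -> g \in A -> f + g \in A) ->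
    {morph h : f g / f + g} ->
  #|A| = (#|h @: A| * #|[set f in A | h f == 0%R]|)%N.
Proof.
move=> Aadd hadd.
rewrite -sum1_card (partition_big_imset h) /= -sum_nat_const.
apply: eq_bigr => _ /imsetP[f0 f0A ->].
rewrite sum1dep_card -(card_imset _ (addrI f0)).
apply: eq_card => f; rewrite !inE; apply/imsetP/andP => [[g]|[fA /eqP hf]].
  rewrite inE => /andP[gA /eqP hg ->]; rewrite Aadd // hadd hg.
  by rewrite ffF2_addxx.
exists (f0 + f); last by rewrite addrA ffF2_addxx add0r.
by rewrite inE Aadd //= hadd hf addr0.
Qed.

(** Once some [f0] of [Z] is outside [B], the hypothesis puts every [f] of [Z] into [B] or
    [f0 + B]. *)
Lemma card_index2 (Z B : {set {ffun I -> F2}}) :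
    (forall f g, f \in Z -> g \in Z -> [|| f \in B, g \in B | f + g \in B]) ->
  (#|Z| <= 2 * #|B|)%N.
Proof.
move=> h; have [ZB|] := boolP (Z \subset B); first by have := subset_leq_card ZB; lia.
case/subsetPn => f0 f0Z f0B.
have sub : Z \subset B :|: [set f0 + g | g in B].
  apply/subsetP => f fZ; rewrite inE; move: (h _ _ f0Z fZ); rewrite (negPf f0B) /=.
  case/orP => [->//|fB]; apply/orP; right; apply/imsetP; exists (f0 + f) => //.
  by rewrite addrA ffF2_addxx add0r.
apply: leq_trans (subset_leq_card sub) _; rewrite cardsU.
apply: leq_trans (leq_subr _ _) _; rewrite card_imset; last exact: addrI.
by rewrite addnn mul2n.
Qed.

(** If all three memberships failed, the cosets of [B] through [0], [f] and [g] would be pairwise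
    disjoint subsets of [Z], giving [3|B| <= |Z|]. *)
Lemma index2_card (Z B : {set {ffun I -> F2}}) :
    (forall f g, f \in Z -> g \in Z -> f + g \in Z) ->
    (forall f g, f \in B -> g \in B -> f + g \in B) -> B \subset Z ->
    0 \in B -> (#|Z| <= 2 * #|B|)%N ->
  forall f g, f \in Z -> g \in Z -> [|| f \in B, g \in B | f + g \in B].
Proof.
move=> Zadd Badd /subsetP BZ B0 ZB f g fZ gZ; apply: contraLR ZB.
rewrite !negb_or -ltnNge => /and3P[fB gB fgB].
pose tr (x : {ffun I -> F2}) := [set x + y | y in B].
have trP x y : reflect (y + x \in B) (y \in tr x).
  apply: (iffP imsetP) => [[z zB ->]|yx]; first by rewrite addrAC ffF2_addxx add0r.
  by exists (y + x) => //; rewrite addrC -addrA ffF2_addxx addr0.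
have card_tr x : #|tr x| = #|B| by rewrite card_imset //; exact: addrI.
have dis x y : x + y \notin B -> [disjoint tr x & tr y].
  move=> xy; apply/pred0P => z /=; apply/negbTE/andP => -[/trP zx /trP zy].
  move/negP: xy; apply; have := Badd _ _ zx zy.
  by rewrite addrACA ffF2_addxx add0r.
have tr_sub x : x \in Z -> tr x \subset Z.
  by move=> xZ; apply/subsetP => _ /imsetP[y yB ->]; apply: Zadd => //; apply: BZ.
have sub : tr 0 :|: (tr f :|: tr g) \subset Z.
  by rewrite !subUset !tr_sub //; apply: BZ.
apply: leq_trans (subset_leq_card sub).
have dis0 x y : x + y \notin B -> tr x :&: tr y = set0.
  by move=> /dis; rewrite -setI_eq0 => /eqP.
have d1 : tr 0 :&: (tr f :|: tr g) = set0.
  by rewrite setIUr !dis0 ?add0r // setU0.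
have Bgt : (0 < #|B|)%N by apply/card_gt0P; exists 0.
have d2 := dis0 _ _ fgB.
rewrite cardsU d1 cardsU d2 !cards0 !card_tr !subn0.
by move: Bgt; move: #|B| => b; lia.
Qed.

Lemma card_sum0 D : (0 < #|D|)%N ->
  (2 * #|[set f in supp_in D | (\sum_(i in D) f i == 0)%R]| = 2 ^ #|D|)%N.
Proof.
case/card_gt0P => i0 i0D; rewrite -card_supp_in.
pose h (f : {ffun I -> F2}) : {ffun unit -> F2} := [ffun _ => \sum_(i in D) f i].
have hadd : {morph h : f g / f + g}.
  move=> f g; apply/ffunP => u; rewrite !ffunE -big_split /=.
  by apply: eq_bigr => i _; rewrite ffunE.
rewrite (card_image_ker (@supp_in_add D) hadd); congr (_ * _)%N.
  have -> : h @: supp_in D = setT.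
    apply/setP => k; rewrite inE; apply/imsetP.
    exists [ffun i => if i == i0 then k tt else 0].
      by apply/supp_inP => i iD; rewrite ffunE; case: eqP => // ii; rewrite ii i0D in iD.
    apply/ffunP => -[]; rewrite ffunE (bigD1 i0) //= ffunE eqxx big1 ?addr0 // => i /andP[_ /negPf ii].
    by rewrite ffunE ii.
  by rewrite cardsT card_ffun card_Fp // card_unit.
apply: eq_card => f; rewrite !inE; congr (_ && _).
apply/eqP/eqP => [s|/ffunP/(_ tt)]; last by rewrite !ffunE.
by apply/ffunP => u; rewrite !ffunE.
Qed.
End Counting.

(** * Cochains of triangulated surfaces *)

Section Cochains.
Variables (W : finType) (E F : {set {set W}}).

Definition cob0 (f : W -> F2) (e : {set W}) : F2 := \sum_(w in e) f w.
Definition cob1 (phi : {set W} -> F2) (t : {set W}) : F2 :=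
  \sum_(e in E | e \subset t) phi e.

Definition cocycle (phi : {set W} -> F2) := forall t, t \in F -> cob1 phi t = 0.
Definition coboundary (phi : {set W} -> F2) :=
  exists f, forall e, e \in E -> phi e = cob0 f e.

Definition two_sided :=
  [/\ forall e, e \in E -> #|e| = 2%N, forall t, t \in F -> #|t| = 3%N,
      forall t e : {set W}, t \in F -> e \subset t -> #|e| = 2%N -> e \in E
    & forall e, e \in E -> #|[set t in F | e \subset t]| = 2%N].

(* H^1 with coefficients in F_2 has at most two elements. *)
Definition H1_index_le2 := forall phi psi, cocycle phi -> cocycle psi ->
  [\/ coboundary phi, coboundary psi | coboundary (fun e => phi e + psi e)].

(** [D] holds the edges that may be crossed; the components of this graph on [F] are the regions
    left after cutting along all other edges. *)
Definition dual_adj (D : {set {set W}}) : rel {set W} :=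
  [rel t t' | [&& t \in F, t' \in F & [exists e in D, (e \subset t) && (e \subset t')]]].

Hypothesis EF : two_sided.

Lemma cob0_pair f x y : x != y -> cob0 f [set x; y] = f x + f y.
Proof. by move=> xy; rewrite /cob0 big_setU1 ?inE //= big_set1. Qed.

Lemma cob1_triangle phi x y z : [set x; y; z] \in F -> x != y -> y != z -> x != z ->
  cob1 phi [set x; y; z] = phi [set x; y] + phi [set y; z] + phi [set x; z].
Proof.
case: EF => E2 _ FE _ tF xy yz xz.
have sub3 : [set e in E | e \subset [set x; y; z]] =
    [set [set x; y]] :|: ([set [set y; z]] :|: [set [set x; z]]).
  have inE3 u v : u != v -> u \in [set x; y; z] -> v \in [set x; y; z] ->
      ([set u; v] \in E) && ([set u; v] \subset [set x; y; z]).
    move=> uv ut vt; have sub : [set u; v] \subset [set x; y; z].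
      by rewrite subUset !sub1set ut vt.
    by rewrite sub (FE _ _ tF sub) // cards2 uv.
  apply/setP => e; rewrite !inE; apply/andP/idP => [[eE sub]|].
    have /eqP/cards2P[u [v [uv ee]]] := E2 _ eE; subst e.
    move: sub; rewrite subUset !sub1set !inE => /andP[ut vt].
    have sw a b : ([set a; b] == [set b; a :> W]) by rewrite setUC.
    move: uv; case/orP: ut => [/orP[]|] /eqP ->; case/orP: vt => [/orP[]|] /eqP ->;
      by rewrite ?eqxx ?sw ?orbT.
  by case/or3P => /eqP ->; apply/andP; apply: inE3 => //; rewrite !inE eqxx ?orbT.
have -> : cob1 phi [set x; y; z] = \sum_(e in [set e in E | e \subset [set x; y; z]]) phi e.
  by apply: eq_bigl => e; rewrite inE.
have neq (A B : {set W}) u : u \in A -> u \notin B -> A != B.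
  by move=> uA; apply: contraNneq => <-.
rewrite sub3 big_setU1 /=; last first.
  rewrite !inE negb_or; apply/andP; split.
    by apply: (neq _ _ x); rewrite !inE ?eqxx // negb_or xy xz.
  by apply: (neq _ _ y); rewrite !inE ?eqxx ?orbT // negb_or eq_sym xy yz.
rewrite big_setU1 ?big_set1 ?addrA //= inE.
by apply: (neq _ _ y); rewrite !inE ?eqxx // negb_or eq_sym xy yz.
Qed.

Lemma triangleP t : t \in F -> exists x y z, [/\ t = [set x; y; z], x != y, y != z & x != z].
Proof.
case: EF => _ F3 _ _ /F3 t3.
have [x xt] : exists x, x \in t by apply/card_gt0P; rewrite t3.
have /cards2P[y [z [yz tE]]] : #|t :\ x| == 2%N by have := cardsD1 x t; rewrite t3 xt; lia.
exists x, y, z; split=> //.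
- by rewrite -setUA -tE setD1K.
- have : y \in t :\ x by rewrite tE !inE eqxx.
  by rewrite !inE eq_sym => /andP[].
- have : z \in t :\ x by rewrite tE !inE eqxx orbT.
  by rewrite !inE eq_sym => /andP[].
Qed.

Lemma cob1_cob0 f t : t \in F -> cob1 (cob0 f) t = 0.
Proof.
move=> tF; case: (triangleP tF) => x [y [z [te xy yz xz]]]; subst t.
rewrite cob1_triangle // !cob0_pair //.
have -> : f x + f y + (f y + f z) + (f x + f z) = (f x + f x) + (f y + f y) + (f z + f z) by ring.
by rewrite !F2_addxx.
Qed.

Lemma cob1D phi psi t : cob1 (fun e => phi e + psi e) t = cob1 phi t + cob1 psi t.
Proof. exact: big_split. Qed.

Lemma cob1_sum (I : finType) (P : pred I) (c : I -> F2) (x : I -> {set W} -> F2) t :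
  cob1 (fun e => \sum_(i | P i) c i * x i e) t = \sum_(i | P i) c i * cob1 (x i) t.
Proof.
by rewrite /cob1 exchange_big /=; apply: eq_bigr => i _; rewrite mulr_sumr.
Qed.

Lemma cob1_indicator e0 t : e0 \in E -> cob1 (fun e => (e == e0)%:R) t = (e0 \subset t)%:R.
Proof.
move=> eE; rewrite /cob1 big_mkcond /= (bigD1 e0) //= eqxx eE /=.
rewrite big1 ?addr0 => [|e /negPf ->]; last by case: ifP.
by case: ifP.
Qed.

Lemma cob1_connect (D : {set {set W}}) t t' : D \subset E -> connect (dual_adj D) t t' ->
  exists x : {set W} -> F2, (forall e, e \notin D -> x e = 0) /\
    forall s, s \in F -> cob1 x s = (s == t)%:R + (s == t')%:R.
Proof.
case: EF => E2 _ FE EF2 /subsetP DE /connectP[p]; elim: p t => [|u p IHp] t /=.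
  move=> _ ->; exists (fun=> 0); split=> // s _.
  by rewrite F2_addxx /cob1 big1.
case/andP => /and3P[tF uF /existsP[e /and3P[eD et eu]]] pth lst.
have [x [xD xs]] := IHp _ pth lst.
(* A dual step may stay at the same triangle; it then crosses nothing. *)
have [tu|tu] := eqVneq t u; first by rewrite tu; exists x.
exists (fun e' => (e' == e)%:R + x e'); split=> [e' e'D|s sF].
  rewrite xD // addr0; case: eqP => // ee; by rewrite ee eD in e'D.
rewrite cob1D cob1_indicator ?DE // xs //.
suff -> : (e \subset s)%:R = (s == t)%:R + (s == u)%:R :> F2.
  by rewrite addrA; congr (_ + _); rewrite -addrA F2_addxx addr0.
have tuE : [set t; u] = [set t in F | e \subset t].
  apply/eqP; rewrite eqEcard EF2 ?DE // cards2 tu andbT.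
  by rewrite subUset !sub1set !inE tF uF et eu.
have /setP/(_ s) := tuE; rewrite !inE sF /= => <-.
by have [->|st] := eqVneq s t; rewrite ?(negPf tu) ?addr0 ?add0r.
Qed.

(* Solvability on the dual graph: a prescribed coboundary with zero sum on each
   component is moved to a root of the component, where it cancels. *)
Lemma cob1_solve (D : {set {set W}}) (k : {set W} -> F2) : D \subset E ->
    (forall t0, t0 \in F -> \sum_(t in F | connect (dual_adj D) t0 t) k t = 0) ->
  exists x : {set W} -> F2, (forall e, e \notin D -> x e = 0) /\ forall s, s \in F -> cob1 x s = k s.
Proof.
move=> DE k0.
have sym : connect_sym (dual_adj D).
  apply: sym_connect_sym => t t'; rewrite /dual_adj /= andbCA; do 2 congr (_ && _).
  by apply: eq_existsb => e; congr (_ && _); rewrite andbC.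
pose rt t := fingraph.root (dual_adj D) t.
have ex t : exists x : {ffun {set W} -> F2}, (forall e, e \notin D -> x e = 0) /\
    forall s, s \in F -> cob1 x s = (s == t)%:R + (s == rt t)%:R.
  have [x [xD xs]] := cob1_connect DE (connect_root (dual_adj D) t).
  exists (finfun x); split=> [e eD|s sF]; first by rewrite ffunE xD.
  by rewrite -xs //; apply: eq_bigr => e _; rewrite ffunE.
have [x xP] := fin_all_exists ex.
exists (fun e => \sum_(t in F) k t * x t e); split=> [e eD|s sF].
  by rewrite big1 // => t _; have [-> ] := xP t; rewrite ?mulr0.
rewrite cob1_sum (eq_bigr (fun t => k t * (s == t)%:R + k t * (s == rt t)%:R)); last first.
  by move=> t _; have [_ ->] := xP t; rewrite ?mulrDr.
rewrite big_split /= (bigD1 s) //= eqxx mulr1 big1 ?addr0; last first.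
  by move=> t /andP[_ /negPf]; rewrite eq_sym => ->; rewrite mulr0.
(* The remaining term is the total of [k] over the component of [s] if [s] is its root, and
   otherwise has no nonzero summand. *)
rewrite [X in _ + X](_ : _ = 0) ?addr0 //.
have [sr|sr] := boolP (rt s == s); last first.
  rewrite big1 // => t tF; case: eqP => [st|]; rewrite ?mulr0 //.
  by move: sr; rewrite st /rt root_root // eqxx.
rewrite -[RHS](k0 s sF) [RHS]big_mkcondr; apply: eq_bigr => t _.
rewrite -(root_connect sym) -/(rt s) -/(rt t) (eqP sr).
by case: eqP; rewrite ?mulr1 ?mulr0.
Qed.

End Cochains.

(** * Minors of triangulated surfaces *)

Definition fiber_adj (W V : finType) (E : {set {set W}}) (beta : W -> option V) (v : V) : rel W :=
  [rel x y | [&& beta x == Some v, beta y == Some v & [set x; y] \in E]].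

(* The graph with edge set A is a minor of the graph (W, E): beta x is the
   branch set containing x, if any. *)
Definition minor_model (W V : finType) (E : {set {set W}}) (A : {set {set V}})
    (beta : W -> option V) :=
  (forall x y v, beta x = Some v -> beta y = Some v -> connect (fiber_adj E beta v) x y) /\
  (forall e, e \in A -> exists x y u v,
     [/\ [set x; y] \in E, e = [set u; v], beta x = Some u & beta y = Some v]).

(** Membership in the cycle space over [F_2]. *)
Definition even_edge_set (V : finType) (B : {set {set V}}) :=
  forall v, ~~ odd #|[set e in B | v \in e]|.

Lemma sum_bool_card (T : finType) (A : {set T}) (P : pred T) :
  (\sum_(x in A) P x = #|[set x in A | P x]|)%N.
Proof.
rewrite -sum1_card [RHS](eq_bigl (fun x => (x \in A) && P x)) => [|x]; last by rewrite inE.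
by rewrite big_mkcondr; apply: eq_bigr => x _; case: (P x).
Qed.

Section MinorBound.
Variables (W V : finType) (E F : {set {set W}}) (A : {set {set V}}) (U : {set V}).
Variables (beta : W -> option V) (hat : {set V} -> {set W}).
Hypothesis EF : two_sided E F.
Hypothesis H1 : H1_index_le2 E F.
Hypothesis A2 : forall e, e \in A -> #|e| = 2%N.
Hypothesis AU : forall e, e \in A -> e \subset U.
Hypothesis U0 : (0 < #|U|)%N.
Hypothesis beta_conn : forall x y v,
  beta x = Some v -> beta y = Some v -> connect (fiber_adj E beta v) x y.
Hypothesis hatP : forall e, e \in A -> exists x y u v,
  [/\ hat e = [set x; y] /\ [set x; y] \in E, e = [set u; v], beta x = Some u & beta y = Some v].

(** [Eint] disappears when branch sets are contracted, and [hat @: A] draws the minor. [D] is what a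
    face may cross, so a face is a component of [dual], represented by its root in [R0]. As [c t h]
    counts mod 2 the triangles at [h] in the face of [t], the cochain [b t] is the boundary of that
    face. *)
Let Eint := [set h in E | [exists v, [forall x in h, beta x == Some v]]].
Let D := E :\: (Eint :|: hat @: A).
Let dual := dual_adj F D.
Let R0 := [set t in F | fingraph.root dual t == t].
Let c (t h : {set W}) : F2 := \sum_(s in F | connect dual t s) (h \subset s)%:R.
Let b t e := c t (hat e).
Let supp_b t := [set e in A | b t e != 0].
Let I' := [set t in R0 | supp_b t != set0].

Let DE : D \subset E. Proof. exact: subsetDl. Qed.

Let dual_sym : connect_sym dual.
Proof.
apply: sym_connect_sym => t t'; rewrite /dual /dual_adj /= andbCA; do 2 congr (_ && _).
by apply: eq_existsb => e; congr (_ && _); rewrite andbC.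
Qed.

Let rootF t : t \in F -> fingraph.root dual t \in F.
Proof.
move=> tF; have := connect_root dual t; move: (fingraph.root dual t) => r /connectP[p].
elim: p t tF => [|u p IHp] t tF /=; first by move=> _ ->.
by case/andP => /and3P[_ uF _] /(IHp _ uF).
Qed.

Let hat_ends e : e \in A -> exists x y u v, [/\ hat e = [set x; y], [set x; y] \in E,
  e = [set u; v], beta x = Some u & beta y = Some v] /\ x != y /\ u != v.
Proof.
move=> eA; have [x [y [u [v [[he hE] eE bx By]]]]] := hatP eA.
exists x, y, u, v; split; first by split.
have [E2 _ _ _] := EF.
by move: (E2 _ hE) (A2 eA); rewrite eE !cards2; do 2!case: eqP.
Qed.

Let hatE e : e \in A -> hat e \in E.
Proof. by move=> /hat_ends[x [y [u [v [[-> ]]]]]]. Qed.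

(** An edge is read off from its representative as the set of branch labels of the two ends. *)
Let hat_inj : {in A &, injective hat}.
Proof.
have rec e : e \in A -> e = [set v | Some v \in beta @: hat e].
  case/hat_ends => x [y [u [v [[-> _ -> bx By] _]]]].
  by apply/setP => w; rewrite imsetU1 imset_set1 bx By !inE !(inj_eq Some_inj).
by move=> e e' eA e'A hee; rewrite (rec _ eA) (rec _ e'A) hee.
Qed.

Let hatNint e : e \in A -> hat e \notin Eint.
Proof.
case/hat_ends => x [y [u [v [[-> _ _ bx By] [_ uv]]]]]; rewrite inE negb_and orbC.
apply/orP; left; apply/existsPn => w; apply/forallPn.
have [uw|uw] := eqVneq u w.
  by exists y; rewrite negb_imply !inE eqxx orbT By -uw (inj_eq Some_inj) eq_sym.
by exists x; rewrite negb_imply !inE eqxx bx (inj_eq Some_inj).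
Qed.

(** The two triangles at a crossable edge lie in the same face and cancel. *)
Let c_D t h : t \in F -> h \in D -> c t h = 0.
Proof.
move=> tF hD; have hE := subsetP DE _ hD.
have [_ _ _ EF2] := EF; have /eqP/cards2P[s [s' [ss' sE]]] := EF2 _ hE.
have [sF s'F hs hs'] : [/\ s \in F, s' \in F, h \subset s & h \subset s'].
  have : s \in [set t in F | h \subset t] by rewrite sE !inE eqxx.
  have : s' \in [set t in F | h \subset t] by rewrite sE !inE eqxx orbT.
  by rewrite !inE => /andP[-> ->] /andP[-> ->].
have conn : connect dual t s = connect dual t s'.
  apply: same_connect_r => //; apply: connect1.
  by rewrite /dual /dual_adj /= sF s'F; apply/existsP; exists h; rewrite hD hs hs'.
rewrite /c (eq_bigr (fun s0 : {set W} => if h \subset s0 then 1 else (0 : F2))); last first.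
  by move=> s0 _; case: (h \subset s0).
rewrite -big_mkcondr /=.
transitivity (\sum_(s in [set t in F | h \subset t] | connect dual t s) (1 : F2)).
  by apply: eq_bigl => x; rewrite !inE andbAC.
rewrite sE big_mkcondr big_setU1 ?inE //= big_set1 conn.
exact: F2_addxx.
Qed.

(** Summation by parts over a face: edges of [D] cancel by [c_D], those of [Eint] by hypothesis, and
    only the drawn edges remain. *)
Let pairing t (phi : {set W} -> F2) : t \in F -> (forall h, h \in Eint -> phi h = 0) ->
  \sum_(s in F | connect dual t s) cob1 E phi s = \sum_(e in A) phi (hat e) * b t e.
Proof.
move=> tF phi0.
transitivity (\sum_(h in E) phi h * c t h).
  rewrite /cob1 /c; under eq_bigr do rewrite big_mkcondr /=.
  rewrite exchange_big /=; apply: eq_bigr => h _; rewrite mulr_sumr.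
  by apply: eq_bigr => s _; case: ifP; rewrite ?mulr1 ?mulr0.
rewrite (bigID (mem (hat @: A))) /= [X in _ + X]big1 ?addr0.
  rewrite -(big_imset (fun h => phi h * c t h) hat_inj) /=.
  apply: eq_bigl => h; apply/andP/idP => [[]//|hA]; split=> //.
  by case/imsetP: hA => e eA ->; exact: hatE.
move=> h /andP[hE hA]; have [hint|hint] := boolP (h \in Eint); first by rewrite phi0 ?mul0r.
by rewrite c_D ?mulr0 // in_setD in_setU negb_or hint hA hE.
Qed.

(** Pair the boundary with the coboundary of the indicator of branch set [v]: this cocycle vanishes
    on [Eint] and is the incidence with [v] on the drawn edges. *)
Let b_supp_even t : t \in F -> even_edge_set (supp_b t).
Proof.
move=> tF v; rewrite -F2_natr_eq0.
pose f w : F2 := (beta w == Some v)%:R.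
have int0 h : h \in Eint -> cob0 f h = 0.
  rewrite inE => /andP[hE /existsP[u /forallP hu]].
  have [E2 _ _ _] := EF; have /eqP/cards2P[x [y [xy hxy]]] := E2 _ hE; subst h.
  rewrite cob0_pair // /f; have := hu x; have := hu y.
  by rewrite !inE !eqxx orbT /= => /eqP -> /eqP ->; exact: F2_addxx.
have := pairing tF int0; rewrite big1; last first.
  by move=> s /andP[sF _]; exact: (cob1_cob0 EF).
move=> /esym sum0; apply/eqP; rewrite -[RHS]sum0.
have -> : #|[set e in supp_b t | v \in e]| = (\sum_(e in A) ((v \in e) && (b t e != 0%R)))%N.
  rewrite sum_bool_card; apply: eq_card => e; rewrite !inE.
  by rewrite -andbA; congr (_ && _); rewrite andbC.
rewrite natr_sum; apply: eq_bigr => e eA.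
have -> : cob0 f (hat e) = (v \in e)%:R.
  have [x [y [u [w [[-> _ -> bx By] [xy uw]]]]]] := hat_ends eA.
  rewrite cob0_pair // /f bx By !(inj_eq Some_inj) !inE [v == u]eq_sym [v == w]eq_sym.
  have [<-|] := eqVneq u v; last by rewrite add0r.
  by rewrite eq_sym (negPf uw) addr0.
by case: (v \in e); rewrite ?mul0r // mul1r; case: (F2_cases (b t e)) => ->.
Qed.

(** A face with [e] in its boundary contains one of the two triangles at [hat e]. *)
Let b_root_count e : e \in A -> (#|[set t in I' | b t e != 0%R]| <= 2)%N.
Proof.
move=> eA; have [_ _ _ EF2] := EF; rewrite -[leqRHS](EF2 _ (hatE eA)).
apply: leq_trans (leq_imset_card (fingraph.root dual) _).
apply: subset_leq_card; apply/subsetP => t; rewrite !inE => /andP[/andP[/andP[tF /eqP tr] _]].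
apply: contraNT => nt; rewrite /b /c big1 // => s /andP[sF ts].
case: (boolP (hat e \subset s)) => // hs; case/negP: nt; apply/imsetP; exists s.
  by rewrite inE sF.
by rewrite -tr; apply/eqP; rewrite root_connect.
Qed.

(** Over all faces together, [hat e] is counted once for each of its two triangles. *)
Let sum_b e : e \in A -> \sum_(t in R0) b t e = 0.
Proof.
move=> eA; rewrite /b /c; under eq_bigr do rewrite big_mkcondr /=.
rewrite exchange_big /= (eq_bigr (fun s : {set W} => (hat e \subset s)%:R : F2)); last first.
  move=> s sF; rewrite (bigD1 (fingraph.root dual s)) /=; last first.
    by rewrite inE rootF //= root_root.
  rewrite dual_sym connect_root big1 ?addr0 // => t /andP[].
  rewrite inE => /andP[_ /eqP tr] ts; case: ifP => //.
  by rewrite -(root_connect dual_sym) tr => /eqP ts'; rewrite ts' eqxx in ts.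
have [_ _ _ EF2] := EF; rewrite -natr_sum sum_bool_card (EF2 _ (hatE eA)).
by apply/eqP; rewrite F2_natr_eq0.
Qed.

Let h (phi : {ffun {set V} -> F2}) : {ffun {set W} -> F2} :=
  [ffun t => if t \in R0 then \sum_(e in A) phi e * b t e else 0].

Let h_add : {morph h : f g / f + g}.
Proof.
move=> f g; apply/ffunP => t; rewrite !ffunE; case: ifP => _; rewrite ?addr0 //.
by rewrite -big_split; apply: eq_bigr => e _; rewrite ffunE mulrDl.
Qed.

Let h_image : h @: supp_in A \subset [set k in supp_in I' | \sum_(t in I') k t == 0].
Proof.
apply/subsetP => _ /imsetP[phi phiA ->].
have hI : h phi \in supp_in I'.
  apply/supp_inP => t; rewrite inE ffunE; case: ifP => // _ /=.
  rewrite negbK => /eqP st; rewrite big1 // => e eA.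
  have : e \notin supp_b t by rewrite st inE.
  by rewrite inE eA /= negbK => /eqP ->; rewrite mulr0.
rewrite inE hI /=; apply/eqP; transitivity (\sum_(t in R0) h phi t).
  rewrite [RHS](bigID (mem I')) /= [X in _ + X]big1 ?addr0.
    apply: eq_bigl => t; apply/idP/andP => [tI|[]//]; split=> //.
    by move: tI; rewrite inE => /andP[].
  by move=> t /andP[_ tI]; move/supp_inP: hI; apply.
transitivity (\sum_(t in R0) \sum_(e in A) phi e * b t e).
  by apply: eq_bigr => t tR; rewrite ffunE tR.
by rewrite exchange_big big1 //= => e eA; rewrite -mulr_sumr sum_b ?mulr0.
Qed.

Let extends (phi : {ffun {set V} -> F2}) (Phi : {set W} -> F2) :=
  [/\ cocycle E F Phi, forall h, h \in Eint -> Phi h = 0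
    & forall e, e \in A -> Phi (hat e) = phi e].

(** [k] is the coboundary of [phi] extended by zero from the drawn edges. Since [phi] pairs to zero
    with every face boundary, [k] sums to zero on each face, and [cob1_solve] cancels it by a
    correction supported on [D]. *)
Let ker_extends (phi : {ffun {set V} -> F2}) : phi \in [set phi in supp_in A | h phi == 0] -> exists Phi, extends phi Phi.
Proof.
rewrite inE => /andP[_ /eqP hphi].
pose k (t : {set W}) : F2 := \sum_(e in A | hat e \subset t) phi e.
have sumk t : \sum_(s in F | connect dual t s) k s = \sum_(e in A) phi e * b t e.
  rewrite /k; under eq_bigr do rewrite big_mkcondr /=.
  rewrite exchange_big /=; apply: eq_bigr => e _; rewrite mulr_sumr.
  by apply: eq_bigr => s _; case: ifP; rewrite ?mulr1 ?mulr0.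
have k0 t : t \in F -> \sum_(s in F | connect dual t s) k s = 0.
  move=> tF; have tr := same_connect dual_sym (connect_root dual t).
  under eq_bigl do rewrite tr.
  rewrite sumk; have /ffunP/(_ (fingraph.root dual t)) := hphi.
  by rewrite !ffunE inE rootF // root_root // eqxx.
have [x [xD xs]] := cob1_solve EF DE k0.
have hatx e : e \in A -> x (hat e) = 0.
  by move=> eA; apply: xD; rewrite inE !inE (imset_f hat eA) orbT.
exists (fun g => x g + \sum_(e in A | hat e == g) phi e); split=> [t tF|g gint|e eA].
- rewrite cob1D xs // [X in _ + X](_ : _ = k t) ?F2_addxx //.
  rewrite /cob1 /k; under eq_bigr do rewrite big_mkcondr /=.
  rewrite exchange_big /= [RHS]big_mkcondr; apply: eq_bigr => e eA.
  rewrite -big_mkcondr /= ; case: ifP => sub.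
    rewrite (big_pred1 (hat e)) // => g /=; rewrite eq_sym.
    by case: eqP => [->|]; rewrite ?hatE ?sub ?andbF.
  rewrite big_pred0 // => g; apply/negbTE/negP => /andP[/andP[_ gt] /eqP hg].
  by rewrite hg gt in sub.
- rewrite xD; last by rewrite inE inE gint.
  by rewrite add0r big1 // => e /andP[eA /eqP hg]; move: (hatNint eA); rewrite hg gint.
- rewrite hatx // add0r (big_pred1 e) // => e' /=.
  apply/andP/eqP => [[e'A /eqP]|->]; last by rewrite eA.
  exact: hat_inj.
Qed.

(** Coboundaries of the minor itself: the image is its cut space. *)
Let cut (g : {ffun V -> F2}) : {ffun {set V} -> F2} :=
  [ffun e => if e \in A then \sum_(v in e) g v else 0].

Let cut_add : {morph cut : f g / f + g}.
Proof.
move=> f g; apply/ffunP => t; rewrite !ffunE; case: ifP => _; rewrite ?addr0 //.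
by rewrite -big_split; apply: eq_bigr => e _; rewrite ffunE.
Qed.

(** A potential of [Phi] is constant on each branch set, because [Phi] vanishes on [Eint] and branch
    sets are connected; so it descends to a potential on [U]. *)
Let extends_cut (phi : {ffun {set V} -> F2}) (Phi : {set W} -> F2) : phi \in supp_in A -> extends phi Phi -> coboundary E Phi ->
  phi \in cut @: supp_in U.
Proof.
move=> /supp_inP phiA [_ Phi0 Phihat] [f fP].
have [E2 _ _ _] := EF.
have f_const x y v : beta x = Some v -> beta y = Some v -> f x = f y.
  move=> bx By; have /connectP[p] := beta_conn bx By.
  elim: p x {bx} => [|z p IHp] x /=; first by move=> _ ->.
  case/andP => /and3P[/eqP bx /eqP bz xz] pth lst; rewrite -(IHp _ pth lst).
  have xz' : x != z by have := E2 _ xz; rewrite cards2; case: eqP.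
  have := fP _ xz; rewrite Phi0; last first.
    rewrite inE xz; apply/existsP; exists v; apply/forallP => w.
    by rewrite !inE; apply/implyP => /orP[] /eqP ->; rewrite ?bx ?bz.
  rewrite cob0_pair // => /esym/eqP; rewrite addr_eq0 => /eqP ->.
  by apply/eqP; rewrite eq_sym -addr_eq0 F2_addxx.
pose g : {ffun V -> F2} := [ffun v => if v \in U then
   (if [pick x | beta x == Some v] is Some x then f x else 0) else 0].
have gE x v : v \in U -> beta x = Some v -> g v = f x.
  move=> vU bx; rewrite ffunE vU; case: pickP => [y /eqP By|/(_ x)]; last by rewrite bx eqxx.
  exact: f_const bx.
apply/imsetP; exists g; first by apply/supp_inP => v vU; rewrite ffunE (negPf vU).
apply/ffunP => e; rewrite ffunE; case: ifP => eA; last by rewrite phiA ?eA.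
rewrite -Phihat // fP ?hatE //; have eU := AU eA.
have [x [y [u [v [[-> _ ee bx By] [xy uv]]]]]] := hat_ends eA.
move: eU; rewrite ee subUset !sub1set => /andP[uU vU].
rewrite cob0_pair // -/(cob0 g [set u; v]) cob0_pair // (gE x u) ?(gE y v) //.
Qed.

(** The zero function and the indicator of [U] are two potentials with zero cut. *)
Let cut_card : (2 * #|cut @: supp_in U| <= 2 ^ #|U|)%N.
Proof.
rewrite -(card_supp_in U) (card_image_ker (@supp_in_add _ U) cut_add) mulnC leq_mul2l.
apply/orP; right.
pose one : {ffun V -> F2} := [ffun v => (v \in U)%:R].
have [u uU] : exists u, u \in U by apply/card_gt0P.
have one0 : 0 != one.
  by apply/eqP => /ffunP/(_ u); rewrite !ffunE uU.
pose zero : {ffun V -> F2} := 0.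
rewrite [leqLHS](_ : _ = #|[set zero; one]|); last by rewrite cards2 one0.
apply: subset_leq_card; rewrite subUset !sub1set !inE -andbA; apply/and4P; split.
- by apply/forallP => i; rewrite ffunE eqxx implybT.
- by apply/eqP/ffunP => e; rewrite !ffunE; case: ifP => // _; rewrite big1 // => v _; rewrite ffunE.
- by apply/forallP => i; rewrite ffunE; case: (i \in U).
- apply/eqP/ffunP => e; rewrite !ffunE; case: ifP => // eA.
  have /subsetP eU := AU eA.
  rewrite (eq_bigr (fun=> 1)) => [|v ve]; last by rewrite ffunE eU.
  by rewrite sumr_const A2 //; apply/eqP; rewrite F2_natr_eq0.
Qed.

(** Counting incidences of faces and boundary edges gives the first inequality. For the second, [h]
    takes at most [2^(f-1)] values if some boundary is nonzero and one value otherwise, while its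
    kernel is at most twice as large as the cut space, hence of size at most [2^|U|]. *)
Lemma minor_face_count g :
    (forall B : {set {set V}}, B \subset A -> B != set0 -> even_edge_set B -> (g <= #|B|)%N) ->
  exists f, (g * f <= 2 * #|A|)%N /\ ((#|A| + 1 <= f + #|U|)%N \/ (#|A| <= #|U|)%N).
Proof.
move=> girth; exists #|I'|; split.
  have : (\sum_(t in I') g <= \sum_(t in I') #|supp_b t|)%N.
    apply: leq_sum => t; rewrite inE => /andP[]; rewrite inE => /andP[tF _] tb.
    apply: girth => //; [by apply/subsetP => e; rewrite inE => /andP[]|exact: b_supp_even].
  rewrite sum_nat_const mulnC => /leq_trans; apply.
  have -> : (\sum_(t in I') #|supp_b t| = \sum_(e in A) #|[set t in I' | b t e != 0%R]|)%N.
    transitivity (\sum_(t in I') \sum_(e in A) (b t e != 0%R))%N.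
      by apply: eq_bigr => t _; rewrite sum_bool_card.
    by rewrite exchange_big; apply: eq_bigr => e _; rewrite sum_bool_card.
  by rewrite mulnC -sum_nat_const; apply: leq_sum => e; exact: b_root_count.
have ker_le : (#|[set phi in supp_in A | h phi == 0%R]| <= 2 ^ #|U|)%N.
  apply: leq_trans cut_card; apply: card_index2 => f1 f2 f1K f2K.
  have [P1 e1] := ker_extends f1K; have [P2 e2] := ker_extends f2K.
  have [K1 K2] : f1 \in supp_in A /\ f2 \in supp_in A.
    by move: f1K f2K; rewrite !inE => /andP[-> _] /andP[-> _].
  have e12 : extends (f1 + f2) (fun e => P1 e + P2 e).
    have [a1 b1 c1] := e1; have [a2 b2 c2] := e2.
    split=> [t tF|g0 gi|e eA]; first by rewrite cob1D a1 // a2 // addr0.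
      by rewrite b1 // b2 // addr0.
    by rewrite ffunE c1 // c2.
  have [e1c _ _] := e1; have [e2c _ _] := e2.
  have [/(extends_cut K1 e1) ->|/(extends_cut K2 e2) ->|] := H1 e1c e2c; rewrite ?orbT //.
  by move/(extends_cut (supp_in_add K1 K2) e12) ->; rewrite !orbT.
have cardA := card_image_ker (@supp_in_add _ A) h_add.
rewrite card_supp_in in cardA.
have := subset_leq_card h_image.
have [->|] := eqVneq I' set0.
  move=> im; right; rewrite -(@leq_exp2l 2) // cardA.
  apply: leq_trans (leq_mul im ker_le) _; rewrite -[leqRHS]mul1n leq_mul2r.
  apply/orP; right; apply: (@leq_trans #|[set (0 : {ffun {set W} -> F2})]|); last by rewrite cards1.
  apply: subset_leq_card; apply/subsetP => k; rewrite in_set => /andP[kS _]; move/supp_inP: kS => k0.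
  by rewrite inE; apply/eqP/ffunP => t; rewrite k0 ?inE // ffunE.
move=> In0 im; have /card_sum0 I0 : (0 < #|I'|)%N by rewrite card_gt0.
left.
rewrite -(@leq_exp2l 2) // addn1 expnS expnD cardA mulnA leq_mul // -I0.
by rewrite leq_mul2l im orbT.
Qed.

End MinorBound.

(** * Edge bounds from the shortest possible cycles *)

Section SparseMinor.
Variable V : finType.
Implicit Types (A B : {set {set V}}) (X : {set V}).

Definition bipartite_edges A X := forall u v, [set u; v] \in A -> (u \in X) != (v \in X).

(** The empty set is excluded because the additive constants fail for it. *)
Definition sparse_edges A := A != set0 ->
  (#|A| + 3 <= 3 * #|cover A|)%N /\
  (forall X, bipartite_edges A X -> (#|A| + 2 <= 2 * #|cover A|)%N).

(** An even set has no vertex of degree 1, so a trail arriving at [u] along [e] can be continued. *)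
Lemma edge_other B e u : (forall e, e \in B -> #|e| = 2%N) -> even_edge_set B ->
  e \in B -> u \in e -> exists w, [/\ w != u, w \notin e & [set u; w] \in B].
Proof.
move=> B2 even eB ue; have := even u.
have [h|h] := leqP 2 #|[set e in B | u \in e]|; last first.
  have -> : #|[set e in B | u \in e]| = 1%N; last by [].
  apply/eqP; rewrite eqn_leq -ltnS h; apply/card_gt0P; exists e.
  by rewrite inE eB.
move=> _; have /set0Pn[e'] : [set e in B | u \in e] :\ e != set0.
  by rewrite -card_gt0; have := cardsD1 e [set e in B | u \in e]; lia.
rewrite !inE => /and3P[e'e e'B ue'].
have /eqP/cards1P[w ew] : #|e' :\ u| = 1%N by have := cardsD1 u e'; rewrite ue' B2 //; lia.
have : w \in e' :\ u by rewrite ew inE.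
rewrite !inE => /andP[wu we']; exists w; split=> //; last by rewrite -ew setD1K.
apply: contra e'e => we; rewrite eqEcard !B2 // leqnn andbT.
by rewrite -(setD1K ue') ew subUset !sub1set ue we.
Qed.

Lemma even_card_ge3 B : (forall e, e \in B -> #|e| = 2%N) -> B != set0 -> even_edge_set B ->
  (3 <= #|B|)%N.
Proof.
move=> B2 /set0Pn[e eB] even.
have /eqP/cards2P[u [v [uv ee]]] := B2 _ eB; subst e.
have [w [wu we uwB]] := edge_other B2 even eB (set21 u v).
have [x [xv xe vxB]] := edge_other B2 even eB (set22 u v).
move: we xe; rewrite !inE !negb_or => /andP[_ wv] /andP[xu _].
have sub : [set [set u; v]; [set u; w]; [set v; x]] \subset B.
  by rewrite !subUset !sub1set eB uwB.
apply: leq_trans (subset_leq_card sub).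
rewrite -setUA cardsU1 cards2 !inE negb_or.
have vu : v != u by rewrite eq_sym.
have vw : v != w by rewrite eq_sym.
have ux : u != x by rewrite eq_sym.
have -> : [set u; v] != [set u; w].
  by apply/eqP => /setP/(_ v); rewrite !inE eqxx orbT (negPf vu) (negPf vw).
have -> : [set u; v] != [set v; x].
  by apply/eqP => /setP/(_ u); rewrite !inE eqxx (negPf uv) (negPf ux).
have -> // : [set u; w] != [set v; x].
by apply/eqP => /setP/(_ u); rewrite !inE eqxx (negPf uv) (negPf ux).
Qed.

(** Continue the edge [uv] at both ends to [w] and [x], then once more past [w]. Since [w] and [x]
    lie on opposite sides of the bipartition, the four edges are distinct. *)
Lemma even_bipartite_card_ge4 B X : (forall e, e \in B -> #|e| = 2%N) -> B != set0 ->
  even_edge_set B -> bipartite_edges B X -> (4 <= #|B|)%N.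
Proof.
move=> B2 /set0Pn[e eB] even bip.
have /eqP/cards2P[u [v [uv ee]]] := B2 _ eB; subst e.
have [w [wu we uwB]] := edge_other B2 even eB (set21 u v).
have [x [xv xe vxB]] := edge_other B2 even eB (set22 u v).
have [y [yw ye wyB]] := edge_other B2 even uwB (set22 u w).
move: we xe ye; rewrite !inE !negb_or => /andP[_ wv] /andP[xu _] /andP[yu _].
have wx : w != x.
  apply/eqP => wx; subst x; have := bip _ _ eB; have := bip _ _ uwB; have := bip _ _ vxB.
  by case: (u \in X); case: (v \in X); case: (w \in X).
have sub : [set [set u; v]; [set u; w]; [set v; x]; [set w; y]] \subset B.
  by rewrite !subUset !sub1set eB uwB vxB.
apply: leq_trans (subset_leq_card sub).
rewrite -!setUA !cardsU1 cards1 !inE !negb_or.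
have vu : v != u by rewrite eq_sym.
have vw : v != w by rewrite eq_sym.
have uw : u != w by rewrite eq_sym.
have ux : u != x by rewrite eq_sym.
have uy : u != y by rewrite eq_sym.
have -> : [set u; v] != [set u; w].
  by apply/eqP => /setP/(_ v); rewrite !inE eqxx orbT (negPf vu) (negPf vw).
have -> : [set u; v] != [set v; x].
  by apply/eqP => /setP/(_ u); rewrite !inE eqxx (negPf uv) (negPf ux).
have -> : [set u; v] != [set w; y].
  by apply/eqP => /setP/(_ u); rewrite !inE eqxx (negPf uw) (negPf uy).
have -> : [set u; w] != [set v; x].
  by apply/eqP => /setP/(_ u); rewrite !inE eqxx (negPf uv) (negPf ux).
have -> : [set u; w] != [set w; y].
  by apply/eqP => /setP/(_ u); rewrite !inE eqxx (negPf uw) (negPf uy).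
have -> // : [set v; x] != [set w; y].
by apply/eqP => /setP/(_ w); rewrite !inE eqxx (negPf wv) (negPf wx).
Qed.

Lemma minor_sparse (W : finType) (E F : {set {set W}}) A (beta : W -> option V) :
    two_sided E F -> H1_index_le2 E F -> (forall e, e \in A -> #|e| = 2%N) ->
  minor_model E A beta -> sparse_edges A.
Proof.
move=> EF H1 A2 [conn hatP] A0.
have [hat hP] : exists hat : {set V} -> {set W}, forall e, e \in A -> exists x y u v,
  [/\ hat e = [set x; y] /\ [set x; y] \in E, e = [set u; v], beta x = Some u & beta y = Some v].
  apply: (@fin_all_exists _ (fun=> {set W}) (fun e he => e \in A -> exists x y u v,
  [/\ he = [set x; y] /\ [set x; y] \in E, e = [set u; v], beta x = Some u & beta y = Some v])) => e.
  have [eA|] := boolP (e \in A); last by exists set0.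
  have [x [y [u [v [xyE ee bx By]]]]] := hatP _ eA.
  by exists [set x; y] => _; exists x, y, u, v.
have AU e : e \in A -> e \subset cover A by move=> eA; apply: (bigcup_sup e).
have U2 : (2 <= #|cover A|)%N.
  by have /set0Pn[e eA] := A0; rewrite -(A2 _ eA); apply: subset_leq_card; apply: AU.
have sub2 B : B \subset A -> forall e, e \in B -> #|e| = 2%N.
  by move=> /subsetP BA e /BA/A2.
have count := minor_face_count EF H1 A2 AU (ltnW U2) conn hP.
split.
  (* Eliminate [f] from [3f <= 2|A|] and [|A| + 1 <= f + |U|]; in the alternative [|A| <= |U|] the
     bound follows from [|U| >= 2]. *)
  have [|f] := count 3%N; last by lia.
  by move=> B BA B0 Be; apply: even_card_ge3 => //; apply: sub2.
move=> X bip.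
have bipB B : B \subset A -> bipartite_edges B X.
  by move=> /subsetP BA u v /BA/bip.
have [|f] := count 4%N; last by lia.
by move=> B BA B0 Be; apply: even_bipartite_card_ge4 (sub2 B BA) B0 Be (bipB B BA).
Qed.

End SparseMinor.

(** * Closed surfaces of positive Euler characteristic *)

Section EulerCohomology.
Variables (W : finType) (E F : {set {set W}}).
Hypothesis EF : two_sided E F.
Hypothesis F0 : (0 < #|F|)%N.
Hypothesis dual_conn : forall t t', t \in F -> t' \in F -> connect (dual_adj F E) t t'.
Hypothesis vertex_conn : forall v w, connect [rel a b | [set a; b] \in E] v w.
Hypothesis euler : (#|E| + 1 <= #|W| + #|F|)%N.

Let d1 (phi : {ffun {set W} -> F2}) : {ffun {set W} -> F2} :=
  [ffun t => if t \in F then cob1 E phi t else 0].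
Let d0 (f : {ffun W -> F2}) : {ffun {set W} -> F2} :=
  [ffun e => if e \in E then cob0 f e else 0].
Let Z := [set phi in supp_in E | d1 phi == 0].
Let B := d0 @: supp_in [set: W].

Let d1_add : {morph d1 : f g / f + g}.
Proof.
move=> f g; apply/ffunP => t; rewrite !ffunE; case: ifP => _; rewrite ?addr0 //.
by rewrite /cob1 -big_split; apply: eq_bigr => e _; rewrite ffunE.
Qed.

Let d0_add : {morph d0 : f g / f + g}.
Proof.
move=> f g; apply/ffunP => t; rewrite !ffunE; case: ifP => _; rewrite ?addr0 //.
by rewrite /cob0 -big_split; apply: eq_bigr => e _; rewrite ffunE.
Qed.

(** Connectedness of the dual graph makes every function on triangles with sum zero a coboundary, so
    [d1] has rank at least [|F| - 1]; then [euler] bounds the number of cocycles. *)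
Let Z_card : (#|Z| <= 2 ^ #|W|)%N.
Proof.
have := card_image_ker (@supp_in_add _ E) d1_add; rewrite card_supp_in -/Z => cardZ.
have im : [set k in supp_in F | \sum_(t in F) k t == 0] \subset d1 @: supp_in E.
  apply/subsetP => k; rewrite in_set => /andP[/supp_inP kF /eqP k0].
  have [t0|x [xE xs]] := @cob1_solve _ _ _ EF E k (subxx _).
    move=> t0F; rewrite -[RHS]k0; apply: eq_bigl => t.
    by have [tF|] := boolP (t \in F); rewrite //= dual_conn.
  apply/imsetP; exists (finfun x); first by apply/supp_inP => e eE; rewrite ffunE xE.
  apply/ffunP => t; rewrite ffunE; case: ifP => [tF|/negbT/kF //].
  by rewrite -xs //; apply: eq_bigr => e _; rewrite ffunE.
have := subset_leq_card im; have := card_sum0 F0; move: cardZ.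
move: #|Z| #|d1 @: supp_in E| => z i cZ cF ci.
have : (z * 2 ^ #|F| <= 2 ^ (#|W| + #|F|))%N.
  apply: (@leq_trans (2 ^ (#|E| + 1))); last by rewrite leq_exp2l.
  by rewrite expnD cZ -cF; nia.
by rewrite expnD leq_pmul2r // expn_gt0.
Qed.

(** By [vertex_conn] only constants have zero coboundary, and there are at most two of them. *)
Let B_card : (2 ^ #|W| <= 2 * #|B|)%N.
Proof.
have := card_image_ker (@supp_in_add _ [set: W]) d0_add; rewrite card_supp_in cardsT => ->.
rewrite mulnC leq_mul2r; apply/orP; right.
pose zero : {ffun W -> F2} := 0; pose one : {ffun W -> F2} := [ffun=> 1].
apply: (@leq_trans #|[set zero; one]|); last by rewrite cards2; case: eqP.
apply: subset_leq_card; apply/subsetP => f; rewrite in_set => /andP[_ /eqP df].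
have f_const v w : f v = f w.
  have /connectP[p] := vertex_conn v w; elim: p v => [|x p IHp] v /=; first by move=> _ ->.
  case/andP => vxE pth lst; rewrite -(IHp _ pth lst).
  have vx : v != x by have [E2 _ _ _] := EF; have := E2 _ vxE; rewrite cards2; case: eqP.
  have /ffunP/(_ [set v; x]) := df; rewrite !ffunE vxE cob0_pair // => /eqP.
  by rewrite addr_eq0 => /eqP ->; apply/eqP; rewrite eq_sym -addr_eq0 F2_addxx.
have [v _|noW] := pickP W; last by rewrite !inE; apply/orP; left; apply/eqP/ffunP => v; have := noW v.
by rewrite !inE; apply/orP; case: (F2_cases (f v)) => fv; [left|right];
  apply/eqP/ffunP => w; rewrite ffunE (f_const w v).
Qed.

Lemma euler_H1_index_le2 : H1_index_le2 E F.
Proof.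
have Zadd f g : f \in Z -> g \in Z -> f + g \in Z.
  move=> /setIdP[fE /eqP f0] /setIdP[gE /eqP g0]; apply/setIdP; split.
    exact: supp_in_add.
  by rewrite d1_add f0 g0 addr0.
have Badd f g : f \in B -> g \in B -> f + g \in B.
  move=> /imsetP[f' f'S ->] /imsetP[g' g'S ->]; rewrite -d0_add.
  by apply: imset_f; apply: supp_in_add.
have BZ : B \subset Z.
  apply/subsetP => _ /imsetP[f fS ->]; rewrite in_set; apply/andP; split.
    by apply/supp_inP => e eE; rewrite ffunE (negPf eE).
  apply/eqP/ffunP => t; rewrite !ffunE; case: ifP => // tF.
  rewrite -[RHS](cob1_cob0 EF f tF); apply: eq_bigr => e /andP[eE _].
  by rewrite ffunE eE.
have B0 : 0 \in B.
  apply/imsetP; exists 0; first by apply/supp_inP => i; rewrite ffunE.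
  by apply/ffunP => e; rewrite !ffunE; case: ifP => // _; rewrite /cob0 big1 // => v _; rewrite ffunE.
have ZB : (#|Z| <= 2 * #|B|)%N by exact: leq_trans Z_card B_card.
pose res (phi : {set W} -> F2) : {ffun {set W} -> F2} := [ffun e => if e \in E then phi e else 0].
have resZ phi : cocycle E F phi -> res phi \in Z.
  move=> phic; rewrite in_set; apply/andP; split.
    by apply/supp_inP => e eE; rewrite ffunE (negPf eE).
  apply/eqP/ffunP => t; rewrite !ffunE; case: ifP => // tF.
  by rewrite -[RHS](phic t tF); apply: eq_bigr => e /andP[eE _]; rewrite ffunE eE.
have resB phi : res phi \in B -> coboundary E phi.
  case/imsetP => f _ /ffunP fphi; exists f => e eE.
  by have := fphi e; rewrite !ffunE eE.
move=> phi psi phiZ psiZ.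
have := index2_card Zadd Badd BZ B0 ZB (resZ _ phiZ) (resZ _ psiZ).
case/or3P => [/resB|/resB|]; [by constructor 1|by constructor 2|constructor 3].
apply: resB; rewrite (_ : res _ = res phi + res psi) //.
by apply/ffunP => e; rewrite !ffunE; case: ifP; rewrite ?addr0.
Qed.

End EulerCohomology.

(** * Cohomology of a triangulated closed surface *)

Definition edges_of (W : finType) (K : {set {set W}}) := [set s in K | #|s| == 2].
Definition triangles_of (W : finType) (K : {set {set W}}) := [set s in K | #|s| == 3].

Section SurfaceComplex.
Variables (n : nat) (K : {set {set 'I_n}}).
Hypothesis Ksurf : closed_surface_complex K.

Lemma surface_sub (s t : {set 'I_n}) : s != set0 -> s \subset t -> t \in K -> s \in K.
Proof. by case: Ksurf => -[_ _ h] _ _ _ _; exact: h. Qed.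

Lemma surface_pure s : s \in K -> exists2 t, t \in triangles_of K & s \subset t.
Proof.
case: Ksurf => _ + _ _ _ => /[apply] -[t [tK t3 st]]; exists t => //.
by rewrite inE tK t3.
Qed.

Lemma surface_two_sided : two_sided (edges_of K) (triangles_of K).
Proof.
split=> [e|t|t e|e]; rewrite ?inE.
- by case/andP => _ /eqP.
- by case/andP => _ /eqP.
- case/andP => tK _ et e2; rewrite e2 eqxx andbT; apply: (surface_sub _ et tK).
  by rewrite -card_gt0 e2.
- case/andP => eK /eqP e2; case: Ksurf => _ _ /(_ _ eK e2) <- _ _.
  by apply: eq_card => t; rewrite !inE andbA.
Qed.

Lemma surface_vertex_conn v w : connect [rel a b | [set a; b] \in edges_of K] v w.
Proof.
case: Ksurf => _ _ _ _ /(_ v w); apply: connect_sub => a b /= abK.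
have [->|ab] := eqVneq a b; first exact: connect0.
by apply: connect1; rewrite /= inE abK cards2 ab.
Qed.

Let dual := dual_adj (triangles_of K) (edges_of K).

Let dual_share v w s t : v != w -> s \in triangles_of K -> t \in triangles_of K ->
  v \in s -> w \in s -> v \in t -> w \in t -> dual s t.
Proof.
move=> vw sF tF vs ws vt wt; rewrite /dual /dual_adj /= sF tF; apply/existsP.
exists [set v; w]; rewrite !subUset !sub1set vs ws vt wt !andbT.
have [_ _ FE _] := surface_two_sided.
by apply: (FE s) => //; rewrite ?subUset ?sub1set ?vs // cards2 vw.
Qed.

Let triangle_other v t : t \in triangles_of K -> v \in t -> exists2 w, w != v & w \in t.
Proof.
rewrite inE => /andP[_ /eqP t3] vt.
have /card_gt0P[w] : (0 < #|t :\ v|)%N by have := cardsD1 v t; lia.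
by rewrite !inE => /andP[wv wt]; exists w.
Qed.

(** A walk in the link of [v] is a walk through triangles at [v], consecutive ones sharing an edge
    at [v]. *)
Let star_conn v s t : s \in triangles_of K -> t \in triangles_of K -> v \in s -> v \in t ->
  connect dual s t.
Proof.
move=> sF tF vs vt.
have [w wv ws] := triangle_other sF vs; have [w' wv' wt] := triangle_other tF vt.
have edge u r : u != v -> r \in triangles_of K -> v \in r -> u \in r -> [set v; u] \in K.
  rewrite inE => uv /andP[rK _] vr ur; apply: surface_sub rK.
    by apply/set0Pn; exists v; rewrite !inE eqxx.
  by rewrite subUset !sub1set vr ur.
have : connect (link_adj K v) w w'.
  case: Ksurf => _ _ _ + _; apply=> //; [exact: edge sF vs ws|exact: edge tF vt wt].
case/connectP => p; elim: p w s wv sF vs ws => [|x p IHp] w s wv sF vs ws /=.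
  by move=> _ w'w; subst w'; apply: connect1; apply: (@dual_share v w) => //; rewrite eq_sym.
case/andP => /andP[vwx3 vwxK] pth lst.
have rF : [set v; w; x] \in triangles_of K by rewrite inE vwxK.
have xv : x != v.
  apply: contraTneq vwx3 => ->; rewrite setUAC setUid cards2.
  by case: (v == w).
have [vr wr xr] : [/\ v \in [set v; w; x], w \in [set v; w; x] & x \in [set v; w; x]].
  by rewrite !inE !eqxx !orbT.
apply: connect_trans (IHp x _ xv rF vr xr pth lst).
by apply: connect1; apply: (@dual_share v w) => //; rewrite eq_sym.
Qed.

(** Follow a path of vertices from [s] to [t]: by purity the stars of consecutive vertices share a
    triangle. *)
Lemma surface_dual_conn s t : s \in triangles_of K -> t \in triangles_of K -> connect dual s t.
Proof.
move=> sF tF.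
have nonempty r : r \in triangles_of K -> exists v, v \in r.
  by rewrite inE => /andP[_ /eqP r3]; apply/card_gt0P; rewrite r3.
have [v vs] := nonempty _ sF; have [w wt] := nonempty _ tF.
have : connect [rel a b | [set a; b] \in K] v w by case: Ksurf.
case/connectP => p; elim: p v s sF vs => [|x p IHp] v s sF vs /=.
  by move=> _ wv; subst w; apply: star_conn vs wt.
case/andP => vxK pth lst; have [r rF] := surface_pure vxK.
rewrite subUset !sub1set => /andP[vr xr].
exact: connect_trans (star_conn sF rF vs vr) (IHp x _ rF xr pth lst).
Qed.

Lemma surface_simplex_card s : s \in K -> [|| #|s| == 1, #|s| == 2 | #|s| == 3]%N.
Proof.
move=> sK; have [t] := surface_pure sK; rewrite inE => /andP[_ /eqP t3] /subset_leq_card.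
have : (0 < #|s|)%N.
  by rewrite card_gt0; apply: contraTneq sK => ->; case: Ksurf => -[].
by rewrite t3; case: #|s| => [|[|[|[|?]]]].
Qed.

Lemma surface_euler :
  complex_euler_char K = n%:Z - #|edges_of K|%:Z + #|triangles_of K|%:Z.
Proof.
have cardE k : (#|[set s in K | #|s| == k]|%:Z = \sum_(s in K) (#|s| == k)%:Z)%R.
  by rewrite -sum_bool_card; elim/big_rec2: _ => // s x y _ <-; rewrite PoszD.
have -> : n%:Z = #|[set s in K | #|s| == 1%N]|%:Z.
  congr Posz; transitivity #|[set [set v] | v in [set: 'I_n]]|.
    by rewrite card_imset ?cardsT ?card_ord //; exact: set1_inj.
  apply: eq_card => s; rewrite inE; apply/imsetP/andP => [[v _ ->]|[sK /cards1P[v ->]]].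
    by rewrite cards1; case: Ksurf => -[_ -> _].
  by exists v.
rewrite /edges_of /triangles_of !cardE -sumrB -big_split /=; apply: eq_bigr => s sK.
by have /or3P[] := surface_simplex_card sK => /eqP ->.
Qed.

Lemma surface_H1 : (0 < complex_euler_char K)%R -> H1_index_le2 (edges_of K) (triangles_of K).
Proof.
move=> chi; apply: euler_H1_index_le2 => //.
- exact: surface_two_sided.
- rewrite card_gt0; apply: contraTneq chi => F0.
  rewrite /complex_euler_char big1 // => s sK.
  by have [t] := surface_pure sK; rewrite F0 inE.
- exact: surface_dual_conn.
- exact: surface_vertex_conn.
by move: chi; rewrite surface_euler card_ord; lia.
Qed.

End SurfaceComplex.

(** * Subdivision of a closed surface *)

Lemma card3_third (T : finType) (t : {set T}) i j : #|t| = 3%N -> i \in t -> j \in t -> i != j ->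
  exists k, [/\ t = [set i; j; k], i != k & j != k].
Proof.
move=> t3 it jt ij.
have /eqP/cards1P[k kE] : #|t :\ i :\ j| = 1%N.
  have := cardsD1 i t; have := cardsD1 j (t :\ i).
  by rewrite !inE it jt t3 eq_sym ij /=; lia.
have : k \in t :\ i :\ j by rewrite kE inE.
rewrite !inE => /and3P[kj ki kt]; exists k; split; rewrite 1?eq_sym //.
rewrite -setUA -kE setD1K ?setD1K // !inE jt andbT eq_sym //.
Qed.

Section Grid.
Variables (n N : nat) (K : {set {set 'I_n}}).
Hypothesis N0 : (0 < N)%N.
Hypothesis Ksurf : closed_surface_complex K.

Definition gpoint := {ffun 'I_n -> 'I_N.+1}.
Implicit Types (a b c : gpoint) (i j k l : 'I_n).

Definition gsupp a := [set i | a i != 0%N :> nat].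
Definition on_grid a := (\sum_i a i == N)%N.
(** Within one triangle of [K] all points have coordinate sum [N], so distinct close points differ
    by some [e_i - e_j]: they are neighbours in the triangular lattice. *)
Definition gclose a b := [forall i, (a i <= b i + 1) && (b i <= a i + 1)]%N.

(* The subdivision of every triangle of K into N^2 triangles; the point a has
   barycentric coordinates a i / N. *)
Definition grid_complex : {set {set gpoint}} :=
  [set s | [&& s != set0, [forall a in s, on_grid a],
     [forall a in s, [forall b in s, gclose a b]] & \bigcup_(a in s) gsupp a \in K]].

Lemma gcloseP a b : reflect (forall i, a i <= b i + 1 /\ b i <= a i + 1)%N (gclose a b).
Proof.
apply: (iffP forallP) => h i; first by apply/andP.
by apply/andP.
Qed.

Lemma gclose_refl a : gclose a a.
Proof. by apply/gcloseP => i; lia. Qed.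

Lemma gclose_sym a b : gclose a b = gclose b a.
Proof. by apply: eq_forallb => i; rewrite andbC. Qed.

Lemma gsupp_out a (s : {set 'I_n}) i : gsupp a \subset s -> i \notin s -> a i = 0%N :> nat.
Proof. by move=> /subsetP h; apply: contraNeq => ai; apply: h; rewrite inE. Qed.

Lemma on_grid_supp a : on_grid a -> gsupp a != set0.
Proof.
move=> /eqP aN; apply: contraTneq N0 => a0; rewrite -aN big1 // => i _.
by apply: (@gsupp_out a set0); rewrite ?a0 ?inE.
Qed.

Lemma grid_complexP (s : {set gpoint}) (t : {set 'I_n}) : s != set0 -> t \in triangles_of K ->
    (forall a, a \in s -> on_grid a) -> (forall a, a \in s -> gsupp a \subset t) ->
    (forall a b, a \in s -> b \in s -> gclose a b) ->
  s \in grid_complex.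
Proof.
move=> s0; rewrite inE => /andP[tK _] sN st sc; rewrite inE s0 /=; apply/and3P; split.
- by apply/forallP => a; apply/implyP => /sN.
- by apply/forallP => a; apply/implyP => ais; apply/forallP => b; apply/implyP; exact: sc.
- apply: (surface_sub Ksurf _ _ tK); last by apply/bigcupsP.
  have /set0Pn[a ais] := s0; have /set0Pn[i ia] := on_grid_supp (sN _ ais).
  by apply/set0Pn; exists i; apply/bigcupP; exists a.
Qed.

Lemma grid_complex_inv (s : {set gpoint}) : s \in grid_complex ->
  [/\ s != set0, forall a, a \in s -> on_grid a, forall a b, a \in s -> b \in s -> gclose a b,
   \bigcup_(a in s) gsupp a \in K
   & exists2 t, t \in triangles_of K & forall a, a \in s -> gsupp a \subset t].
Proof.
rewrite inE => /and4P[s0 /forallP sN /forallP sc sK]; split=> //.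
- by move=> a ais; have := sN a; rewrite ais.
- by move=> a b ais bs; have := sc a; rewrite ais => /forallP/(_ b); rewrite bs.
- have [t tF /subsetP st] := surface_pure Ksurf sK; exists t => // a ais.
  by apply/subsetP => i ia; apply: st; apply/bigcupP; exists a.
Qed.

Definition wpt (h : 'I_n -> nat) : gpoint := [ffun l => inord (h l)].

Lemma wptE h l : (h l <= N)%N -> wpt h l = h l :> nat.
Proof. by move=> hl; rewrite ffunE inordK. Qed.

Definition pt3 i j k p q r : gpoint :=
  wpt (fun l => if l == i then p else if l == j then q else if l == k then r else 0%N).

Definition pt2 i j p q : gpoint :=
  wpt (fun l => if l == i then p else if l == j then q else 0%N).

Lemma sum3 (h : 'I_n -> nat) i j k : i != j -> j != k -> i != k ->
  (forall l, l \notin [set i; j; k] -> h l = 0%N) -> (\sum_l h l = h i + h j + h k)%N.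
Proof.
move=> ij jk ik h0.
rewrite (bigD1 i) //= (bigD1 j) /= 1?eq_sym // (bigD1 k) /= ?big1 ?addn0 ?addnA //.
  by move=> l /andP[/andP[li lj] lk]; apply: h0; rewrite !inE !negb_or li lj lk.
by rewrite eq_sym ik eq_sym jk.
Qed.

Section Triangle.
Variables (i j k : 'I_n).
Hypotheses (ij : i != j) (jk : j != k) (ik : i != k).
Let ji : j == i = false. Proof. by rewrite eq_sym (negPf ij). Qed.
Let kj : k == j = false. Proof. by rewrite eq_sym (negPf jk). Qed.
Let ki : k == i = false. Proof. by rewrite eq_sym (negPf ik). Qed.

Lemma pt3P p q r : (p + q + r = N)%N ->
  [/\ pt3 i j k p q r i = p :> nat, pt3 i j k p q r j = q :> nat, pt3 i j k p q r k = r :> nat,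
   gsupp (pt3 i j k p q r) \subset [set i; j; k] & on_grid (pt3 i j k p q r)].
Proof.
move=> pqr; have val l : pt3 i j k p q r l =
    (if l == i then p else if l == j then q else if l == k then r else 0%N) :> nat.
  by rewrite wptE //; do 3?case: ifP => _; lia.
have out l : l \notin [set i; j; k] -> pt3 i j k p q r l = 0%N :> nat.
  by rewrite !inE !negb_or val => /andP[/andP[/negPf -> /negPf ->] /negPf ->].
have vi : pt3 i j k p q r i = p :> nat by rewrite val eqxx.
have vj : pt3 i j k p q r j = q :> nat by rewrite val ji eqxx.
have vk : pt3 i j k p q r k = r :> nat by rewrite val ki kj eqxx.
split=> //; first by apply/subsetP => l; rewrite inE; apply: contraNT => /out ->.
by rewrite /on_grid (sum3 ij jk ik) // vi vj vk pqr.
Qed.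

Lemma grid_coord a : gsupp a \subset [set i; j; k] -> on_grid a -> (a i + a j + a k = N)%N.
Proof. by move=> at_ /eqP aN; rewrite -[RHS]aN (sum3 ij jk ik) // => l; exact: gsupp_out. Qed.

Lemma gpoint_eq a b : gsupp a \subset [set i; j; k] -> gsupp b \subset [set i; j; k] ->
  a i = b i :> nat -> a j = b j :> nat -> a k = b k :> nat -> a = b.
Proof.
move=> ai bi abi abj abk; apply/ffunP => l; apply: val_inj => /=.
have [|lt] := boolP (l \in [set i; j; k]); last by rewrite (gsupp_out ai lt) (gsupp_out bi lt).
by rewrite !inE => /orP[/orP[]|] /eqP ->.
Qed.

Lemma gclose_coord a b : gsupp a \subset [set i; j; k] -> gsupp b \subset [set i; j; k] ->
  (a i <= b i + 1 -> b i <= a i + 1 -> a j <= b j + 1 -> b j <= a j + 1 ->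
   a k <= b k + 1 -> b k <= a k + 1 -> gclose a b)%N.
Proof.
move=> ai bi *; apply/gcloseP => l.
have [|lt] := boolP (l \in [set i; j; k]); last by rewrite (gsupp_out ai lt) (gsupp_out bi lt).
by rewrite !inE => /orP[/orP[]|] /eqP ->.
Qed.

Hypothesis tF : [set i; j; k] \in triangles_of K.

Lemma grid_edge a b : on_grid a -> on_grid b -> gsupp a \subset [set i; j; k] ->
  gsupp b \subset [set i; j; k] -> gclose a b -> a != b -> [set a; b] \in edges_of grid_complex.
Proof.
move=> aN bN at_ bt ab neq; rewrite [_ \in edges_of _]inE cards2 neq eqxx andbT.
apply: (grid_complexP _ tF).
- by apply/set0Pn; exists a; rewrite !inE eqxx.
- by move=> x; rewrite !inE => /orP[] /eqP ->.
- by move=> x; rewrite !inE => /orP[] /eqP ->.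
by move=> x y; rewrite !inE => /orP[] /eqP -> /orP[] /eqP ->; rewrite ?gclose_refl // gclose_sym.
Qed.

Lemma grid_triangle a b c : on_grid a -> on_grid b -> on_grid c -> gsupp a \subset [set i; j; k] ->
  gsupp b \subset [set i; j; k] -> gsupp c \subset [set i; j; k] ->
  gclose a b -> gclose b c -> gclose a c -> a != b -> b != c -> a != c ->
  [set a; b; c] \in triangles_of grid_complex.
Proof.
move=> aN bN cN at_ bt ct ab bc ac nab nbc nac.
have c3 : #|[set a; b; c]| == 3%N.
  by rewrite -setUA cardsU1 cards2 !inE negb_or nab nac nbc.
rewrite [_ \in triangles_of _]inE c3 andbT.
apply: (grid_complexP _ tF).
- by apply/set0Pn; exists a; rewrite !inE eqxx.
- by move=> x; rewrite !inE => /orP[/orP[]|] /eqP ->.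
- by move=> x; rewrite !inE => /orP[/orP[]|] /eqP ->.
by move=> x y; rewrite !inE => /orP[/orP[]|] /eqP -> /orP[/orP[]|] /eqP ->;
  rewrite ?gclose_refl // gclose_sym.
Qed.
End Triangle.

Lemma grid_edge_inv a b : [set a; b] \in edges_of grid_complex ->
  [/\ a != b, on_grid a, on_grid b, gclose a b &
    exists2 t, t \in triangles_of K & gsupp a \subset t /\ gsupp b \subset t].
Proof.
rewrite inE => /andP[/grid_complex_inv[_ sN sc _ [t tF st]]].
rewrite cards2; case: (eqVneq a b) => //= ab _; split=> //.
- by apply: sN; rewrite set21.
- by apply: sN; rewrite set22.
- by apply: sc; rewrite ?set21 ?set22.
- by exists t => //; split; apply: st; rewrite ?set21 ?set22.
Qed.
End Grid.

Ltac coord_lia :=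
  repeat match goal with H : ?P |- _ =>
    match P with context [nat_of_ord _] => (try clearbody H); revert H end end;
  repeat match goal with |- context [nat_of_ord ?x] => generalize (nat_of_ord x) end;
  clear; intros; lia.

(** * Each edge of the subdivision lies on two small triangles *)

Section GridSurface.
Variables (n N : nat) (K : {set {set 'I_n}}).
Hypothesis N0 : (0 < N)%N.
Hypothesis Ksurf : closed_surface_complex K.
Implicit Types (a b c : gpoint n N) (i j k l : 'I_n).
Let KEF := surface_two_sided Ksurf.
Local Notation T := (grid_complex N K).

Lemma grid_edge_dir a b : [set a; b] \in edges_of T ->
  exists i j, [/\ i != j, a i = (b i + 1)%N :> nat, b j = (a j + 1)%N :> nat &
    forall l, l != i -> l != j -> a l = b l :> nat].
Proof.
case/(grid_edge_inv Ksurf) => ab aN bN cab [t tF [at_ bt]].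
have [x [y [z [tE xy yz xz]]]] := triangleP KEF tF; subst t.
have sa := grid_coord xy yz xz at_ aN; have sb := grid_coord xy yz xz bt bN.
have /gcloseP cl := cab.
have [cx cx'] := cl x; have [cy cy'] := cl y; have [cz cz'] := cl z.
have neq : ~ (a x = b x :> nat /\ a y = b y :> nat /\ a z = b z :> nat).
  by case=> ax [ay az]; move/eqP: ab; apply; apply: gpoint_eq at_ bt _ _ _.
have rest l : l != x -> l != y -> l != z -> a l = b l :> nat.
  move=> lx ly lz; have lt : l \notin [set x; y; z] by rewrite !inE !negb_or lx ly lz.
  by rewrite (gsupp_out at_ lt) (gsupp_out bt lt).
have done_ i j k : i != j -> (forall l, l != i -> l != j -> l != k -> a l = b l :> nat) ->
    a i = (b i + 1)%N :> nat -> b j = (a j + 1)%N :> nat -> a k = b k :> nat ->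
    exists i j, [/\ i != j, a i = (b i + 1)%N :> nat, b j = (a j + 1)%N :> nat &
    forall l, l != i -> l != j -> a l = b l :> nat].
  move=> ij r ai bj ak; exists i, j; split=> // l li lj.
  by have [->//|lk] := eqVneq l k; apply: r.
have [yx zy zx] : [/\ y != x, z != y & z != x] by rewrite ![_ == x]eq_sym [z == y]eq_sym.
have : ((a x = b x + 1 :> nat) /\ (b y = a y + 1 :> nat) /\ (a z = b z :> nat) \/
        (a x = b x + 1 :> nat) /\ (b z = a z + 1 :> nat) /\ (a y = b y :> nat) \/
        (a y = b y + 1 :> nat) /\ (b x = a x + 1 :> nat) /\ (a z = b z :> nat) \/
        (a y = b y + 1 :> nat) /\ (b z = a z + 1 :> nat) /\ (a x = b x :> nat) \/
        (a z = b z + 1 :> nat) /\ (b x = a x + 1 :> nat) /\ (a y = b y :> nat) \/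
        (a z = b z + 1 :> nat) /\ (b y = a y + 1 :> nat) /\ (a x = b x :> nat))%N.
  by coord_lia.
case=> [[? [? ?]]|[[? [? ?]]|[[? [? ?]]|[[? [? ?]]|[[? [? ?]]|[? [? ?]]]]]]].
- by apply: (done_ x y z).
- by apply: (done_ x z y) => // l *; apply: rest.
- by apply: (done_ y x z) => // l *; apply: rest.
- by apply: (done_ y z x) => // l *; apply: rest.
- by apply: (done_ z x y) => // l *; apply: rest.
- by apply: (done_ z y x) => // l *; apply: rest.
Qed.

Section EdgeThird.
Variables (a b : gpoint n N) (i j : 'I_n).
Hypothesis abE : [set a; b] \in edges_of T.
Hypotheses (ij : i != j) (ai : a i = (b i + 1)%N :> nat) (bj : b j = (a j + 1)%N :> nat).
Hypothesis rest : forall l, l != i -> l != j -> a l = b l :> nat.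

(** With [b = a - e_i + e_j], the points [a - e_i + e_l] and [a + e_j - e_l] are the possible common
    neighbours of [a] and [b] in the triangle [ijl]. The first always exists because [a i > 0]. *)
Definition third_up l : gpoint n N := pt3 N i j l (a i - 1) (a j) (a l + 1).
Definition third_down l : gpoint n N := pt3 N i j l (a i) (a j + 1) (a l - 1).

Let edge_in (t : {set 'I_n}) : gsupp a \subset t -> gsupp b \subset t -> i \in t /\ j \in t.
Proof.
move=> /subsetP at_ /subsetP bt; split; [apply: at_|apply: bt]; rewrite inE; coord_lia.
Qed.

Let supp_sub (t : {set 'I_n}) : gsupp a \subset t -> j \in t -> gsupp b \subset t.
Proof.
move=> /subsetP at_ jt; apply/subsetP => l; rewrite inE => bl.
have [->//|lj] := eqVneq l j; apply: at_; rewrite inE.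
by have [->|li] := eqVneq l i; [coord_lia|rewrite rest].
Qed.

Section InTriangle.
Variables (l : 'I_n).
Hypotheses (il : i != l) (jl : j != l) (tF : [set i; j; l] \in triangles_of K).
Hypotheses (at_ : gsupp a \subset [set i; j; l]).

Let bt : gsupp b \subset [set i; j; l].
Proof. by apply: supp_sub at_ _; rewrite !inE eqxx orbT. Qed.

Let al : a l = b l :> nat. Proof. by apply: rest; rewrite eq_sym. Qed.

Let sa : (a i + a j + a l = N)%N.
Proof. by have [_ aN _ _ _] := grid_edge_inv Ksurf abE; exact: grid_coord. Qed.

Let third_in c : (c i + c j + c l = N)%N -> on_grid c -> gsupp c \subset [set i; j; l] ->
  (a i <= c i + 1 -> c i <= a i -> a j <= c j -> c j <= a j + 1 ->
    a l <= c l + 1 -> c l <= a l + 1 -> (a l <> c l :> nat) ->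
  [set a; b; c] \in triangles_of T /\ c \notin [set a; b])%N.
Proof.
move=> sc cN ct *; have := al; have := sa => ? ?; have [ab aN bN cab _] := grid_edge_inv Ksurf abE.
have ca : c != a by apply/eqP => ca; subst c; coord_lia.
have cb : c != b by apply/eqP => cb; subst c; coord_lia.
split; last by rewrite !inE negb_or ca cb.
apply: (grid_triangle N0 Ksurf tF) => //; rewrite 1?eq_sym //.
  by apply: (gclose_coord bt ct); coord_lia.
by apply: (gclose_coord at_ ct); coord_lia.
Qed.

Lemma third_up_in : [set a; b; third_up l] \in triangles_of T /\ third_up l \notin [set a; b].
Proof.
have := sa => ?; have [|pi pj pl ps pN] := pt3P N0 ij jl il (_ : (a i - 1 + a j + (a l + 1) = N)%N); first by coord_lia.
by apply: third_in; rewrite /third_up ?pi ?pj ?pl //; coord_lia.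
Qed.

Lemma third_down_in : (0 < a l)%N ->
  [set a; b; third_down l] \in triangles_of T /\ third_down l \notin [set a; b].
Proof.
move=> al0; have := sa => ?.
have [|pi pj pl ps pN] := pt3P N0 ij jl il (_ : (a i + (a j + 1) + (a l - 1) = N)%N); first by coord_lia.
by apply: third_in; rewrite /third_down ?pi ?pj ?pl //; coord_lia.
Qed.

Lemma third_cases c : on_grid c -> gsupp c \subset [set i; j; l] -> gclose a c -> gclose b c ->
  c != a -> c != b -> c = third_up l \/ (0 < a l)%N /\ c = third_down l.
Proof.
move=> cN ct /gcloseP ac /gcloseP bc ca cb.
have sc := grid_coord ij jl il ct cN.
have [? ?] := ac i; have [? ?] := ac j; have [? ?] := ac l.
have [? ?] := bc i; have [? ?] := bc j; have [? ?] := bc l.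
have na : ~ (c i = a i :> nat /\ c j = a j :> nat /\ c l = a l :> nat).
  by case=> h1 [h2 h3]; move/eqP: ca; apply; apply: gpoint_eq ct at_ _ _ _.
have nb : ~ (c i = b i :> nat /\ c j = b j :> nat /\ c l = b l :> nat).
  by case=> h1 [h2 h3]; move/eqP: cb; apply; apply: gpoint_eq ct bt _ _ _.
have := sa; have := al; have := ai; have := bj => *.
have : ((c i = a i - 1 :> nat) /\ (c j = a j :> nat) /\ (c l = a l + 1 :> nat) \/
        0 < a l /\ ((c i = a i :> nat) /\ (c j = a j + 1 :> nat) /\ (c l = a l - 1 :> nat)))%N.
  by coord_lia.
case=> [[h1 [h2 h3]]|[a0 [h1 [h2 h3]]]]; [left|right; split=> //].
  have [|pi pj pl ps pN] := pt3P N0 ij jl il (_ : (a i - 1 + a j + (a l + 1) = N)%N); first by coord_lia.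
  by apply: (gpoint_eq ct ps); rewrite ?h1 ?h2 ?h3 ?pi ?pj ?pl.
have [|pi pj pl ps pN] := pt3P N0 ij jl il (_ : (a i + (a j + 1) + (a l - 1) = N)%N); first by coord_lia.
by apply: (gpoint_eq ct ps); rewrite ?h1 ?h2 ?h3 ?pi ?pj ?pl.
Qed.
End InTriangle.

Let ends_in (t : {set 'I_n}) : gsupp a \subset t -> gsupp b \subset t -> t \in triangles_of K ->
  exists l, [/\ t = [set i; j; l], i != l & j != l].
Proof.
move=> at_ bt tF; have [it jt] := edge_in at_ bt; apply: card3_third => //.
by case: KEF => _ + _ _; apply.
Qed.

Lemma triangle_at_edge s : s \in triangles_of T -> [set a; b] \subset s ->
  exists l, [/\ i != l, j != l, [set i; j; l] \in triangles_of K, gsupp a \subset [set i; j; l] &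
    s = [set a; b; third_up l] \/ (0 < a l)%N /\ s = [set a; b; third_down l]].
Proof.
rewrite inE subUset !sub1set => /andP[/grid_complex_inv[//|_ sN sc _ [t tF st]] /eqP s3] /andP[as_ bs].
have [ab _ _ _ _] := grid_edge_inv Ksurf abE.
have [c [sE ac bc]] := card3_third s3 as_ bs ab.
have [l [tE il jl]] := ends_in (st _ as_) (st _ bs) tF; subst t; exists l; split=> //; first exact: st.
have cs : c \in s by rewrite sE !inE eqxx orbT.
have ca : c != a by rewrite eq_sym.
have cb : c != b by rewrite eq_sym.
by have [<-|[al <-]] := third_cases il jl tF (st _ as_) (sN _ cs) (st _ cs) (sc _ _ as_ cs) (sc _ _ bs cs) ca cb;
  [left|right].
Qed.

Let neq_add (c c' : gpoint n N) : c \notin [set a; b] -> c != c' -> [set a; b; c] != [set a; b; c'].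
Proof.
move=> cab cc; apply/eqP => /setP/(_ c); rewrite [in LHS]inE set11 orbT.
by rewrite inE (negPf cab) inE (negPf cc).
Qed.

(** If some further coordinate [a k] is positive, only the triangle [ijk] contains the edge, and
    there is one common neighbour on either side. Otherwise the edge lies on the edge [ij] of [K],
    and each of the two triangles of [K] at [ij] supplies its [third_up]. *)
Lemma grid_edge_two_sided : #|[set s in triangles_of T | [set a; b] \subset s]| = 2%N.
Proof.
have ab_sub c : [set a; b] \subset [set a; b; c] by exact: subsetUl.
have [ab aN bN cab [t tF [at_ bt]]] := grid_edge_inv Ksurf abE.
have [k /and3P[ik jk ak]|none] := pickP (fun k => [&& i != k, j != k & (0 < a k)%N]).
  have only l : gsupp a \subset [set i; j; l] -> l = k.
    move=> /subsetP/(_ k); rewrite !inE -lt0n ak => /(_ isT).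
    by rewrite ![k == _]eq_sym (negPf ik) (negPf jk) => /eqP.
  have [l [tE _ _]] := ends_in at_ bt tF; subst t; have lk := only _ at_; subst l.
  have [upT upN] := third_up_in ik jk tF at_.
  have [dnT dnN] := third_down_in ik jk tF at_ ak.
  have neq : third_up k != third_down k.
    have sa := grid_coord ij jk ik at_ aN.
    have [|_ _ u3 _ _] := pt3P N0 ij jk ik (_ : (a i - 1 + a j + (a k + 1) = N)%N); first by coord_lia.
    have [|_ _ d3 _ _] := pt3P N0 ij jk ik (_ : (a i + (a j + 1) + (a k - 1) = N)%N); first by coord_lia.
    apply/eqP => /ffunP/(_ k)/(congr1 (@nat_of_ord _)).
    by rewrite /third_up /third_down u3 d3; coord_lia.
  have -> : [set s in triangles_of T | [set a; b] \subset s] =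
      [set [set a; b; third_up k]; [set a; b; third_down k]].
    apply/setP => s; rewrite [LHS]inE !in_set2; apply/andP/orP => [[sF abs]|[] /eqP -> //].
    have [l [il jl lF al [-> |[al0 ->]]]] := triangle_at_edge sF abs.
      by rewrite (only _ al) eqxx; left.
    by rewrite (only _ al) eqxx; right.
  by rewrite cards2 neq_add.
have a0 k : i != k -> j != k -> a k = 0%N :> nat.
  by move=> ik jk; have := none k; rewrite ik jk /= lt0n => /negbFE/eqP.
have ijE : [set i; j] \in edges_of K.
  have [it jt] := edge_in at_ bt; case: KEF => _ _ FE _; apply: (FE t) => //.
    by rewrite subUset !sub1set it jt.
  by rewrite cards2 ij.
have [_ F3 _ EF2] := KEF; have /eqP/cards2P[s1 [s2 [s12 sE]]] := EF2 _ ijE.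
have trP s : s \in [set s1; s2] -> s \in triangles_of K /\
    exists k, [/\ s = [set i; j; k], i != k & j != k].
  rewrite -sE inE subUset !sub1set => /andP[sF /andP[is_ js]]; split=> //.
  exact: card3_third (F3 _ sF) is_ js ij.
have [F1 [k1 [s1E ik1 jk1]]] := trP _ (set21 s1 s2).
have [F2_ [k2 [s2E ik2 jk2]]] := trP _ (set22 s1 s2); subst s1 s2.
have a_in l : gsupp a \subset [set i; j; l].
  apply/subsetP => x; rewrite [x \in gsupp a]inE => ax; rewrite !inE.
  apply/orP; left; apply: contraNT ax; rewrite negb_or => /andP[xi xj].
  by rewrite a0 // eq_sym.
have [u1T u1N] := third_up_in ik1 jk1 F1 (a_in k1).
have [u2T u2N] := third_up_in ik2 jk2 F2_ (a_in k2).
have k12 : k1 != k2 by apply: contraNneq s12 => ->.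
have neq : third_up k1 != third_up k2.
  have sa1 := grid_coord ij jk1 ik1 (a_in k1) aN.
  have sa2 := grid_coord ij jk2 ik2 (a_in k2) aN.
  have [|_ _ u3 _ _] := pt3P N0 ij jk1 ik1 (_ : (a i - 1 + a j + (a k1 + 1) = N)%N); first by coord_lia.
  have [|_ _ _ d3 _] := pt3P N0 ij jk2 ik2 (_ : (a i - 1 + a j + (a k2 + 1) = N)%N); first by coord_lia.
  apply/eqP => /ffunP/(_ k1)/(congr1 (@nat_of_ord _)).
  rewrite /third_up u3 (gsupp_out d3) ?addn1 //.
  by rewrite !inE !negb_or ![k1 == _]eq_sym ik1 jk1 eq_sym k12.
have -> : [set s in triangles_of T | [set a; b] \subset s] =
    [set [set a; b; third_up k1]; [set a; b; third_up k2]].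
  apply/setP => s; rewrite [LHS]inE !in_set2; apply/andP/orP => [[sF abs]|[] /eqP -> //].
  have [l [il jl lF al [-> |[]]]] := triangle_at_edge sF abs; last by rewrite a0.
  have : [set i; j; l] \in [set [set i; j; k1]; [set i; j; k2]].
    by rewrite -sE inE lF subUset !sub1set !inE !eqxx orbT.
  have third_eq k : [set i; j; l] = [set i; j; k] -> l = k.
    move=> /setP/(_ l); rewrite !inE eqxx orbT ![l == _]eq_sym (negPf il) (negPf jl) /=.
    by move=> /esym/eqP.
  by rewrite in_set2 => /orP[] /eqP/third_eq ->; [left|right].
by rewrite cards2 neq_add.
Qed.
End EdgeThird.

Lemma grid_two_sided : two_sided (edges_of T) (triangles_of T).
Proof.
split=> [e|t|t e|e].
- by rewrite inE => /andP[_ /eqP].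
- by rewrite inE => /andP[_ /eqP].
- rewrite inE => /andP[/grid_complex_inv[//|_ sN sc _ [t' tF st]] _] /subsetP et e2.
  rewrite [_ \in edges_of _]inE e2 eqxx andbT; apply: (grid_complexP N0 Ksurf _ tF).
  + by rewrite -card_gt0 e2.
  + by move=> a /et/sN.
  + by move=> a /et/st.
  + by move=> a b /et ae /et be; exact: sc.
- move=> eE; have : #|e| == 2%N by move: eE; rewrite inE => /andP[].
  case/cards2P => a [b [ab ee]]; subst e.
  have [i [j [ij ai bj rest]]] := grid_edge_dir eE.
  exact: grid_edge_two_sided eE ij ai bj rest.
Qed.

End GridSurface.

(** * Cohomology of the subdivision *)

Lemma F2_solve (x y z : F2) : x + y + z = 0 -> z = x + y.
Proof.
by move/eqP; rewrite addr_eq0 => /eqP ->; apply/eqP; rewrite -addr_eq0 F2_addxx.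
Qed.

Lemma F2_addK (x y : F2) : x + (x + y) = y.
Proof. by rewrite addrA F2_addxx add0r. Qed.

Section GridCohomology.
Variables (n N : nat) (K : {set {set 'I_n}}).
Hypothesis N0 : (0 < N)%N.
Hypothesis Ksurf : closed_surface_complex K.
Implicit Types (a b c : gpoint n N) (i j k l : 'I_n).
Let KEF := surface_two_sided Ksurf.
Local Notation T := (grid_complex N K).
Let TEF := grid_two_sided N0 Ksurf.

Section Primitive.
Variable phi : {set gpoint n N} -> F2.

Definition primitive_on (t : {set 'I_n}) (f : gpoint n N -> F2) :=
  forall a b, [set a; b] \in edges_of T -> gsupp a \subset t -> gsupp b \subset t ->
  phi [set a; b] = f a + f b.

Section Ladder.
Hypothesis phi_cocycle : cocycle (edges_of T) (triangles_of T) phi.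
Variables (i j k : 'I_n).
Hypotheses (ij : i != j) (jk : j != k) (ik : i != k).
Hypothesis tF : [set i; j; k] \in triangles_of K.

(** Row [r] and column [q] of the subdivided triangle; [up] and [down] below are the cocycle
    condition on the two kinds of small triangles. *)
Let g q r := pt3 N i j k (N - q - r) q r.

Let gP q r : (q + r <= N)%N -> [/\ g q r i = (N - q - r)%N :> nat, g q r j = q :> nat,
  g q r k = r :> nat, gsupp (g q r) \subset [set i; j; k] & on_grid (g q r)].
Proof. by move=> qr; apply: pt3P => //; lia. Qed.

Let g_neq q r q' r' : (q + r <= N)%N -> (q' + r' <= N)%N -> (q != q') || (r != r') ->
  g q r != g q' r'.
Proof.
move=> /gP[_ gj gk _ _] /gP[_ gj' gk' _ _]; apply: contraTneq => gg.
move: gj gk; rewrite gg gj' gk' => -> ->; by rewrite !eqxx.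
Qed.

Let g_close q r q' r' : (q + r <= N)%N -> (q' + r' <= N)%N ->
  (q <= q' + 1)%N -> (q' <= q + 1)%N -> (r <= r' + 1)%N -> (r' <= r + 1)%N ->
  (q + r <= q' + r' + 1)%N -> (q' + r' <= q + r + 1)%N -> gclose (g q r) (g q' r').
Proof.
move=> qr qr' *; have [gi gj gk gs _] := gP qr; have [gi' gj' gk' gs' _] := gP qr'.
by apply: (gclose_coord gs gs'); rewrite ?gi ?gj ?gk ?gi' ?gj' ?gk'; lia.
Qed.

Let up q r : (q + r + 1 <= N)%N ->
  phi [set g q r; g q.+1 r] + phi [set g q.+1 r; g q r.+1] + phi [set g q r; g q r.+1] = 0.
Proof.
move=> qr; have [|_ _ _ s1 N1] := @gP q r; first by clear -qr; lia.
have [|_ _ _ s2 N2] := @gP q.+1 r; first by clear -qr; lia.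
have [|_ _ _ s3 N3] := @gP q r.+1; first by clear -qr; lia.
have n1 : g q r != g q.+1 r by apply: g_neq; clear -qr; lia.
have n2 : g q.+1 r != g q r.+1 by apply: g_neq; clear -qr; lia.
have n3 : g q r != g q r.+1 by apply: g_neq; clear -qr; lia.
rewrite -(cob1_triangle TEF) //; first apply: phi_cocycle.
  all: by apply: (grid_triangle N0 Ksurf tF) => //; apply: g_close; clear -qr; lia.
Qed.

Let down q r : (q + r + 2 <= N)%N ->
  phi [set g q.+1 r; g q r.+1] + phi [set g q r.+1; g q.+1 r.+1]
   + phi [set g q.+1 r; g q.+1 r.+1] = 0.
Proof.
move=> qr; have [|_ _ _ s1 N1] := @gP q.+1 r; first by clear -qr; lia.
have [|_ _ _ s2 N2] := @gP q r.+1; first by clear -qr; lia.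
have [|_ _ _ s3 N3] := @gP q.+1 r.+1; first by clear -qr; lia.
have n1 : g q.+1 r != g q r.+1 by apply: g_neq; clear -qr; lia.
have n2 : g q r.+1 != g q.+1 r.+1 by apply: g_neq; clear -qr; lia.
have n3 : g q.+1 r != g q.+1 r.+1 by apply: g_neq; clear -qr; lia.
rewrite -(cob1_triangle TEF) //; first apply: phi_cocycle.
  all: by apply: (grid_triangle N0 Ksurf tF) => //; apply: g_close; clear -qr; lia.
Qed.

(** The integral of [phi] along the bottom row to column [q], then upwards in that column. *)
Let G q r : F2 := \sum_(u < q) phi [set g u 0; g u.+1 0] + \sum_(v < r) phi [set g q v; g q v.+1].

Let G_vert q r : phi [set g q r; g q r.+1] = G q r + G q r.+1.
Proof. by rewrite /G big_ord_recr /= [X in _ + X]addrA F2_addK. Qed.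

(** Induction up the ladder between columns [q] and [q + 1]: from the lower rung, the [up] triangle
    gives the diagonal, and from this the [down] triangle gives the upper rung. *)
Let G_horiz q r : (q + r + 1 <= N)%N -> phi [set g q r; g q.+1 r] = G q r + G q.+1 r.
Proof.
elim: r => [|r IHr] qr; first by rewrite /G !big_ord0 big_ord_recr /= !addr0 F2_addK.
have := @up q r; have := @down q r; rewrite !G_vert IHr; last by clear -qr; lia.
move=> /(_ ltac:(clear -qr; lia)) d /(_ ltac:(clear -qr; lia)) u.
have uE : phi [set g q.+1 r; g q r.+1] = G q.+1 r + G q r.+1.
  apply: F2_solve; rewrite -[RHS]u.
  have -> : G q r + G q.+1 r + phi [set g q.+1 r; g q r.+1] + (G q r + G q r.+1) =
     G q r + G q r + (G q.+1 r + G q r.+1 + phi [set g q.+1 r; g q r.+1]) by ring.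
  by rewrite F2_addxx add0r.
apply: F2_solve; rewrite -[RHS]d uE.
have -> : G q.+1 r + G q r.+1 + phi [set g q r.+1; g q.+1 r.+1] + (G q.+1 r + G q.+1 r.+1) =
   G q.+1 r + G q.+1 r + (G q r.+1 + G q.+1 r.+1 + phi [set g q r.+1; g q.+1 r.+1]) by ring.
by rewrite F2_addxx add0r.
Qed.

Let G_diag q r : (q + r + 1 <= N)%N -> phi [set g q.+1 r; g q r.+1] = G q.+1 r + G q r.+1.
Proof.
move=> qr; have := up qr; rewrite G_vert G_horiz // => u.
apply: F2_solve; rewrite -[RHS]u.
have -> : G q r + G q.+1 r + phi [set g q.+1 r; g q r.+1] + (G q r + G q r.+1) =
   G q r + G q r + (G q.+1 r + G q r.+1 + phi [set g q.+1 r; g q r.+1]) by ring.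
by rewrite F2_addxx add0r.
Qed.

Lemma triangle_primitive : exists f, primitive_on [set i; j; k] f.
Proof.
exists (fun a => G (a j) (a k)) => a b abE at_ bt.
have [ab aN bN /gcloseP cab _] := grid_edge_inv Ksurf abE.
have norm c : on_grid c -> gsupp c \subset [set i; j; k] -> (c j + c k <= N)%N /\ c = g (c j) (c k).
  move=> cN ct; have sc := grid_coord ij jk ik ct cN.
  have le : (c j + c k <= N)%N by coord_lia.
  split=> //; have [gi gj gk gs _] := gP le; apply: (gpoint_eq ct gs); rewrite ?gi ?gj ?gk //.
  by coord_lia.
have sa := grid_coord ij jk ik at_ aN; have sb := grid_coord ij jk ik bt bN.
have [la aE] := norm a aN at_; have [lb bE] := norm b bN bt.
have [] := cab i; have [] := cab j; have [] := cab k.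
have neq : ~~ ((a j == b j :> nat) && (a k == b k :> nat)).
  by apply: contra ab => /andP[/eqP hj /eqP hk]; rewrite aE bE hj hk.
have -> : [set a; b] = [set g (a j) (a k); g (b j) (b k)] by rewrite -aE -bE.
move: la lb neq sa sb; clear -G_horiz G_vert G_diag.
move: (nat_of_ord (a i)) (nat_of_ord (a j)) (nat_of_ord (a k)) (nat_of_ord (b i))
  (nat_of_ord (b j)) (nat_of_ord (b k)) => p q r p' q' r' la lb neq sa sb r1 r2 q1 q2 p1 p2.
have sw x y x' y' : phi [set g x y; g x' y'] = G x y + G x' y' ->
    phi [set g x' y'; g x y] = G x' y' + G x y.
  by rewrite setUC => ->; rewrite addrC.
(* Distinct close points differ by one of six lattice directions, three of which are reversals
   treated by [sw]. *)
have : (q' = q.+1 /\ r' = r) \/ (q = q'.+1 /\ r' = r) \/ (q' = q /\ r' = r.+1) \/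
    (q' = q /\ r = r'.+1) \/ (q = q'.+1 /\ r' = r.+1) \/ (q' = q.+1 /\ r = r'.+1).
  by clear -la lb neq sa sb r1 r2 q1 q2 p1 p2; lia.
case=> [[qE rE]|[[qE rE]|[[qE rE]|[[qE rE]|[[qE rE]|[qE rE]]]]]]; rewrite {}qE {}rE in la lb *.
- by apply: G_horiz; clear -la lb; lia.
- by apply: sw; apply: G_horiz; clear -la lb; lia.
- exact: G_vert.
- by apply: sw; exact: G_vert.
- by apply: G_diag; clear -la lb; lia.
- by apply: sw; apply: G_diag; clear -la lb; lia.
Qed.
End Ladder.

Definition corner i : gpoint n N := pt2 N i i N 0.

Definition edge_path i j m : F2 :=
  \sum_(u < m) phi [set pt2 N i j (N - u) u; pt2 N i j (N - u.+1) u.+1].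

Lemma pt2P i j m l : (m <= N)%N -> pt2 N i j (N - m) m l =
  (if l == i then (N - m)%N else if l == j then m else 0%N) :> nat.
Proof. by move=> mN; rewrite wptE //; do 2?case: ifP => _; lia. Qed.

Lemma cornerP i l : corner i l = (if l == i then N else 0%N) :> nat.
Proof. by rewrite wptE //; do 2?case: ifP => // _; lia. Qed.

Lemma pt2_0 i j : pt2 N i j (N - 0) 0 = corner i.
Proof.
apply/ffunP => l; apply: val_inj; rewrite /= pt2P // cornerP subn0.
by case: ifP => // _; case: ifP.
Qed.

Lemma pt2_N i j : i != j -> pt2 N i j (N - N) N = corner j.
Proof.
move=> ij; apply/ffunP => l; apply: val_inj; rewrite /= pt2P // cornerP subnn.
by have [->|_] := eqVneq l i; rewrite ?(negPf ij).
Qed.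

Lemma primitive_edge_path t f i j m : t \in triangles_of K -> i \in t -> j \in t -> i != j ->
  primitive_on t f -> (m <= N)%N -> f (pt2 N i j (N - m) m) = f (corner i) + edge_path i j m.
Proof.
move=> tF it jt ij prim; elim: m => [|m IHm] mN; first by rewrite /edge_path big_ord0 addr0 pt2_0.
have t3 : #|t| = 3%N by case: KEF => _ + _ _; apply.
have [k [tE ik jk]] := card3_third t3 it jt ij; subst t.
have ptE u : (u <= N)%N -> [/\ pt2 N i j (N - u) u = pt3 N i j k (N - u) u 0,
    on_grid (pt3 N i j k (N - u) u 0) & gsupp (pt3 N i j k (N - u) u 0) \subset [set i; j; k]].
  move=> uN; have [|_ _ _ ? ?] := pt3P N0 ij jk ik (_ : (N - u + u + 0 = N)%N); first by lia.
  split=> //; rewrite /pt2 /pt3; apply/ffunP => l; rewrite !ffunE.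
  by do 3?case: ifP.
have [e1 g1 s1] := ptE m (ltnW mN); have [e2 g2 s2] := ptE m.+1 mN.
rewrite /edge_path big_ord_recr /= addrA -/(edge_path i j m) -IHm; last exact: ltnW.
rewrite (prim (pt2 N i j (N - m) m)) ?e1 ?e2 // ?F2_addK //.
have [|i1 j1 k1 _ _] := pt3P N0 ij jk ik (_ : (N - m + m + 0 = N)%N); first by lia.
have [|i2 j2 k2 _ _] := pt3P N0 ij jk ik (_ : (N - m.+1 + m.+1 + 0 = N)%N); first by lia.
apply: (grid_edge N0 Ksurf tF) => //.
  by apply: (gclose_coord s1 s2); rewrite ?i1 ?j1 ?k1 ?i2 ?j2 ?k2; lia.
by apply/eqP => /ffunP/(_ j)/(congr1 (@nat_of_ord _)); rewrite j1 j2; lia.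
Qed.

(* Restriction of the cochain to K: its sums along the subdivided edges. *)
Definition coarse (s : {set 'I_n}) : F2 :=
  if [pick p : 'I_n * 'I_n | (p.1 != p.2) && (s == [set p.1; p.2])] is Some p
  then edge_path p.1 p.2 N else 0.

(** [coarse] picks an ordering of the two ends of the edge; a primitive shows that both orderings
    give the same value. *)
Lemma coarseE t f i j : t \in triangles_of K -> i \in t -> j \in t -> i != j ->
  primitive_on t f -> coarse [set i; j] = f (corner i) + f (corner j).
Proof.
move=> tF it jt ij prim; rewrite /coarse; case: pickP => [[x y] /= /andP[xy /eqP ijxy]|].
  have [xt yt] : x \in t /\ y \in t.
    have sub : [set i; j] \subset t by rewrite subUset !sub1set it jt.
    by move: sub; rewrite ijxy subUset !sub1set => /andP[].
  have := primitive_edge_path tF xt yt xy prim (leqnn N).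
  rewrite pt2_N // => fy.
  have -> : edge_path x y N = f (corner x) + f (corner y) by rewrite fy F2_addK.
  rewrite -(cob0_pair (fun l => f (corner l)) xy) -ijxy cob0_pair //.
by move/(_ (i, j)); rewrite /= ij eqxx.
Qed.

Lemma primitive_exists t : cocycle (edges_of T) (triangles_of T) phi -> t \in triangles_of K ->
  exists f, primitive_on t f.
Proof.
move=> phic tF; have [x [y [z [tE xy yz xz]]]] := triangleP KEF tF; subst t.
exact: triangle_primitive.
Qed.

Lemma coarse_cocycle : cocycle (edges_of T) (triangles_of T) phi ->
  cocycle (edges_of K) (triangles_of K) coarse.
Proof.
move=> phic t tF; have [f prim] := primitive_exists phic tF.
have [x [y [z [tE xy yz xz]]]] := triangleP KEF tF; subst t.
have [xt yt zt] : [/\ x \in [set x; y; z], y \in [set x; y; z] & z \in [set x; y; z]].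
  by rewrite !inE !eqxx !orbT.
rewrite (cob1_triangle KEF) // !(coarseE tF _ _ _ prim) //.
have -> : forall u v w : F2, u + v + (v + w) + (u + w) = (u + u) + (v + v) + (w + w).
  by move=> u v w; ring.
by rewrite !F2_addxx.
Qed.

(** Each triangle has a primitive of [phi], which may be shifted by a constant. Prescribing the
    values [g] at the corners makes the primitives agree on common points, so they glue. *)
Lemma coarse_coboundary : cocycle (edges_of T) (triangles_of T) phi ->
  coboundary (edges_of K) coarse -> coboundary (edges_of T) phi.
Proof.
move=> phic [g gP].
have [FT FTP] : exists FT : {set 'I_n} -> gpoint n N -> F2, forall t, t \in triangles_of K ->
    primitive_on t (FT t) /\ forall i, i \in t -> FT t (corner i) = g i.
  apply: (@fin_all_exists _ (fun=> gpoint n N -> F2) (fun t f => t \in triangles_of K ->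
    primitive_on t f /\ forall i, i \in t -> f (corner i) = g i)) => t.
  have [tF|] := boolP (t \in triangles_of K); last by exists (fun=> 0).
  have [f prim] := primitive_exists phic tF.
  have [x [y [z [tE xy yz xz]]]] := triangleP KEF tF.
  have xt : x \in t by rewrite tE !inE eqxx.
  (* The shift that turns [f] into [g] is the same at all corners, because [f] and [g] have the same
     differences along edges of [K]. *)
  exists (fun a => f a + (f (corner x) + g x)) => _; split=> [a b abE at_ bt|i it].
    rewrite (prim a b) // addrACA F2_addxx addr0 //.
  have [->|xi] := eqVneq i x; first by rewrite F2_addK.
  have xi' : x != i by rewrite eq_sym.
  have xiE : [set x; i] \in edges_of K.
    case: KEF => _ _ FE _; apply: (FE t) => //; first by rewrite subUset !sub1set xt it.
    by rewrite cards2 xi'.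
  have := gP _ xiE; rewrite (coarseE tF xt it xi' prim) cob0_pair // => h.
  by rewrite addrA [f (corner i) + _]addrC h addrAC F2_addxx add0r.
(* A point common to two triangles is a corner or lies on an edge [ij], where both primitives arise
   from [g i] by summing [phi] along that edge. *)
have agree t t' a : t \in triangles_of K -> t' \in triangles_of K -> on_grid a ->
    gsupp a \subset t -> gsupp a \subset t' -> FT t a = FT t' a.
  move=> tF t'F aN at_ at'; have [->//|tt'] := eqVneq t t'.
  have [_ F3 _ _] := KEF.
  have card2 : (#|gsupp a| <= 2)%N.
    rewrite leqNgt; apply: contra tt' => a3.
    have full s : s \in triangles_of K -> gsupp a \subset s -> gsupp a = s.
      by move=> sF as_; apply/eqP; rewrite eqEcard as_ F3.
    by rewrite -(full t) // (full t').
  have /set0Pn[i ia] := on_grid_supp N0 aN.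
  have [/eqP|a1] := boolP (gsupp a :\ i == set0).
    move=> a0; have aE : a = corner i.
      have out l : l != i -> a l = 0%N :> nat.
        move=> li; apply/eqP; apply: contraT => al.
        by have : l \in gsupp a :\ i; [rewrite !inE li al|rewrite a0 inE].
      apply/ffunP => l; apply: val_inj; rewrite /= cornerP; case: eqP => [->|/eqP/out //].
      move/eqP: aN; rewrite (bigD1 i) //= big1 ?addn0 // => l li; exact: out.
    have [it it'] : i \in t /\ i \in t' by split; [exact: (subsetP at_)|exact: (subsetP at')].
    by rewrite aE; have [_ ->//] := FTP _ tF; have [_ ->//] := FTP _ t'F.
  have /set0Pn[j] := a1; rewrite !inE => /andP[ji ja].
  have ij : i != j by rewrite eq_sym.
  have ja' : j \in gsupp a by rewrite inE.
  have aij : gsupp a = [set i; j].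
    apply/esym/eqP; rewrite eqEcard subUset !sub1set ia ja' cards2 ij //.
  have out l : l != i -> l != j -> a l = 0%N :> nat.
    by move=> li lj; apply: (@gsupp_out _ _ a [set i; j]); rewrite ?aij // !inE negb_or li lj.
  have sa : (a i + a j = N)%N.
    have /eqP := aN; rewrite (bigD1 i) //= (bigD1 j) //= big1 ?addn0 // => l /andP[li lj].
    exact: out.
  have aE : a = pt2 N i j (N - a j) (a j).
    have ajN : (a j <= N)%N by coord_lia.
    apply/ffunP => l; apply: val_inj; rewrite /= pt2P //.
    have [->|li] := eqVneq l i; first by coord_lia.
    by have [->//|lj] := eqVneq l j; rewrite out.
  have val s : s \in triangles_of K -> gsupp a \subset s -> FT s a = g i + edge_path i j (a j).
    move=> sF; rewrite aij subUset !sub1set => /andP[is_ js].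
    have [prim cor] := FTP _ sF; rewrite {1}aE -(cor i is_).
    by rewrite (primitive_edge_path sF is_ js ij prim) // -ltnS.
  by rewrite (val t) // (val t').
(* Any triangle containing [a] will do, by [agree]; [set0] is a dummy for points in no triangle. *)
pose tau a := odflt set0 [pick t in triangles_of K | gsupp a \subset t].
exists (fun a => FT (tau a) a) => e eE.
have : #|e| == 2%N by move: eE; rewrite inE => /andP[].
case/cards2P => a [b [ab ee]]; subst e.
have [_ aN bN _ [t tF [at_ bt]]] := grid_edge_inv Ksurf eE.
have tauE c : on_grid c -> gsupp c \subset t -> FT (tau c) c = FT t c.
  move=> cN ct; rewrite /tau; case: pickP => [t' /andP[t'F ct']|/(_ t)]; last by rewrite tF ct.
  exact: agree.
rewrite cob0_pair // !tauE //.
by have [prim _] := FTP _ tF; exact: prim.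
Qed.
End Primitive.

(** The chosen ordering depends on [s] alone, so restriction to [K] is additive. *)
Lemma coarseD phi psi s : coarse (fun e => phi e + psi e) s = coarse phi s + coarse psi s.
Proof.
rewrite /coarse; case: pickP => [p _|_]; last by rewrite addr0.
exact: big_split.
Qed.

Lemma grid_H1 : H1_index_le2 (edges_of K) (triangles_of K) ->
  H1_index_le2 (edges_of T) (triangles_of T).
Proof.
move=> H1 phi psi phic psic.
have sumc : cocycle (edges_of T) (triangles_of T) (fun e => phi e + psi e).
  by move=> t tF; rewrite cob1D phic // psic // addr0.
have [h|h|h] := H1 _ _ (coarse_cocycle phic) (coarse_cocycle psic).
- by constructor 1; exact: coarse_coboundary.
- by constructor 2; exact: coarse_coboundary.
constructor 3; apply: coarse_coboundary => //.
by have [f fP] := h; exists f => e eE; rewrite coarseD fP.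
Qed.

End GridCohomology.

(** * Minors from connected vertex sets *)

Definition adj_in (W : finType) (E : {set {set W}}) (S : {set W}) : rel W :=
  [rel x y | [&& x \in S, y \in S & [set x; y] \in E]].

Definition connected_in (W : finType) (E : {set {set W}}) (S : {set W}) :=
  forall x y, x \in S -> y \in S -> connect (adj_in E S) x y.

Lemma adj_in_sym (W : finType) (E : {set {set W}}) S : connect_sym (adj_in E S).
Proof. by apply: sym_connect_sym => x y; rewrite /adj_in /= andbCA setUC. Qed.

Lemma connect_adj_sub (W : finType) (E : {set {set W}}) (S S' : {set W}) x y :
  S \subset S' -> connect (adj_in E S) x y -> connect (adj_in E S') x y.
Proof.
move=> /subsetP SS; apply: connect_sub => {}x {}y /and3P[xS yS xyE].
by apply: connect1; rewrite /adj_in /= !SS.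
Qed.

Section MinorFromSets.
Variables (W V I : finType) (E : {set {set W}}) (ends : I -> {set V}).
Variables (X : V -> {set W}) (Y : I -> {set W}) (tail head : I -> V).
Hypothesis endsE : forall e, ends e = [set tail e; head e].
Hypothesis tail_head : forall e, tail e != head e.
Hypothesis X_conn : forall v, connected_in E (X v).
Hypothesis X_disj : forall v w x, x \in X v -> x \in X w -> v = w.
Hypothesis Y_conn : forall e, connected_in E (Y e).
Hypothesis Y_tail : forall e, exists2 x, x \in Y e & x \in X (tail e).
Hypothesis Y_head : forall e, exists2 x, x \in Y e & x \in X (head e).
Hypothesis YX_disj : forall e v x, x \in Y e -> x \in X v -> v \in ends e.
Hypothesis YY_disj : forall e e' x, x \in Y e -> x \in Y e' -> e = e'.

(** The connecting piece [Y e] is absorbed by its tail, but only the part [C e] that the tail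
    reaches without entering [X (head e)]. The edge by which a walk in [Y e] first enters
    [X (head e)] then represents [e]. *)
Let Y' e := Y e :\: X (head e).
Let C e := [set w in Y' e | [exists x in X (tail e) :&: Y' e, connect (adj_in E (Y' e)) x w]].
Let B v := X v :|: \bigcup_(e | tail e == v) C e.

Let B_disj v w x : x \in B v -> x \in B w -> v = w.
Proof.
have CX e u : x \in C e -> x \in X u -> u = tail e.
  rewrite inE in_setD => /andP[/andP[xh xY] _] xu.
  have : u \in [set tail e; head e] by rewrite -endsE; exact: YX_disj xu.
  rewrite in_set2; by case/orP => /eqP // uh; rewrite -uh xu in xh.
rewrite !in_setU => /orP[xv|/bigcupP[e /eqP <- xC]];
  move=> /orP[xw|/bigcupP[e' /eqP <- xC']].
- exact: X_disj xv xw.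
- exact: CX xv.
- by apply/esym; exact: CX xw.
- congr tail; apply: (@YY_disj _ _ x) => //.
    by move: xC; rewrite inE in_setD => /andP[/andP[]].
  by move: xC'; rewrite inE in_setD => /andP[/andP[]].
Qed.

Let C_sub e : C e \subset B (tail e).
Proof.
by apply/subsetP => x xC; rewrite in_setU; apply/orP; right; apply/bigcupP; exists e.
Qed.

Let C_conn e w : w \in C e -> exists2 x, x \in X (tail e) & connect (adj_in E (B (tail e))) x w.
Proof.
rewrite inE => /andP[_ /existsP[x /andP[xXY conn]]].
have [xX xY] : x \in X (tail e) /\ x \in Y' e by move: xXY; rewrite in_setI => /andP.
exists x => //; have xC : x \in C e.
  by rewrite inE xY; apply/existsP; exists x; rewrite xXY connect0.
case/connectP: conn => p; elim/last_ind: p w => [|p z IHp] w; first by move=> _ ->.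
rewrite rcons_path last_rcons => /andP[pth yz] ->.
apply: connect_trans (IHp _ pth erefl) _; apply: connect1.
have /and3P[lY zY lzE] := yz.
have inC u : u \in Y' e -> connect (adj_in E (Y' e)) x u -> u \in B (tail e).
  move=> uY xu; apply: (subsetP (@C_sub e)); rewrite inE uY; apply/existsP.
  by exists x; rewrite xXY.
have xl : connect (adj_in E (Y' e)) x (last x p) by apply/connectP; exists p.
by rewrite /adj_in /= lzE !inC // (connect_trans xl) // connect1.
Qed.

Lemma minor_from_sets : exists beta, forall A : {set {set V}},
  (forall e, e \in A -> exists i, e = ends i) -> minor_model E A beta.
Proof.
pose beta w := [pick v | w \in B v].
have betaP w v : (beta w == Some v) = (w \in B v).
  rewrite /beta; case: pickP => [u wu|/(_ v) ->]; last by [].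
  apply/eqP/idP => [[<-]//|wv]; congr Some; exact: B_disj wu wv.
have fibE v : fiber_adj E beta v =2 adj_in E (B v).
  by move=> x y; rewrite /fiber_adj /adj_in /= !betaP.
exists beta => A Aends; split=> [x y v /eqP|_ /Aends[e ->]].
  rewrite betaP => xB /eqP; rewrite betaP => yB; rewrite (eq_connect (fibE v)).
  have toX w : w \in B v -> exists2 z, z \in X v & connect (adj_in E (B v)) z w.
    rewrite in_setU => /orP[wX|/bigcupP[e /eqP ev wC]]; first by exists w.
    by rewrite -ev; exact: C_conn.
  have [x' x'X cx] := toX x xB; have [y' y'X cy] := toX y yB.
  rewrite adj_in_sym; apply: connect_trans cx; rewrite adj_in_sym; apply: connect_trans cy.
  by apply: connect_adj_sub (X_conn x'X y'X); exact: subsetUl.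
have th := tail_head e.
have [p pY pX] := Y_tail e; have [q qY qX] := Y_head e.
have pY' : p \in Y' e.
  rewrite in_setD pY andbT; apply: contra th => ph; apply/eqP; exact: X_disj pX ph.
have pC : p \in C e.
  by rewrite inE pY'; apply/existsP; exists p; rewrite in_setI pX pY' connect0.
have /connectP[s] := Y_conn pY qY.
(* Walk along [Y e] towards the head; the current vertex stays in [C e] until the step into
   [X (head e)]. *)
elim: s p pC {pY pX pY'} => [|z s IHs] p pC /=.
  by move=> _ qp; move: pC; rewrite inE in_setD -qp qX.
case/andP => /and3P[pY zY pzE] pth lst.
have [zX|zX] := boolP (z \in X (head e)).
  exists p, z, (tail e), (head e); split=> //; apply/eqP; rewrite betaP.
    exact: (subsetP (@C_sub e)).
  by rewrite in_setU zX.
apply: (IHs z _ pth lst); have zY' : z \in Y' e by rewrite in_setD zX zY.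
rewrite inE zY'; move: pC; rewrite inE => /andP[pY' /existsP[x /andP[xX xp]]].
apply/existsP; exists x; rewrite xX (connect_trans xp) // connect1 //.
by rewrite /adj_in /= pY' zY' pzE.
Qed.
End MinorFromSets.

(** * Greedy labellings *)

Lemma edge_set_card2 (G : sgraph) (e : {set G}) : e \in edge_set G -> #|e| = 2%N.
Proof.
case/imsetP => -[u v] /=; rewrite inE /= => uv ->; rewrite cards2.
by case: eqP uv => // ->; rewrite adj_irr.
Qed.

Section Greedy.
Variables (d : nat) (G : sgraph) (L : element G -> {fset int}) (A : {set edge G}).
Hypothesis d0 : (0 < d)%N.
Implicit Types (c : element G -> int) (Z : {set element G}) (e : edge G) (u v : G).

Definition edeg (A : {set edge G}) u := #|[set e in A | u \in val e]|.

(** Vertices constrain each other only through edges of [A], whereas the constraints involving edges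
    are governed by the coloured set [Z]. *)
Definition joined u v := [exists e in A, val e == [set u; v]].

Definition compatible c (x y : element G) : bool :=
  match x, y with
  | inl u, inl v => joined u v ==> (c x != c y)
  | inr e, inr e' => (val e :&: val e' != set0) ==> (c x != c y)
  | inl u, inr e | inr e, inl u => (u \in val e) ==> (d%:Z <= `|c x - c y|)
  end.

(** [Z] is the set of coloured elements. Elsewhere [c] is an arbitrary member of the list, so
    uncolouring just shrinks [Z]. *)
Definition partial_labelling Z c :=
  (forall x, c x \in L x) /\ (forall x y, x \in Z -> y \in Z -> x != y -> compatible c x y).

(** The labels at distance less than [d] from [z]; their number [2d - 1] is the price of one
    incidence in the budgets below. *)
Definition near_labels (z : int) : seq int := [seq z + i%:Z - d.-1%:Z | i <- iota 0 (2 * d).-1].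

Lemma near_labelsP z w : w \notin near_labels z -> d%:Z <= `|z - w| /\ d%:Z <= `|w - z|.
Proof.
move=> wz; suff h : d%:Z <= `|w - z| by rewrite distrC.
rewrite leNgt; apply: contra wz => wz; apply/mapP.
exists (absz (w - z + d.-1%:Z)); first by rewrite mem_iota; lia.
by lia.
Qed.

Definition forbidden c (x y : element G) : seq int :=
  match x, y with
  | inl u, inl v => if joined u v then [:: c y] else [::]
  | inr e, inr e' => if val e :&: val e' != set0 then [:: c y] else [::]
  | inl u, inr e | inr e, inl u => if u \in val e then near_labels (c y) else [::]
  end.

Lemma joinedC u v : joined u v = joined v u.
Proof. by apply: eq_existsb => e; rewrite setUC. Qed.

Lemma forbiddenP c x y z : z \notin forbidden c x y -> x != y ->
  let c' := fun t => if t == x then z else c t in compatible c' x y /\ compatible c' y x.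
Proof.
move=> zf xy /=; rewrite /compatible; move: zf; rewrite /forbidden.
have yx : y == x = false by rewrite eq_sym (negPf xy).
case: x y xy yx => [u|e] [v|e'] xy yx; rewrite ?eqxx ?yx.
- rewrite (joinedC v u); case: (joined u v) => //=; rewrite inE => zc.
  by rewrite zc eq_sym zc.
- by case: (u \in _) => //= /near_labelsP[-> ->].
- by case: (v \in _) => //= /near_labelsP[-> ->].
- rewrite [val e' :&: _]setIC; case: (_ != _) => //=; rewrite inE => zc.
  by rewrite zc eq_sym zc.
Qed.

Lemma fset_avoid (s : {fset int}) (t : seq int) : (size t < #|` s|)%N -> exists2 z, z \in s & z \notin t.
Proof.
move=> ts; have [/allP sub|/allPn[z zs zt]] := boolP (all (mem t) s); last by exists z.
by have := uniq_leq_size (fset_uniq s) sub; rewrite leqNgt ts.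
Qed.

Lemma partial_extend Z c x : partial_labelling Z c -> x \notin Z ->
    (\sum_(y in Z) size (forbidden c x y) < #|` L x|)%N ->
  exists c', partial_labelling (x |: Z) c'.
Proof.
move=> [cL cZ] xZ sz.
pose t := flatten [seq forbidden c x y | y <- enum Z].
have [|z zL zt] := @fset_avoid (L x) t.
  rewrite size_flatten /shape -map_comp sumnE big_map big_enum /= .
  exact: sz.
have zf y : y \in Z -> z \notin forbidden c x y.
  move=> yZ; apply: contra zt => zf; apply/flattenP; exists (forbidden c x y) => //.
  by apply/mapP; exists y => //; rewrite mem_enum.
exists (fun t => if t == x then z else c t); split=> [y|y y'].
  by case: eqP => [->|].
have neq w : w \in Z -> w != x by apply: contraTneq => ->.
rewrite !in_setU1 => /orP[/eqP ->|yZ] /orP[/eqP ->|y'Z] yy'; first by rewrite eqxx in yy'.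
- by have [] := forbiddenP (zf _ y'Z) yy'.
- by have [] := @forbiddenP c x y z (zf _ yZ); rewrite 1?eq_sym.
have := cZ y y' yZ y'Z yy'; have := neq _ yZ; have := neq _ y'Z.
by rewrite /compatible; case: y {yZ yy'} => [u|e]; case: y' {y'Z} => [u'|e'] /negPf -> /negPf ->.
Qed.

Definition edges_at Z u := [set e | (inr e \in Z) && (u \in val e)].

Lemma size_near_labels z : size (near_labels z) = (2 * d).-1.
Proof. by rewrite size_map size_iota. Qed.

Lemma forbidden_vertex_size Z c u :
  (\sum_(y in Z) size (forbidden c (inl u) y) <= edeg A u + (2 * d).-1 * #|edges_at Z u|)%N.
Proof.
rewrite big_sumType /=; apply: leq_add; last first.
  rewrite mulnC -sum_nat_const big_mkcond [leqRHS]big_mkcond; apply: leq_sum => e _.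
  by rewrite [e \in edges_at _ _]inE; case: ifP => //= _; case: ifP; rewrite ?size_near_labels.
apply: (@leq_trans #|[set v | joined u v]|).
  rewrite -sum1_card big_mkcond [leqRHS]big_mkcond; apply: leq_sum => v _.
  by rewrite [v \in finset _]inE; case: ifP => //= _; case: ifP.
have inj : {in [set v | joined u v] &, injective (fun v => [set u; v])}.
  move=> v w; rewrite !inE => /existsP[e /andP[eA /eqP ev]] _ /setP/(_ v).
  rewrite !inE eqxx orbT => /esym/orP[/eqP vu|/eqP //].
  by have := edge_set_card2 (valP e); rewrite ev vu setUid cards1.
rewrite -(card_in_imset inj) /edeg -[leqRHS](card_imset _ val_inj); apply: subset_leq_card.
apply/subsetP => s /imsetP[v + ->]; rewrite inE => /existsP[e /andP[eA /eqP ev]].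
by apply/imsetP; exists e => //; rewrite inE eA ev !inE eqxx.
Qed.

Lemma forbidden_edge_size Z c e u v : val e = [set u; v] ->
  (\sum_(y in Z) size (forbidden c (inr e) y) <=
   #|edges_at Z u| + #|edges_at Z v| + (2 * d).-1 * ((inl u \in Z) + (inl v \in Z)))%N.
Proof.
move=> ev; have uv : u != v by have := edge_set_card2 (valP e); rewrite ev cards2; case: eqP.
rewrite big_sumType /= addnC; apply: leq_add.
  apply: (@leq_trans #|edges_at Z u :|: edges_at Z v|); last by rewrite cardsU leq_subr.
  rewrite -sum1_card big_mkcond [leqRHS]big_mkcond; apply: leq_sum => e' _.
  case: ifP => // e'Z; case: ifP => // /set0Pn[w]; rewrite ev in_setI in_set2 => /andP[wuv we'].
  by rewrite in_setU !inE e'Z /=; case/orP: wuv => /eqP <-; rewrite we' ?orbT.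
rewrite ev (bigID (mem [set u; v])) /= [X in (_ + X)%N]big1 ?addn0; last first.
  by move=> w /andP[_ /negPf ->].
under eq_bigl do rewrite andbC.
rewrite big_mkcondr big_setU1 ?inE //= big_set1 !inE !eqxx orbT /= size_near_labels mulnDr.
by case: (inl u \in Z); case: (inl v \in Z); rewrite ?muln1 ?muln0 ?size_near_labels.
Qed.
End Greedy.

Definition graph_elements (G : sgraph) (A : {set edge G}) : {set element G} :=
  [set x | if x is inr e then e \in A else true].

(** One end is uncoloured: incident edges take up to [M] labels and the other end [2d - 1]. *)
Lemma edge_budget1 (d M su sv : nat) (b : bool) : (0 < d)%N -> (su + sv <= M)%N ->
  (su + sv + (2 * d).-1 * (false + b) < M + 2 * d)%N.
Proof. by case: b; lia. Qed.

(** Two coloured ends cost [4d - 2], which leaves room for [M - 2d + 1] incident edges. *)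
Lemma edge_budget2 (d M su sv : nat) (b b' : bool) : (0 < d)%N -> (su + sv + 2 * d <= M + 1)%N ->
  (su + sv + (2 * d).-1 * (b + b') < M + 2 * d)%N.
Proof. by case: b; case: b'; lia. Qed.

(** Every reduction colours [u] when at most three edges at it are coloured, at a cost of
    [6d - 3]. *)
Lemma vertex_budget (d M n s : nat) : (0 < d)%N -> (s <= 3)%N -> (n + 4 * d <= M + 2)%N ->
  (n + (2 * d).-1 * s < M + 2 * d)%N.
Proof.
move=> d0 s3 nM; apply: (@leq_ltn_trans (n + (2 * d).-1 * 3)); last by lia.
by rewrite leq_add2l leq_mul2l s3 orbT.
Qed.

(** * Reducible configurations *)

Section Reductions.
Variables (d M : nat) (G : sgraph) (L : element G -> {fset int}).
Hypothesis d0 : (0 < d)%N.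
Hypothesis L_card : forall x, #|` L x| = (M + 2 * d)%N.
Implicit Types (A : {set edge G}) (Z : {set element G}) (e f : edge G) (u v w : G).

Definition labellable A := exists c, partial_labelling d L A (graph_elements A) c.

Lemma edge_ends e : exists u v, val e = [set u; v] /\ u != v.
Proof.
by have /eqP/cards2P[u [v [uv ev]]] := edge_set_card2 (valP e); exists u, v.
Qed.

(* Uncolouring u removes the only constraint on vertices that the deletion of e adds. *)
Lemma labelling_uncolour A e u v c Z : val e = [set u; v] ->
    partial_labelling d L (A :\ e) (graph_elements (A :\ e)) c ->
    Z \subset graph_elements (A :\ e) -> inl u \notin Z ->
  partial_labelling d L A Z c.
Proof.
move=> ev [cL cZ] /subsetP ZA uZ; split=> // x y xZ yZ xy.
have := cZ x y (ZA _ xZ) (ZA _ yZ) xy.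
case: x y xZ yZ {xy} => [x|f] [y|f'] //= xZ yZ /implyP h; apply/implyP => /existsP[f /andP[fA /eqP fE]].
apply: h; apply/existsP; exists f; rewrite in_setD1 fA fE eqxx !andbT.
apply/eqP => fe; subst f; have : u \in val e by rewrite ev set21.
by rewrite fE in_set2 => /orP[] /eqP ux; subst u; [rewrite xZ in uZ|rewrite yZ in uZ].
Qed.

Lemma extend_edge A Z c e u v : partial_labelling d L A Z c -> inr e \notin Z -> val e = [set u; v] ->
    (#|edges_at Z u| + #|edges_at Z v| + (2 * d).-1 * ((inl u \in Z) + (inl v \in Z)) < M + 2 * d)%N ->
  exists c', partial_labelling d L A (inr e |: Z) c'.
Proof.
move=> cZ eZ ev sz; apply: partial_extend cZ eZ _ => //; rewrite L_card.
by apply: leq_ltn_trans sz; exact: forbidden_edge_size ev.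
Qed.

Lemma extend_vertex A Z c u : partial_labelling d L A Z c -> inl u \notin Z ->
    (edeg A u + (2 * d).-1 * #|edges_at Z u| < M + 2 * d)%N ->
  exists c', partial_labelling d L A (inl u |: Z) c'.
Proof.
move=> cZ uZ sz; apply: partial_extend cZ uZ _ => //; rewrite L_card.
by apply: leq_ltn_trans sz; exact: forbidden_vertex_size.
Qed.

Lemma edges_at_full A Z u (Q : {set edge G}) : (forall e, inr e \in Z -> (e \in A) && (e \notin Q)) ->
  (forall e, e \in Q -> e \in A /\ u \in val e) -> (#|edges_at Z u| + #|Q| <= edeg A u)%N.
Proof.
move=> ZA QA; have dis : edges_at Z u :&: Q = set0.
  apply/setP => e; rewrite !inE; apply/negbTE/negP => /andP[/andP[/ZA/andP[_ eQ] _] eQ'].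
  by rewrite eQ' in eQ.
rewrite -[leqLHS]subn0 -[X in (_ - X)%N](@cards0 (edge G)) -dis -cardsU.
apply: subset_leq_card; apply/subsetP => e; rewrite !inE => /orP[/andP[/ZA/andP[-> _] ->]//|/QA[-> ->] //].
Qed.

Lemma edges_at_le A Z u : (forall e, inr e \in Z -> e \in A) -> (#|edges_at Z u| <= edeg A u)%N.
Proof.
move=> ZA; apply: subset_leq_card; apply/subsetP => e; rewrite !inE => /andP[/ZA -> ->] //.
Qed.

Lemma edges_at_lt A Z u e : (forall e, inr e \in Z -> e \in A) -> e \in A -> inr e \notin Z ->
  u \in val e -> (#|edges_at Z u| < edeg A u)%N.
Proof.
move=> ZA eA eZ ue; rewrite -addn1 -(cards1 e); apply: edges_at_full.
  by move=> f fZ; rewrite ZA // inE; apply: contraNneq eZ => <-.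
by move=> f; rewrite inE => /eqP ->.
Qed.

Lemma labellable_full A Z c : partial_labelling d L A Z c -> graph_elements A \subset Z -> labellable A.
Proof.
move=> [cL cZ] /subsetP AZ; exists c; split=> // x y xA yA; exact: cZ (AZ _ xA) (AZ _ yA).
Qed.

Section OneEdge.
Variables (A : {set edge G}) (e : edge G) (u v : G).
Hypotheses (eA : e \in A) (ev : val e = [set u; v]).
Hypothesis IH : labellable (A :\ e).

Let ue : u \in val e. Proof. by rewrite ev set21. Qed.
Let ve : v \in val e. Proof. by rewrite ev set22. Qed.
Let uv : u != v. Proof. by have := edge_set_card2 (valP e); rewrite ev cards2; case: eqP. Qed.

Let Z0 := graph_elements (A :\ e) :\ inl u.

Let Z0_sub : Z0 \subset graph_elements (A :\ e). Proof. exact: subD1set. Qed.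

Let Z0_edge f : (inr f \in Z0) = (f \in A :\ e). Proof. by rewrite !inE. Qed.

Let Z0_A f : inr f \in Z0 -> f \in A. Proof. by rewrite Z0_edge in_setD1 => /andP[]. Qed.

Let uZ0 : inl u \notin Z0. Proof. by rewrite !inE eqxx. Qed.
Let eZ0 : inr e \notin Z0. Proof. by rewrite Z0_edge !inE eqxx. Qed.

Let full_sub (Z : {set element G}) : inl u \in Z -> inr e \in Z -> Z0 \subset Z -> graph_elements A \subset Z.
Proof.
move=> uZ eZ /subsetP ZZ; apply/subsetP => x xA.
have [->//|xu] := eqVneq x (inl u); have [->//|xe] := eqVneq x (inr e).
apply: ZZ; rewrite in_setD1 xu /=; move: xA xe; rewrite !inE; case: x {xu} => // f fA fe.
by rewrite in_setD1 fA andbT; apply: contra fe => /eqP ->.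
Qed.

Lemma reduce3 : (edeg A u <= 3)%N -> (4 * d + 1 <= M)%N -> (edeg A u + edeg A v <= M + 2)%N ->
  labellable A.
Proof.
move=> u3 dM uvM; have [c cP] := IH.
have c0 := labelling_uncolour ev cP Z0_sub uZ0.
have hu := edges_at_lt Z0_A eA eZ0 ue; have hv := edges_at_lt Z0_A eA eZ0 ve.
have [|c1 c1P] := extend_edge c0 eZ0 ev.
  rewrite (negPf uZ0); apply: edge_budget1 => //.
  by clear -hu hv uvM; lia.
have uZ1 : inl u \notin inr e |: Z0 by rewrite in_setU1 negb_or uZ0.
have [|c2 c2P] := extend_vertex c1P uZ1.
  have h : (#|edges_at (inr e |: Z0) u| <= edeg A u)%N.
    by apply: edges_at_le => f; rewrite in_setU1 => /orP[/eqP[->]|/Z0_A].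
  by apply: vertex_budget => //; clear -h u3 dM; lia.
apply: labellable_full c2P _; apply: full_sub; rewrite ?in_setU1 ?eqxx ?orbT //.
by apply/subsetP => x xZ; rewrite !in_setU1 xZ !orbT.
Qed.

(** Three coloured edges at [u] can be afforded, so [u] is recoloured before [e]; the edge then
    faces two coloured ends, whence the stronger condition on [v]. *)
Lemma reduce4 : edeg A u = 4%N -> (4 * d + 2 <= M)%N -> (edeg A v + 2 * d + 1 <= M)%N ->
  labellable A.
Proof.
move=> u4 dM vM; have [c cP] := IH.
have c0 := labelling_uncolour ev cP Z0_sub uZ0.
have hu := edges_at_lt Z0_A eA eZ0 ue; have hv := edges_at_lt Z0_A eA eZ0 ve.
have [|c1 c1P] := extend_vertex c0 uZ0.
  by apply: vertex_budget => //; clear -hu u4 dM; lia.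
have eZ1 : inr e \notin inl u |: Z0 by rewrite in_setU1 negb_or eZ0.
have [|c2 c2P] := extend_edge c1P eZ1 ev.
  have Z1_A f : inr f \in inl u |: Z0 -> f \in A by rewrite in_setU1 => /orP[//|/Z0_A].
  have hu1 := edges_at_lt Z1_A eA eZ1 ue; have hv1 := edges_at_lt Z1_A eA eZ1 ve.
  by apply: edge_budget2 => //; clear -hu1 hv1 u4 vM; lia.
apply: labellable_full c2P _; apply: full_sub; rewrite ?in_setU1 ?eqxx ?orbT //.
by apply/subsetP => x xZ; rewrite !in_setU1 xZ !orbT.
Qed.

(** Deleting [e] alone would leave four coloured edges at [u], one too many for [vertex_budget].
    Clearing [f] as well means that both edges are coloured last against two coloured ends, hence
    the same condition on [v] and [w]. *)
Lemma reduce5 f w : edeg A u = 5%N -> (4 * d + 3 <= M)%N -> (edeg A v + 2 * d + 2 <= M)%N ->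
    f \in A -> f != e -> val f = [set u; w] -> (edeg A w + 2 * d + 2 <= M)%N ->
  labellable A.
Proof.
move=> u5 dM vM fA fe fw wM; have [c cP] := IH.
have uf : u \in val f by rewrite fw set21.
have wf : w \in val f by rewrite fw set22.
pose Z1 := Z0 :\ inr f.
have Z1_A g : inr g \in Z1 -> g \in A by rewrite in_setD1 => /andP[_ /Z0_A].
have uZ1 : inl u \notin Z1 by rewrite in_setD1 negb_and uZ0 orbT.
have c0 : partial_labelling d L A Z1 c.
  apply: labelling_uncolour ev cP _ uZ1; apply: fintype.subset_trans Z0_sub; exact: subD1set.
have eZ1 : inr e \notin Z1 by rewrite in_setD1 negb_and eZ0 orbT.
have fZ1 : inr f \notin Z1 by rewrite in_setD1 eqxx.
have hu : (#|edges_at Z1 u| + 2 <= edeg A u)%N.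
  have -> : 2%N = #|[set e; f]| by rewrite cards2 eq_sym fe.
  apply: edges_at_full => g; last by rewrite in_set2 => /orP[] /eqP ->.
  move=> gZ; rewrite Z1_A //= in_set2 negb_or; apply/andP; split.
    by apply: contraNneq eZ1 => <-.
  by apply: contraNneq fZ1 => <-.
have [|c1 c1P] := extend_vertex c0 uZ1.
  by apply: vertex_budget => //; clear -hu u5 dM; lia.
have eZ2 : inr e \notin inl u |: Z1 by rewrite in_setU1 negb_or eZ1.
have fZ2 : inr f \notin inl u |: Z1 by rewrite in_setU1 negb_or fZ1.
have Z2_A g : inr g \in inl u |: Z1 -> g \in A by rewrite in_setU1 => /orP[//|/Z1_A].
have [|c2 c2P] := extend_edge c1P eZ2 ev.
  have hu2 := edges_at_lt Z2_A eA eZ2 ue; have hv2 := edges_at_lt Z2_A eA eZ2 ve.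
  by apply: edge_budget2 => //; clear -hu2 hv2 u5 vM; lia.
have fZ3 : inr f \notin inr e |: (inl u |: Z1).
  by rewrite in_setU1 negb_or fZ2 andbT; apply: contra fe => /eqP[->].
have Z3_A g : inr g \in inr e |: (inl u |: Z1) -> g \in A.
  by rewrite in_setU1 => /orP[/eqP[->]//|/Z2_A].
have [|c3 c3P] := extend_edge c2P fZ3 fw.
  have hu3 := edges_at_lt Z3_A fA fZ3 uf; have hw3 := edges_at_lt Z3_A fA fZ3 wf.
  by apply: edge_budget2 => //; clear -hu3 hw3 u5 wM; lia.
apply: labellable_full c3P _; apply: full_sub; rewrite ?in_setU1 ?eqxx ?orbT //.
apply/subsetP => x xZ; have [->|xf] := eqVneq x (inr f); first by rewrite in_setU1 eqxx.
by rewrite !in_setU1 in_setD1 xf xZ !orbT.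
Qed.
End OneEdge.

End Reductions.

(** * Discharging *)

Lemma sum_setU (T : finType) (X Y : {set T}) (F : T -> nat) : [disjoint X & Y] ->
  (\sum_(x in X :|: Y) F x = \sum_(x in X) F x + \sum_(x in Y) F x)%N.
Proof. by move=> XY; rewrite -bigU //; apply: eq_bigl => x; rewrite in_setU. Qed.

Section Discharging.
Variable G : sgraph.
Implicit Types (A : {set edge G}) (X Y : {set G}) (e f : edge G) (u v w : G).
Hypothesis G_sparse : forall B : {set {set G}}, B \subset edge_set G -> sparse_edges B.

Definition covered A := [set v | (0 < edeg A v)%N].

Lemma edeg_max A v : (edeg A v <= max_degree G)%N.
Proof.
apply: (@leq_trans #|[pred w | adj v w]|); last first.
  exact: (@leq_bigmax _ (fun v : G => #|[pred w | adj v w]|) v).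
rewrite /edeg -(card_imset _ val_inj).
apply: leq_trans (leq_imset_card (fun w => [set v; w]) _).
apply: subset_leq_card; apply/subsetP => s /imsetP[e + ->]; rewrite inE => /andP[_].
case/imsetP: (valP e) => -[a b] /=; rewrite inE /= => ab ->.
rewrite in_set2 => /orP[] /eqP ->; first exact: imset_f.
by rewrite setUC; apply: imset_f; rewrite inE /= adj_sym.
Qed.

Lemma sum_edeg A X : (\sum_(v in X) edeg A v = \sum_(e in A) #|val e :&: X|)%N.
Proof.
transitivity (\sum_(v in X) \sum_(e in A) (v \in val e))%N.
  by apply: eq_bigr => v _; rewrite sum_bool_card.
rewrite exchange_big; apply: eq_bigr => e _; rewrite sum_bool_card.
by apply: eq_card => v; rewrite !inE andbC.
Qed.

Lemma sum_edeg_all A : (\sum_v edeg A v = 2 * #|A|)%N.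
Proof.
have := sum_edeg A [set: G]; rewrite (eq_bigl xpredT) => [->|v]; last by rewrite inE.
rewrite (eq_bigr (fun=> 2%N)) ?sum_nat_const 1?mulnC // => e _.
by rewrite setIT (edge_set_card2 (valP e)).
Qed.

Lemma cover_val A : cover [set val e | e in A] = covered A.
Proof.
apply/setP => v; rewrite [RHS]inE; apply/bigcupP/card_gt0P.
  by case=> s /imsetP[e eA ->] ve; exists e; rewrite inE eA.
by case=> e; rewrite inE => /andP[eA ve]; exists (val e) => //; exact: imset_f.
Qed.

Lemma edge_sparse A : A != set0 ->
  (#|A| + 3 <= 3 * #|covered A|)%N /\
  (forall X, (forall e u v, e \in A -> val e = [set u; v] -> (u \in X) != (v \in X)) ->
   (#|A| + 2 <= 2 * #|covered A|)%N).
Proof.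
move=> A0; pose B := [set val e | e in A].
have BG : B \subset edge_set G by apply/subsetP => s /imsetP[e _ ->]; exact: valP.
have B0 : B != set0.
  by have /set0Pn[e eA] := A0; apply/set0Pn; exists (val e); exact: imset_f.
have := G_sparse BG B0; rewrite cover_val card_imset; last exact: val_inj.
case=> h3 h2; split=> // X bip; apply: (h2 X) => u v /imsetP[e eA ev].
exact: (bip e).
Qed.

Definition cross A X Y := [set e in A | (val e :&: X != set0) && (val e :&: Y != set0)].

Lemma cross_ends A X Y e : [disjoint X & Y] -> e \in cross A X Y ->
  exists x y, [/\ val e = [set x; y], x \in X, y \in Y, x \notin Y & y \notin X].
Proof.
move=> /pred0P XY; rewrite inE => /and3P[_ /set0Pn[x] + /set0Pn[y]].
rewrite !in_setI => /andP[xe xX] /andP[ye yY]; exists x, y.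
have xNY : x \notin Y by have := XY x; rewrite /= xX /= => ->.
have yNX : y \notin X by have := XY y; rewrite /= yY andbT => ->.
split=> //; apply/esym/eqP; rewrite eqEcard subUset !sub1set xe ye (edge_set_card2 (valP e)) cards2.
by case: eqP xX yNX => // -> ->.
Qed.

(** The edges between [X] and [Y] form a bipartite graph on at most [|X| + |Y|] vertices, and each
    has exactly one end in [X]. *)
Lemma cross_bound A X Y : [disjoint X & Y] ->
  (\sum_(x in X) edeg (cross A X Y) x <= 2 * (#|X| + #|Y|))%N.
Proof.
move=> XY; rewrite sum_edeg.
have -> : (\sum_(e in cross A X Y) #|val e :&: X| = #|cross A X Y|)%N.
  rewrite -sum1_card; apply: eq_bigr => e /(cross_ends XY)[x [y [-> xX yY _ yNX]]].
  apply/eqP/cards1P; exists x; apply/setP => z; rewrite !inE.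
  apply/andP/eqP => [[/orP[]/eqP -> // yX]|->]; last by rewrite eqxx.
  by rewrite yX in yNX.
have [->|C0] := eqVneq (cross A X Y) set0; first by rewrite cards0.
have [_ /(_ X)] := edge_sparse C0.
have bip e u v : e \in cross A X Y -> val e = [set u; v] -> (u \in X) != (v \in X).
  move=> /(cross_ends XY)[x [y [exy xX yY xNY yNX]]] euv.
  have uv : u != v by have := edge_set_card2 (valP e); rewrite euv cards2; case: eqP.
  have : u \in [set x; y] by rewrite -exy euv set21.
  have : v \in [set x; y] by rewrite -exy euv set22.
  rewrite !in_set2 => /orP[] /eqP vE /orP[] /eqP uE; subst u v; rewrite ?eqxx // in uv *.
    by rewrite xX (negPf yNX).
  by rewrite xX (negPf yNX).
move=> /(_ bip) h; apply: leq_trans (leq_addr 2 _) (leq_trans h _); rewrite leq_mul2l /=.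
apply: (@leq_trans #|X :|: Y|); last by rewrite cardsU leq_subr.
apply: subset_leq_card; apply/subsetP => v; rewrite inE => /card_gt0P[e].
rewrite inE => /andP[/(cross_ends XY)[x [y [-> xX yY _ _]]]].
by rewrite in_set2 in_setU => /orP[] /eqP ->; rewrite ?xX ?yY ?orbT.
Qed.

Lemma discharging A (M d : nat) : (2 <= d)%N -> (5 * d + 2 <= M)%N -> (forall v, edeg A v <= M)%N ->
    A != set0 ->
    (forall e u v, e \in A -> val e = [set u; v] -> edeg A u <= 3 -> M + 3 <= edeg A u + edeg A v)%N ->
    (forall e u v, e \in A -> val e = [set u; v] -> edeg A u = 4 -> M <= edeg A v + 2 * d)%N ->
    (forall e f u v w, e \in A -> f \in A -> e != f -> val e = [set u; v] -> val f = [set u; w] ->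
      edeg A u = 5 -> M < edeg A v + 2 * d + 2 \/ M < edeg A w + 2 * d + 2)%N ->
  False.
Proof.
move=> d2 dM degM A0 red3 red4 red5.
have other e u : u \in val e -> exists v, val e = [set u; v].
  have [a [b [-> ab]]] := edge_ends e; rewrite in_set2 => /orP[] /eqP ->; first by exists b.
  by exists a; rewrite setUC.
pose V k := [set v | edeg A v == k]; pose W k := [set v | (k <= edeg A v)%N].
have dis_lt (X : {set G}) k : (forall v, v \in X -> edeg A v < k)%N -> [disjoint X & W k].
  move=> h; apply/pred0P => v /=; apply/negbTE/andP => -[/h + ]; rewrite inE; lia.
(* By [red3] a vertex of degree 1 or 2 would have a neighbour of degree above [M]. *)
have deg_ge3 v : (0 < edeg A v)%N -> (3 <= edeg A v)%N.
  move=> v0; have /card_gt0P[e] := v0; rewrite inE => /andP[eA ve].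
  have [w ew] := other _ _ ve; have := red3 _ _ _ eA ew; have := degM w.
  by move: (edeg A v) (edeg A w) => p q; lia.
have cross_deg X Y x : x \in X -> (forall e w, e \in A -> val e = [set x; w] -> w \in Y) ->
    edeg (cross A X Y) x = edeg A x.
  move=> xX h; apply: eq_card => e; rewrite !inE; case: (boolP (e \in A)) => //= eA.
  case: (boolP (x \in val e)) => [xe|]; last by rewrite andbF.
  have [w ew] := other _ _ xe; rewrite andbT; apply/andP; split; apply/set0Pn.
    by exists x; rewrite in_setI xe.
  by exists w; rewrite in_setI ew set22 (h e).
have deg3 x : x \in V 3%N -> forall e w, e \in A -> val e = [set x; w] -> (M <= edeg A w)%N.
  rewrite inE => /eqP x3 e w eA ew; have := red3 _ _ _ eA ew.
  by rewrite x3; move: (edeg A w) => p; lia.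
have deg4 x : x \in V 4%N -> forall e w, e \in A -> val e = [set x; w] -> (8 <= edeg A w)%N.
  rewrite inE => /eqP x4 e w eA ew; have := red4 _ _ _ eA ew x4.
  by move: (edeg A w) => p; lia.
have M12 : (12 <= M)%N by lia.
have b0 : (3 * #|V 3%N| <= 2 * (#|V 3%N| + #|W M|))%N.
  have disj : [disjoint V 3%N & W M] by apply: dis_lt => v; rewrite inE => /eqP ->; lia.
  apply: leq_trans (cross_bound A disj).
  rewrite mulnC -sum_nat_const; apply: leq_sum => x x3; rewrite cross_deg //.
    by move: x3; rewrite inE => /eqP ->.
  by move=> e w eA ew; rewrite inE (deg3 x x3 e w).
have V34 : [disjoint V 3%N & V 4%N].
  by apply/pred0P => v /=; rewrite !inE; apply/negbTE/andP => -[/eqP ->].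
have b1 : (3 * #|V 3%N| + 4 * #|V 4%N| <= 2 * (#|V 3%N| + #|V 4%N| + #|W 8%N|))%N.
  have disj : [disjoint V 3%N :|: V 4%N & W 8%N].
    by apply: dis_lt => v; rewrite !inE => /orP[] /eqP ->.
  have := cross_bound A disj; rewrite [#|_ :|: V 4%N|]cardsU disjoint_setI0 // cards0 subn0.
  apply: leq_trans; rewrite sum_setU //; apply: leq_add.
  - rewrite mulnC -sum_nat_const; apply: leq_sum => x x3; rewrite cross_deg ?in_setU ?x3 //.
      by move: x3; rewrite inE => /eqP ->.
    by move=> e w eA ew; rewrite inE; have := deg3 x x3 e w eA ew; lia.
  - rewrite mulnC -sum_nat_const; apply: leq_sum => x x4; rewrite cross_deg ?in_setU ?x4 ?orbT //.
      by move: x4; rewrite inE => /eqP ->.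
    by move=> e w eA ew; rewrite inE (deg4 x x4 e w).
have b2 : (3 * #|V 3%N| + 4 * #|V 4%N| + 4 * #|V 5%N| <=
           2 * (#|V 3%N| + #|V 4%N| + #|V 5%N| + #|W 7%N|))%N.
  have V345 : [disjoint V 3%N :|: V 4%N & V 5%N].
    by apply/pred0P => v /=; rewrite !inE; apply/negbTE/andP => -[/orP[] /eqP ->].
  have disj : [disjoint V 3%N :|: V 4%N :|: V 5%N & W 7%N].
    by apply: dis_lt => v; rewrite !inE => /orP[/orP[]|] /eqP ->.
  have := cross_bound A disj.
  rewrite [#|_ :|: V 5%N|]cardsU disjoint_setI0 // cards0 subn0.
  rewrite [#|_ :|: V 4%N|]cardsU disjoint_setI0 // cards0 subn0.
  apply: leq_trans; rewrite !sum_setU //; apply: leq_add; first apply: leq_add.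
  - rewrite mulnC -sum_nat_const; apply: leq_sum => x x3; rewrite cross_deg ?in_setU ?x3 //.
      by move: x3; rewrite inE => /eqP ->.
    by move=> e w eA ew; rewrite inE; have := deg3 x x3 e w eA ew; lia.
  - rewrite mulnC -sum_nat_const; apply: leq_sum => x x4; rewrite cross_deg ?in_setU ?x4 ?orbT //.
      by move: x4; rewrite inE => /eqP ->.
    by move=> e w eA ew; rewrite inE; have := deg4 x x4 e w eA ew; lia.
  rewrite mulnC -sum_nat_const; apply: leq_sum => x x5.
  have x5' : edeg A x = 5%N by move: x5; rewrite inE => /eqP.
  pose C := cross A (V 3%N :|: V 4%N :|: V 5%N) (W 7%N).
  (* By [red5] at most one edge at [x] avoids [W 7], so at least four of its five edges are
     crossing. *)
  pose bad := [set e in A | (x \in val e) && (val e :&: W 7%N == set0)].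
  have bad1 : (#|bad| <= 1)%N.
    rewrite leqNgt; apply/negP => /card_gt1P[e [f [eb fb ef]]].
    move: eb fb; rewrite !inE => /and3P[eA xe /eqP e7] /and3P[fA xf /eqP f7].
    have [v ev] := other _ _ xe; have [w fw] := other _ _ xf.
    have small (g : edge G) y : y \in val g -> val g :&: W 7%N = set0 -> (edeg A y < 7)%N.
      move=> yg g7; rewrite ltnNge; apply/negP => y7.
      by have : y \in val g :&: W 7%N; [rewrite in_setI yg inE|rewrite g7 inE].
    have v7 : (edeg A v < 7)%N by apply: (small e); rewrite // ev set22.
    have w7 : (edeg A w < 7)%N by apply: (small f); rewrite // fw set22.
    have := red5 _ _ _ _ _ eA fA ef ev fw x5'.
    by clear -v7 w7 d2 dM; lia.
  have sub : [set e in A | x \in val e] \subset [set e in C | x \in val e] :|: bad.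
    apply/subsetP => e; rewrite inE => /andP[eA xe]; rewrite in_setU.
    have [e7|e7] := eqVneq (val e :&: W 7%N) set0; apply/orP; [right|left].
      by rewrite inE eA xe e7 eqxx.
    rewrite inE xe andbT inE eA e7 andbT; apply/set0Pn; exists x.
    by rewrite in_setI xe in_setU x5 orbT.
  have h : (5 <= edeg C x + #|bad|)%N.
    by rewrite -x5'; apply: leq_trans (subset_leq_card sub) _; rewrite cardsU; exact: leq_subr.
  by rewrite -/C; move: h bad1; move: (edeg C x) #|bad| => p q; clear; lia.
(* Summed over vertices of degree [k >= 3]: [6 + [k = 7] + 2[k >= 8] + 4[k >= M] <= k + 3[k = 3] +
   2[k = 4] + [k = 5]], with equality for [3 <= k <= 8]; the case [k = M] needs [M >= 12]. *)
have count : (6 * #|covered A| + #|V 7%N| + 2 * #|W 8%N| + 4 * #|W M| <=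
    2 * #|A| + 3 * #|V 3%N| + 2 * #|V 4%N| + #|V 5%N|)%N.
  have cardE (P : pred G) : #|[set v | P v]| = (\sum_v P v)%N.
    by rewrite -sum1_card big_mkcond; apply: eq_bigr => v _; rewrite inE; case: (P v).
  rewrite -sum_edeg_all !cardE !big_distrr -!big_split /=; apply: leq_sum => v _.
  have := deg_ge3 v; move: (edeg A v) => k; clear -M12.
  by case: (ltngtP k M); case: k => [|[|[|[|[|[|[|[|k]]]]]]]] //=; lia.
have W7 : (#|W 7%N| = #|V 7%N| + #|W 8%N|)%N.
  have -> : W 7%N = V 7%N :|: W 8%N.
    by apply/setP => v; rewrite !inE leq_eqVlt eq_sym.
  rewrite cardsU disjoint_setI0 ?cards0 ?subn0 //.
  by apply: dis_lt => v; rewrite inE => /eqP ->.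
have [tot _] := edge_sparse A0.
(* [4 b0 + b1 + b2] says that [3|V 3| + 2|V 4| + |V 5|] is at most [|V 7| + 2|W 8| + 4|W M|], while
   [count] and [tot] make it larger by at least 6. *)
by clear -count b0 b1 b2 W7 tot; lia.
Qed.

Lemma sparse_total_choosability d : (2 <= d)%N -> (5 * d + 2 <= max_degree G)%N ->
  (total_choosability d G <= max_degree G + 2 * d)%N.
Proof.
move=> d2 dM; rewrite /total_choosability; case: ex_minnP => m _; apply; apply/asboolP => L L_card.
have d0 : (0 < d)%N by exact: ltnW.
(* Minimality is over edge sets on the fixed vertex set; the bound [M] remains the maximum degree of
   the whole graph, so the lists keep their size. *)
have all A : labellable d L A.
  have [k] := ubnP #|A|; elim: k A => // k IH A Ak.
  have [A0|A0] := eqVneq A set0.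
    have [c cP] : exists c : element G -> int, forall x, c x \in L x.
      apply: (@fin_all_exists _ (fun=> int) (fun x z => z \in L x)) => x.
      have [|z zL _] := @fset_avoid (L x) [::]; last by exists z.
      by rewrite L_card addn_gt0 muln_gt0 d0 orbT.
    exists c; split=> // -[u|e] [v|e'] /=; rewrite A0 !inE //.
    by move=> _ _ _; apply/implyP => /existsP[e]; rewrite inE.
  apply: contrapT => nlab.
  have IHe e : e \in A -> labellable d L (A :\ e).
    by move=> eA; apply: IH; have := cardsD1 e A; rewrite eA; move: Ak; move: #|A| #|A :\ e|; lia.
  apply: (@discharging A (max_degree G) d) => //.
  - by move=> v; exact: edeg_max.
  - move=> e u v eA ev u3; rewrite leqNgt; apply/negP => h; apply: nlab.
    by apply: (reduce3 d0 L_card eA ev (IHe _ eA)) => //; move: h dM; clear; lia.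
  - move=> e u v eA ev u4; rewrite leqNgt; apply/negP => h; apply: nlab.
    by apply: (reduce4 d0 L_card eA ev (IHe _ eA)) => //; move: h dM d2; clear; lia.
  - move=> e f u v w eA fA ef ev fw u5.
    have [|h1] := ltnP (max_degree G) (edeg A v + 2 * d + 2); first by left.
    have [|h2] := ltnP (max_degree G) (edeg A w + 2 * d + 2); first by right.
    exfalso; apply: nlab; apply: (reduce5 d0 L_card eA ev (IHe _ eA) u5 _ h1 fA _ fw h2) => //.
      by move: dM d2; clear; lia.
    by rewrite eq_sym.
have [c [cL cP]] := all [set: edge G].
have inT x : x \in graph_elements [set: edge G] by rewrite inE; case: x => // e; rewrite inE.
exists c => //; split=> [u v uv|e e' ee' meet|u e ue].
- have uvE : [set u; v] \in edge_set G by apply/imsetP; exists (u, v).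
  have neq : inl u != inl v :> element G by apply: contraTneq uv => -[->]; rewrite adj_irr.
  have := cP _ _ (inT (inl u)) (inT (inl v)) neq => /implyP h; apply/eqP; apply: h.
  by apply/existsP; exists (Sub [set u; v] uvE : edge G); rewrite inE SubK eqxx.
- have neq : inr e != inr e' :> element G by apply: contra ee' => /eqP[->].
  by have := cP _ _ (inT (inr e)) (inT (inr e')) neq => /implyP/(_ meet)/eqP.
- by have := cP _ _ (inT (inl u)) (inT (inr e)) isT => /implyP/(_ ue).
Qed.

End Discharging.

(** * Embeddings *)

From mathcomp Require Import all_classical all_reals all_analysis.

Import numFieldNormedType.Exports.
Local Open Scope classical_set_scope.
Local Open Scope ring_scope.

(** Round [u] and [v] down and let the third number take the rest, which exceeds [w] by less than 2.
    If the excess is at least 1, pass one unit to the first number: then [u] has a positive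
    fractional part. *)
Lemma round3 (R : realType) (N : nat) (u v w : R) : 0 <= u -> 0 <= v -> 0 <= w ->
    u + v + w = N%:R ->
  exists p q r : nat, [/\ (p + q + r = N)%N, `|u - p%:R| < 1, `|v - q%:R| < 1 & `|w - r%:R| < 1].
Proof.
move=> u0 v0 w0 uvw.
have /andP[pu up] := truncn_itv u0; have /andP[qv vq] := truncn_itv v0.
move: (Num.trunc u) (Num.trunc v) pu up qv vq => p q pu up qv vq.
rewrite -natr1 in up; rewrite -natr1 in vq.
have pqN : (p + q <= N)%N by rewrite -(ler_nat R) natrD; lra.
have rE : (N - (p + q))%:R = N%:R - (p%:R + q%:R) :> R by rewrite natrB // natrD.
have [small|big] := ltP ((N - (p + q))%:R - w) 1.
  exists p, q, (N - (p + q))%N; split; [lia|..]; rewrite ltr_norml; lra.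
have rpos : (0 < N - (p + q))%N by rewrite -(ltr_nat R); lra.
exists p.+1, q, (N - (p + q)).-1; split; [lia|..]; rewrite ltr_norml.
- by rewrite -natr1; lra.
- by lra.
have -> : (N - (p + q)).-1%:R = (N - (p + q))%:R - 1 :> R by rewrite -[in RHS](prednK rpos) -natr1 addrK.
lra.
Qed.

(** * Open stars of grid points and hulls of connected sets *)

Section GridCover.
Variables (R : realType) (n N : nat) (K : {set {set 'I_n}}).
Hypothesis N0 : (0 < N)%N.
Hypothesis Ksurf : closed_surface_complex K.
Implicit Types (a b : gpoint n N) (x y : 'rV[R]_n).

(** For a vertex [a] of the subdivision, the trace of this set on the polyhedron is the open star of
    [a]. *)
Definition gball a : set 'rV[R]_n :=
  [set x | forall i, `|N%:R * x ord0 i - (a i)%:R| < 1].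

Lemma gball_open a : open (gball a).
Proof.
rewrite openE => x xa.
suff near_ i : \forall y \near x, `|N%:R * (y : 'rV[R]_n) ord0 i - (a i)%:R| < 1.
  exact: (@filter_forall _ _ (fun i (y : 'rV[R]_n) => `|N%:R * y ord0 i - (a i)%:R| < 1) (nbhs x)).
have cont : (fun z : R => `|N%:R * z - (a i)%:R|) @ x ord0 i --> `|N%:R * x ord0 i - (a i)%:R|.
  apply: cvg_norm; apply: cvgB; last exact: cvg_cst.
  by apply: cvgM; [exact: cvg_cst|exact: cvg_id].
have cont' : (fun y : 'rV[R]_n => `|N%:R * y ord0 i - (a i)%:R|) @ x --> `|N%:R * x ord0 i - (a i)%:R|.
  exact: cvg_comp (@coord_continuous R 1 n ord0 i x) cont.
exact: (cvgr_lt _ cont' 1 (xa i)).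
Qed.

Lemma gball_dist a x y i : gball a x -> gball a y -> `|x ord0 i - y ord0 i| < 2 / N%:R.
Proof.
move=> /(_ i) xa /(_ i) ya.
have Npos : (0 : R) < N%:R by rewrite ltr0n.
rewrite ltr_pdivlMr // -[in X in _ * X](gtr0_norm Npos) -normrM.
move: xa ya; rewrite !ltr_norml => /andP[? ?] /andP[? ?]; apply/andP; split; lra.
Qed.

Lemma gball_supp a x : gball a x -> forall i, a i != 0%N :> nat -> x ord0 i != 0.
Proof.
move=> /(_ _) xa i ai; apply: contraTneq (xa i) => ->; rewrite mulr0 sub0r normrN -leNgt.
by rewrite normr_nat ler1n lt0n.
Qed.

Lemma polyhedron_triangle x : polyhedron R K x -> exists i j k,
  [/\ [set i; j; k]%SET \in triangles_of K, [/\ i != j, j != k & i != k],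
   forall l, l \notin [set i; j; k]%SET -> x ord0 l = 0 & forall l, 0 <= x ord0 l].
Proof.
case=> x0 _ [s sK xs]; have [t tF /fintype.subsetP st] := surface_pure Ksurf sK.
have [i [j [k [tE ij jk ik]]]] := triangleP (surface_two_sided Ksurf) tF; subst t.
exists i, j, k; split=> // l lt; apply: xs; apply: contra lt; exact: st.
Qed.

Lemma gball_cover x : polyhedron R K x -> exists2 a, on_grid a & gball a x.
Proof.
move=> xP; have [i [j [k [tF [ij jk ik] out x0]]]] := polyhedron_triangle xP.
case: xP => _ x1 _.
have sum : x ord0 i + x ord0 j + x ord0 k = 1.
  rewrite -[RHS]x1 (bigD1 i) //= (bigD1 j) /= 1?eq_sym // (bigD1 k) /= ?big1 ?addr0 ?addrA //.
    by move=> l /andP[/andP[li lj] lk]; apply: out; rewrite !inE !negb_or li lj lk.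
  by rewrite eq_sym ik eq_sym jk.
have [||||p [q [r [pqr hp hq hr]]]] := @round3 R N (N%:R * x ord0 i) (N%:R * x ord0 j) (N%:R * x ord0 k);
  rewrite ?mulr_ge0 //; first by rewrite -!mulrDr sum mulr1.
have [pi pj pk ps pN] := pt3P N0 ij jk ik pqr.
exists (pt3 N i j k p q r) => // l.
have [|lt] := boolP (l \in [set i; j; k]%SET); last first.
  by rewrite out // mulr0 (gsupp_out ps lt) subrr normr0.
by rewrite !inE => /orP[/orP[]|] /eqP ->; rewrite ?pi ?pj ?pk.
Qed.

(** A common point [x] forces the supports of [a] and [b] into a triangle carrying [x], and the
    coordinates of [a] and [b] differ by less than 2. *)
Lemma gball_nerve a b x : polyhedron R K x -> on_grid a -> on_grid b -> gball a x -> gball b x ->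
  a != b -> [set a; b]%SET \in edges_of (grid_complex N K).
Proof.
move=> xP aN bN ax bx ab; have [i [j [k [tF _ out x0]]]] := polyhedron_triangle xP.
have supp c : gball c x -> gsupp c \subset [set i; j; k]%SET.
  move=> cx; apply/fintype.subsetP => l; rewrite [l \in gsupp c]inE => /(gball_supp cx).
  by apply: contraNT => /out ->.
apply: (grid_edge N0 Ksurf tF) => //; try exact: supp.
have near_ (c d : gpoint n N) l : gball c x -> gball d x -> (c l <= d l + 1)%N.
  move=> /(_ l) + /(_ l); rewrite !ltr_norml => /andP[? ?] /andP[? ?].
  have : (c l)%:R < (d l + 2)%:R :> R by rewrite natrD; lra.
  by rewrite ltr_nat addn2 ltnS addn1.
by apply/gcloseP => l; split; exact: near_.
Qed.

Definition grid_hull (A : set 'rV[R]_n) : {set gpoint n N} :=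
  [set a | on_grid a && `[< exists2 x, A x & gball a x >]]%SET.

Lemma grid_hullP A a : reflect (on_grid a /\ exists2 x, A x & gball a x) (a \in grid_hull A).
Proof.
rewrite inE; apply: (iffP andP) => [[aN /asboolP ?]|[aN ?]]; first by [].
by split=> //; apply/asboolP.
Qed.

(** The stars of the points reachable from [a] and those of the other hull points form two open sets
    that cover [A] and, by [gball_nerve], do not meet on [A]. *)
Lemma grid_hull_connected A : A `<=` polyhedron R K -> connected A ->
  connected_in (edges_of (grid_complex N K)) (grid_hull A).
Proof.
move=> AP Aconn a b aA bA; apply: contrapT => /negP nab.
pose adj := adj_in (edges_of (grid_complex N K)) (grid_hull A).
pose O1 := \bigcup_(c in [set c | c \in grid_hull A /\ connect adj a c]) gball c.
pose O2 := \bigcup_(c in [set c | c \in grid_hull A /\ ~~ connect adj a c]) gball c.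
have O1open : open O1 by apply: bigcup_open => c _; exact: gball_open.
have O2open : open O2 by apply: bigcup_open => c _; exact: gball_open.
have sep x : A x -> O1 x -> O2 x -> False.
  move=> xA [c [cA ac] cx] [d [dA ad] dx]; move/negP: (ad); apply.
  apply: connect_trans (ac) _; apply: connect1; rewrite /adj /adj_in /= cA dA /=.
  move/grid_hullP: (cA) => [cN _]; move/grid_hullP: (dA) => [dN _].
  have cd : c != d by apply: contraNneq ad => <-.
  exact: (gball_nerve (AP _ xA) cN dN cx dx cd).
have all x : A x -> O1 x \/ O2 x.
  move=> xA; have [c cN cx] := gball_cover (AP _ xA).
  have cA : c \in grid_hull A by apply/grid_hullP; split=> //; exists x.
  by have [ac|ac] := boolP (connect adj a c); [left|right]; exists c.
have /grid_hullP[_ [x xA xa]] := aA; have /grid_hullP[_ [y yA yb]] := bA.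
have : A `&` O1 = A.
  apply: Aconn.
  - by exists x; split=> //; exists a => //; split.
  - by exists O1.
  - exists (~` O2); first exact: open_closedC.
    apply/seteqP; split=> z [zA zO]; split=> //; first by move=> zO2; exact: sep zA zO zO2.
    by have [] := all _ zA.
move=> /seteqP[_ /(_ _ yA)[_ yO1]]; apply: (sep y yA yO1).
by exists b.
Qed.

End GridCover.

Lemma rV_hausdorff (R : realType) (n : nat) : hausdorff_space 'rV[R]_n.
Proof.
rewrite ball_hausdorff => a b ab.
have [i abi] : exists i, a ord0 i != b ord0 i.
  apply: contrapT => nex; move/eqP: ab; apply; apply/rowP => i.
  by apply: contrapT => ne; apply: nex; exists i; apply/eqP.
have e0 : 0 < `|a ord0 i - b ord0 i| / 2 by rewrite divr_gt0 // normr_gt0 subr_eq0.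
exists (PosNum e0, PosNum e0); apply/eqP; apply/seteqP; split=> // x /= [[_ /(_ ord0 i) ax] [_ /(_ ord0 i) bx]].
move: ax bx; rewrite /ball /= => ax bx.
have := ler_distD (x ord0 i) (a ord0 i) (b ord0 i); rewrite (distrC (x ord0 i)).
by move: ax bx; lra.
Qed.

(** The radius is quantified by a filter so that finitely many pairs of pieces can share one [e]. *)
Lemma compact_separated (R : realType) (T : pseudoMetricType R) (A B : set T) :
    hausdorff_space T -> compact A -> compact B -> A `&` B = set0 ->
  \forall e \near (0 : R)^'+, forall x, A x -> forall y, B y -> ~ ball x e y.
Proof.
move=> haus Ac Bc AB.
have Bcl : closed B by exact: compact_closed.
have /compact_near_coveringP/(_ R (0^'+)) := Ac.
move=> /(_ (fun e x => forall y, B y -> ~ ball x e y)); apply.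
move=> x xA.
have : nbhs x (~` B).
  apply: open_nbhs_nbhs; split; first exact: closed_openC.
  by move=> xB; have : (A `&` B) x by []; rewrite AB.
move=> /nbhs_ballP[d /= d0 dB].
have d20 : 0 < d / 2 by rewrite divr_gt0.
exists (ball x (d / 2), [set e | e < d / 2]).
  by split=> /=; [exact: nbhsx_ballx|exact: nbhs_right_lt].
move=> [x' e] /= [xx' ed] y yB x'y.
apply: (dB y) => //; rewrite [d]splitr.
by apply: ball_triangle xx' _; apply: le_ball x'y; exact: ltW.
Qed.

Lemma thirds_apart (R : realType) (t t' : R) : t = t' -> t <= 1 / 3 -> 2 / 3 <= t' -> False.
Proof. by move=> -> *; lra. Qed.

Lemma thirds_ends (R : realType) : ((1 : R) <= 1 / 3) = false /\ (2 / 3 <= (0 : R)) = false.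
Proof. by split; apply/negbTE; rewrite -ltNge; lra. Qed.

(** * From a drawing to a minor of the subdivision *)

Section EmbeddingMinor.
Variables (R : realType) (n : nat) (K : {set {set 'I_n}}) (G : sgraph).
Hypothesis Ksurf : closed_surface_complex K.
Variables (P : G -> 'rV[R]_n) (c : edge G -> R -> 'rV[R]_n) (tail head : edge G -> G).
Hypothesis P_poly : forall v, polyhedron R K (P v).
Hypothesis c_poly : forall e t, polyhedron R K (c e t).
Hypothesis P_inj : injective P.
Hypothesis c_cont : forall e, {within `[0, 1], continuous (c e)}.
Hypothesis c_inj : forall e, set_inj `[0, 1] (c e).
Hypothesis endsE : forall e : edge G, val e = [set tail e; head e]%SET.
Hypothesis c_0 : forall e, c e 0 = P (tail e).
Hypothesis c_1 : forall e, c e 1 = P (head e).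
Hypothesis c_P : forall e t v, `]0, 1[%classic t -> c e t <> P v.
Hypothesis c_c : forall e e' t t', e != e' -> `]0, 1[%classic t -> `]0, 1[%classic t' -> c e t <> c e' t'.

Let tail_head e : tail e != head e.
Proof. by have := edge_set_card2 (valP e); rewrite endsE cards2; case: eqP. Qed.

Let seg (k : 'I_3) : set R := `[k%:R / 3, k.+1%:R / 3]%classic.

Let piece (j : G + edge G * 'I_3) : set 'rV[R]_n :=
  match j with inl v => [set P v] | inr (e, k) => c e @` seg k end.

(** End thirds belong to the vertex at their end of the arc; the unowned middle thirds, which avoid
    all vertices and all other arcs, serve as the connecting sets [Y]. *)
Let owner (j : G + edge G * 'I_3) : option G :=
  match j with
  | inl v => Some v
  | inr (e, k) => if k == 0%N :> nat then Some (tail e)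
                  else if k == 2%N :> nat then Some (head e) else None
  end.

Let segP (k : 'I_3) t : seg k t -> [/\ (0 <= t <= 1) , k == 0%N :> nat -> t <= 1 / 3,
   k == 2%N :> nat -> 2 / 3 <= t & k == 1%N :> nat -> 0 < t < 1 ].
Proof.
rewrite /seg /= in_itv /=; case: k => -[|[|[|//]]] /= _ /andP[lo hi]; split=> // *; lra.
Qed.

Let seg_sub (k : 'I_3) : seg k `<=` `[0, 1]%classic.
Proof. by move=> t /segP[h _ _ _]; rewrite /= in_itv. Qed.

Let piece_compact j : compact (piece j).
Proof.
case: j => [v|[e k]] /=; first exact: compact_set1.
apply: continuous_compact; last exact: segment_compact.
exact: continuous_subspaceW (@seg_sub k) (@c_cont e).
Qed.

Let piece_connected j : connected (piece j).
Proof.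
case: j => [v|[e k]] /=; first exact: connected1.
apply: connected_continuous_connected; first exact: segment_connected.
exact: continuous_subspaceW (@seg_sub k) (@c_cont e).
Qed.

Let piece_poly j : piece j `<=` polyhedron R K.
Proof. by case: j => [v|[e k]] x /= => [->|[t _ <-]]. Qed.

(** Meaningful only at [t = 0] and [t = 1]. *)
Let endpt e (t : R) := if t == 0 then tail e else head e.

Let cE e (t : R) : 0 <= t <= 1 -> `]0, 1[%classic t \/ ((t = 0 \/ t = 1) /\ c e t = P (endpt e t)).
Proof.
move=> /andP[t0 t1]; have [->|tn0] := eqVneq t 0.
  by right; split; [left|rewrite c_0 /endpt eqxx].
have [->|tn1] := eqVneq t 1.
  by right; split; [right|rewrite c_1 /endpt oner_eq0].
by left; rewrite /= in_itv /= !lt_neqAle t0 t1 tn1 eq_sym tn0.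
Qed.

Let c_meet e e' (t t' : R) : 0 <= t <= 1 -> 0 <= t' <= 1 -> c e t = c e' t' ->
  (e = e' /\ t = t') \/ [/\ t = 0 \/ t = 1, t' = 0 \/ t' = 1 & endpt e t = endpt e' t'].
Proof.
move=> ht ht' cc; have [ee|ee] := eqVneq e e'.
  by subst e'; left; split=> //; apply: (c_inj _ _ cc); rewrite inE /= in_itv.
right; case: (cE e ht) => [ti|[t01 ct]]; case: (cE e' ht') => [ti'|[t01' ct']].
- by case: (c_c ee ti ti').
- by case: (@c_P e t (endpt e' t') ti); rewrite cc.
- by case: (@c_P e' t' (endpt e t) ti'); rewrite -cc.
- by split=> //; apply: P_inj; rewrite -ct -ct'.
Qed.

Let P_meet e (t : R) v : 0 <= t <= 1 -> c e t = P v -> (t = 0 \/ t = 1) /\ endpt e t = v.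
Proof.
move=> ht cv; case: (cE e ht) => [ti|[t01 ct]]; first by case: (@c_P e t v ti).
by split=> //; apply: P_inj; rewrite -ct.
Qed.

Let owner_piece e (k : 'I_3) t v : seg k t -> owner (inr (e, k)) = Some v ->
  (v = tail e /\ t <= 1 / 3) \/ (v = head e /\ 2 / 3 <= t).
Proof.
move=> /segP[_ k0 k2 _] /=; case: ifP => [/k0 t3 [<-]|_]; first by left.
by case: ifP => // /k2 t3 [<-]; right.
Qed.

Let owner_end e (k : 'I_3) t v : seg k t -> owner (inr (e, k)) = Some v -> t = 0 \/ t = 1 ->
  endpt e t = v.
Proof.
move=> tk ov t01; rewrite /endpt; case: (owner_piece tk ov) => -[-> ht]; case: t01 ht => ->.
- by rewrite eqxx.
- by have [-> _] := thirds_ends R.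
- by have [_ ->] := thirds_ends R.
- by rewrite oner_eq0.
Qed.

Let owner_meet j j' v w x : piece j x -> piece j' x -> owner j = Some v -> owner j' = Some w -> v = w.
Proof.
case: j => [u|[e k]]; case: j' => [u'|[e' k']].
- by move=> -> /P_inj ->  [<-] [<-].
- move=> -> [t tk ct] [<-] ow; have [t01 _ _ _] := segP tk.
  have [tt <-] := P_meet t01 ct; exact: owner_end ow tt.
- move=> [t tk <-] ct ov [<-]; have [t01 _ _ _] := segP tk.
  have [tt <-] := P_meet t01 ct; apply/esym; exact: owner_end ov tt.
move=> [t tk <-] [t' tk' /esym cc] ov ow.
have [t01 _ _ _] := segP tk; have [t01' _ _ _] := segP tk'.
have [[ee tt]|[tt tt' ends]] := c_meet t01 t01' cc.
  subst e' t'; case: (owner_piece tk ov) => -[-> h1]; case: (owner_piece tk' ow) => -[-> h2] //; exfalso.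
    exact: thirds_apart erefl h1 h2.
  exact: thirds_apart erefl h2 h1.
by rewrite -(owner_end tk ov tt) -(owner_end tk' ow tt').
Qed.

Let mid : 'I_3 := Ordinal (isT : (1 < 3)%N).

Let mid_meet e j x : piece (inr (e, mid)) x -> piece j x ->
  (forall w, owner j = Some w -> w \in val e) /\ (forall e', j = inr (e', mid) -> e = e').
Proof.
move=> [t tk <-] xj; have [t01 _ _ /(_ isT)/andP[t0 t1]] := segP tk.
have no : ~ (t = 0 \/ t = 1) by case=> tt; move: t0 t1; rewrite tt ltxx.
case: j xj => [u cu|[e' k] [t' tk' /esym cc]]; first by case: no; have [] := P_meet t01 cu.
have [t01' _ _ _] := segP tk'.
have [[ee tt]|[//]] := c_meet t01 t01' cc; subst e' t'; split=> [w ow|e' [] //].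
by rewrite endsE !inE; case: (owner_piece tk' ow) => -[-> _]; rewrite eqxx ?orbT.
Qed.

Lemma embedding_minor : exists N (beta : gpoint n N -> option G),
  (0 < N)%N /\ minor_model (edges_of (grid_complex N K)) (edge_set G) beta.
Proof.
have sep : \forall e \near (0 : R)^'+, forall jj : (G + edge G * 'I_3) * (G + edge G * 'I_3),
    piece jj.1 `&` piece jj.2 = set0 ->
    forall x, piece jj.1 x -> forall y, piece jj.2 y -> ~ ball x e y.
  apply: filter_forall => -[j j'] /=.
  have [dis|ndis] := pselect (piece j `&` piece j' = set0); last by near=> e.
  near=> e => _; near: e; apply: compact_separated => //; exact: rV_hausdorff.
have [eps [eps0 epsP]] : exists eps : R, 0 < eps /\ forall j j', piece j `&` piece j' = set0 ->
    forall x, piece j x -> forall y, piece j' y -> ~ ball x eps y.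
  near (0 : R)^'+ => eps; exists eps; split; first by [].
  by move=> j j'; have := near sep eps; move=> /(_ _ (j, j')); apply.
have e20 : 0 < eps / 2 by rewrite divr_gt0.
(* Points of one ball are within [2 / N] in each coordinate, so with [N = m + 1] two pieces whose
   hulls share a grid point come within [eps], and therefore meet. *)
have [m mP] : exists m : nat, m.+1%:R^-1 < eps / 2.
  by have [m _ /(_ m (leqnn _))] := near_infty_natSinv_lt (PosNum e20); exists m.
pose N := m.+1.
pose hull j : {set gpoint n N} := grid_hull N (piece j).
have hull_meet j j' a : a \in hull j -> a \in hull j' -> exists2 x, piece j x & piece j' x.
  move=> /grid_hullP[_ [x xj xa]] /grid_hullP[_ [y yj ya]]; apply: contrapT => nex.
  have dis : piece j `&` piece j' = set0.
    by apply/seteqP; split=> // z [zj zj']; apply: nex; exists z.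
  apply: (epsP _ _ dis x xj y yj); split=> // i0 i; rewrite (ord1 i0) /ball /=.
  apply: lt_trans (gball_dist (ltn0Sn m) i xa ya) _.
  by move: mP; rewrite -/N; lra.
have hull_ex j x : piece j x -> exists2 a, a \in hull j & forall j', piece j' x -> a \in hull j'.
  move=> xj; have [a aN ax] := gball_cover (ltn0Sn m) Ksurf (piece_poly xj).
  by exists a => [|j' xj']; apply/grid_hullP; split=> //; exists x.
pose X v : {set gpoint n N} := [set a | [exists j, (owner j == Some v) && (a \in hull j)]]%SET.
pose Y e : {set gpoint n N} := hull (inr (e, mid)).
have XP v a : reflect (exists2 j, owner j = Some v & a \in hull j) (a \in X v).
  rewrite inE; apply: (iffP existsP) => [[j /andP[/eqP ? ?]]|[j oj aj]]; first by exists j.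
  by exists j; rewrite oj eqxx.
have hull_conn j : connected_in (edges_of (grid_complex N K)) (hull j).
  exact: (grid_hull_connected (ltn0Sn m) Ksurf (@piece_poly j) (@piece_connected j)).
have P_in j v : owner j = Some v -> piece j (P v).
  case: j => [u [<-]//|[e [[|[|[|//]]] /= k3]]] //= [<-].
    by exists 0; rewrite ?c_0 // /seg /= in_itv /=; lra.
  by exists 1; rewrite ?c_1 // /seg /= in_itv /=; lra.
have [|||||||beta betaP] := @minor_from_sets (gpoint n N) G (edge G)
    (edges_of (grid_complex N K)) val X Y tail head endsE tail_head.
(* All pieces owned by [v] contain [P v], so their connected hulls share a grid point [p]. *)
- move=> v a b /XP[j oj aj] /XP[j' oj' bj'].
  have [p pP pall] := @hull_ex (inl v) (P v) erefl.
  have sub i : owner i = Some v -> hull i \subset X v.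
    by move=> oi; apply/fintype.subsetP => x xi; apply/XP; exists i.
  apply: (@connect_trans _ _ p).
    by apply: connect_adj_sub (sub j oj) _; apply: hull_conn => //; apply: pall; exact: P_in.
  by apply: connect_adj_sub (sub j' oj') _; apply: hull_conn => //; apply: pall; exact: P_in.
- move=> v w a /XP[j oj aj] /XP[j' oj' aj']; have [x xj xj'] := hull_meet _ _ _ aj aj'.
  exact: owner_meet xj xj' oj oj'.
- by move=> e; exact: hull_conn.
(* The arc point at [1 / 3] lies both in the middle third and in the third owned by the tail. *)
- move=> e; have [|a aY aall] := @hull_ex (inr (e, mid)) (c e (1 / 3)).
    by exists (1 / 3) => //; rewrite /seg /= in_itv /=; lra.
  exists a => //; apply/XP; exists (inr (e, ord0)) => //; apply: aall.
  by exists (1 / 3) => //; rewrite /seg /= in_itv /=; lra.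
- move=> e; have [|a aY aall] := @hull_ex (inr (e, mid)) (c e (2 / 3)).
    by exists (2 / 3) => //; rewrite /seg /= in_itv /=; lra.
  exists a => //; apply/XP; exists (inr (e, ord_max)) => //; apply: aall.
  by exists (2 / 3) => //; rewrite /seg /= in_itv /=; lra.
- move=> e v a aY /XP[j oj aj]; have [x xY xj] := hull_meet _ _ _ aY aj.
  by have [h _] := mid_meet xY xj; apply: h.
- move=> e e' a aY aY'; have [x xY xY'] := hull_meet _ _ _ aY aY'.
  by have [_ h] := mid_meet xY xY'; apply: h.
exists N, beta; split=> //; apply: betaP => e eG.
by exists (Sub e eG : edge G).
Unshelve. all: by end_near.
Qed.

End EmbeddingMinor.

(** The homeomorphism moves the drawing onto the polyhedron, where the grid minor is found; the
    subdivision inherits the bound on [H^1] from [K]. *)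
Lemma embedded_sparse (R : realType) (G : sgraph) (S : topologicalType) (eps : int)
    (A : {set {set G}}) : has_euler_char R S eps -> 0 < eps -> embedded_in R G S ->
  A \subset edge_set G -> sparse_edges A.
Proof.
move=> [n [K [Ksurf homeo chi]]] eps0 [pos [arc [pos_inj arc_cont arc_ends arc_pos arc_arc]]] AG.
have [f [g [[_ g_cont] _ g_poly _ fg]]] := homeo.
have g_inj : injective g by move=> x y gxy; rewrite -(fg x) // gxy fg.
have {}g_cont : continuous g by apply/continuous_subspace_setT.
have [ht htP] : exists ht : edge G -> G * G, forall e, [/\ val e = [set (ht e).1; (ht e).2]%SET,
    arc e 0 = pos (ht e).1 & arc e 1 = pos (ht e).2].
  apply: (@fin_all_exists _ (fun=> (G * G)%type) (fun e p => [/\ val e = [set p.1; p.2]%SET,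
    arc e 0 = pos p.1 & arc e 1 = pos p.2])) => e.
  by have [u [v h]] := arc_ends e; exists (u, v).
have [||||||||||N [beta [N0 [bconn bedge]]]] := @embedding_minor R n K G Ksurf (fun v => g (pos v))
   (fun e t => g (arc e t)) (fun e => (ht e).1) (fun e => (ht e).2).
- by move=> v; apply: g_poly.
- by move=> e t; apply: g_poly.
- by move=> u v /g_inj/pos_inj.
- move=> e; have [cont _] := arc_cont e; move=> x.
  exact: (continuous_comp (cont x) (g_cont _)).
- by move=> e x y xI yI /g_inj; have [_ inj] := arc_cont e; exact: inj.
- by move=> e; have [] := htP e.
- by move=> e; have [_ ->] := htP e.
- by move=> e; have [_ _ ->] := htP e.
- by move=> e t v ht01 /g_inj; exact: arc_pos.
- by move=> e e' t t' ee h1 h2 /g_inj; exact: arc_arc.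
have KH1 : H1_index_le2 (edges_of K) (triangles_of K) by apply: surface_H1 => //; rewrite chi.
apply: (minor_sparse (grid_two_sided N0 Ksurf) (grid_H1 N0 Ksurf KH1)).
  by move=> e eA; apply: edge_set_card2; apply: (fintype.subsetP AG).
by split; [exact: bconn|move=> e eA; apply: bedge; apply: (fintype.subsetP AG)].
Qed.

Theorem theorem1p2 (R : realType) (d : nat) (G : sgraph) (S : topologicalType)
    (eps : int) (hd : (2 <= d)%N) (hS : closed_surface R S)
    (hchi : has_euler_char R S eps) (heps : (0 < eps)%R)
    (hG : embedded_in R G S) (hDelta : (5 * d + 2 <= max_degree G)%N) :
  (total_choosability d G <= max_degree G + 2 * d)%N.
Proof.
by apply: sparse_total_choosability => // B; exact: (embedded_sparse hchi).
Qed.
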